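(* For all sufficiently large $n$, $$f(n)>0.76898\,\frac{n}{\log n}.$$
   Context: The divisor graph of order $n$ is the graph with vertices $1,2,\ldots,n$ and an edge between two distinct vertices $j,k$ if and only if $j\mid k$ or $k\mid j$. $f(n)$ is the maximal number of vertices in a simple path (a path with no repeated vertex) of the divisor graph of order $n$. *)

(* Defs.v *)
From mathcomp Require Import all_boot.

Set Implicit Arguments.
Unset Strict Implicit.
Unset Printing Implicit Defensive.

Definition divisor_adj : rel nat :=
  [rel j k | (j != k) && ((j %| k) || (k %| j))].

Definition simple_divisor_path (n : nat) (s : seq nat) : bool :=
  [&& all (fun k => 0 < k <= n) s, uniq s & sorted divisor_adj s].

(* Ranging over tuples of length m <= n with entries in 'I_n.+1 loses nothing:
   see [leq_divisor_path_max] and [divisor_path_max_attained]. *)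
Definition divisor_path_max (n : nat) : nat :=
  \max_(m < n.+1
    | [exists t : m.-tuple 'I_n.+1, simple_divisor_path n (map val t)]) m.

Lemma leq_divisor_path_max n s :
  simple_divisor_path n s -> size s <= divisor_path_max n.
Proof.
move=> Ps; have /and3P[/allP s_n s_uniq _] := Ps.
have s_small: size s < n.+1.
  rewrite ltnS -(size_iota 1 n); apply: uniq_leq_size => // k /s_n.
  by rewrite mem_iota add1n ltnS.
rewrite /divisor_path_max.
rewrite (bigD1 (Ordinal s_small)) /= ?leq_maxl //.
apply/existsP; exists (map_tuple inord (in_tuple s)).
rewrite /= -map_comp map_id_in // => k /s_n /andP[_ k_n].
by rewrite /= inordK.
Qed.

Lemma divisor_path_max_attained n :
  exists2 s, simple_divisor_path n s & size s = divisor_path_max n.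
Proof.
rewrite /divisor_path_max; apply: (big_ind
  (fun m => exists2 s, simple_divisor_path n s & size s = m)) => [|x y [s Ps <-] [t Pt <-]|m].
- by exists [::].
- by case: (leqP (size s) (size t)) => _; [exists t | exists s].
- by case/existsP=> t Pt; exists (map val t); rewrite // size_map size_tuple.
Qed.

(* Main.v *)
(* A long path is assembled from blocks.  For a squarefree product Q of primes above 17, the block
   of Q runs from Q to 2 Q.  It contains Q times a long path from 3 to 2 through 17-smooth numbers,
   and the blocks of the products Q d with d < P^-(Q) prime and 2 d^2 Q <= x, consecutive ones
   being linked through a multiple e Q d d' with e = 1 or 2.  Hence the longest path has at least
   as many vertices as the sum, over all Q so reached, of the lengths of the smooth paths.

   Build Q by adjoining its primes in ascending order, and count Q with the smooth paths up to 2 t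
   as long as every prime is at most t times the product of the smaller ones.  The last prime is
   counted by Chebyshev's bound.  For the others, let Pi_m = prod (1 + 1/p)^-1 and
   L_m = sum ln p / (p + 1) over the primes 17 < p <= m.  A product n whose next prime must exceed m
   carries the potential (Pi_m / n) (ln n - L_m + k): skipping or adjoining the next prime p
   replaces (n, m) by (n, p) and (n p, p), and the potential is exactly additive under this step.
   It is a lower bound as long as n <= x^(J1/K).  Above that size the bound comes from a table
   indexed by the K-cells of ln n / ln x and ln p / ln x and computed with Mertens' theorem.  The
   constants then follow from prod (1 - 1/p)^-1 >= 1.586 ln m - C and from pi(y) >= 0.92 y / ln y
   up to lower order terms. *)
From Stdlib Require Import NArith.
Require Import Defs.
From mathcomp Require Import all_boot zify.

Set Implicit Arguments.
Unset Strict Implicit.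
Unset Printing Implicit Defensive.

(** * Paths through products of large primes *)

(** The tree of blocks adjoins primes in descending order, each subject to 2 d^2 Q <= x, whereas the
    count adjoins them in ascending order. Density reconciles the two: if d is a prime of n, Q the
    product of the larger primes of n and S that of the smaller ones, then d <= t S gives 2 d^2 Q <=
    2 t S d Q = 2 t n <= x. With the other primes fixed, of product n, the last prime q runs up to x
    / (2 t n), so the count is about x / ln x times a sum of terms 1 / (2 t n). Adjoining a prime p
    divides such a term by p, and the potential is a harmonic function of this branching process.
    The cutoff at x destroys the harmonicity for large n. There the table takes over: its cells have
    logarithmic width ln x / K, beside which the bounded errors in Mertens' theorem vanish as x
    grows. The table thus supplies boundary values for the potential, and strict slack in the
    leading terms absorbs all lower order ones. *)

Lemma divisor_adjC a b : divisor_adj a b = divisor_adj b a.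
Proof. by rewrite /divisor_adj /= eq_sym orbC. Qed.

Lemma divisor_adj_dvd a b : a %| b -> a != b -> divisor_adj a b.
Proof. by rewrite /divisor_adj /= => -> ->. Qed.

Lemma divisor_adj_mul Q a b :
  0 < Q -> divisor_adj (Q * a) (Q * b) = divisor_adj a b.
Proof. by move=> Q0; rewrite /divisor_adj /= eqn_pmul2l // !dvdn_pmul2l. Qed.

Section Blocks.
Variables (z x : nat) (leaf : nat -> seq nat).
Hypothesis z_ge6 : 6 <= z.
Hypothesis leafP : forall Q, 0 < Q -> 12 * Q <= x ->
  [/\ sorted divisor_adj (leaf Q), uniq (leaf Q),
      head 0 (leaf Q) = 3 /\ last 0 (leaf Q) = 2 &
      forall k, k \in leaf Q ->
        [/\ 1 < k, k != 6, k * Q <= x & forall p, prime p -> p %| k -> p <= z]].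

(** The condition passes to smaller d, so the children of Q are an initial segment of the available
    primes and the chain through their blocks has no gaps. *)
Definition child Q d := 2 * (d * d * Q) <= x.

Lemma child_leq Q d e a : child Q d -> a <= d -> e <= 2 -> e * (Q * d) * a <= x.
Proof.
move=> chd ad e2; apply: leq_trans chd.
have -> : 2 * (d * d * Q) = 2 * (Q * d) * d by clear; lia.
by rewrite !leq_mul.
Qed.

Lemma child_sub Q d d' : child Q d -> d' <= d -> child Q d'.
Proof. by move=> chd d'd; apply: leq_trans chd; rewrite !leq_mul. Qed.

Lemma child_bound Q d k : child Q d -> k <= 2 * d -> k * (Q * d) <= x.
Proof.
move=> chd kd; apply: leq_trans chd.
have -> : 2 * (d * d * Q) = 2 * d * (Q * d) by clear; lia.
by rewrite leq_mul.
Qed.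

Fixpoint weight Q (ds : seq nat) : nat :=
  if ds is d :: ds' then weight Q ds' + child Q d * weight (Q * d) ds'
  else (size (leaf Q)).+1.

Definition inblock (ds : seq nat) Q v :=
  exists2 w, v = Q * w &
    [/\ 0 < w, v <= x & forall p, prime p -> p %| w -> p <= z \/ p \in ds].

(** Two vertices are left free for the surroundings: [6 * Q], through which a parent may return from
    its chain to its smooth path, and [c] times Q times the largest prime of [ds], the link to the
    next block. Here [c] tells at which end, Q or 2 Q, the block will be left. *)
Definition block ds Q c (s : seq nat) :=
  [/\ [/\ 0 < size s, head 0 s = Q & last 0 s = 2 * Q],
      sorted divisor_adj s, uniq s,
      forall v, v \in s -> inblock ds Q v &
      [/\ 6 * Q \notin s, c * Q * head 0 ds \notin s &
          weight Q ds <= (size s).+1]].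

(** The link that arrives from the preceding block fixes the coefficient [c] of the first vertex;
    the coefficient [e] of the last one is whatever the traversal yields. That every vertex is a
    multiple of some Q d' keeps the chain apart from Q times the smooth path. The last bound leaves
    room for Q and its smooth path, which are appended later. *)
Definition chain (ds : seq nat) Q c (s : seq nat) :=
  exists e d, [/\ [/\ e \in [:: 1; 2], d \in ds & 6 * (Q * d) \notin s],
      [/\ 0 < size s, head 0 s = c * (Q * head 0 ds) & last 0 s = e * (Q * d)],
      sorted divisor_adj s /\ uniq s,
      forall v, v \in s -> inblock ds Q v /\ exists2 d', d' \in ds & Q * d' %| v &
      weight Q ds <= (size s + size (leaf Q)).+2].

Lemma inblock_cons d ds Q v :
  z < d -> 0 < Q -> prime d -> inblock ds (Q * d) v -> inblock (d :: ds) Q v.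
Proof.
move=> zd Q0 pd [w -> [w0 vx Pw]]; exists (d * w); first by rewrite mulnA.
split=> [||p pp]; [by rewrite muln_gt0 w0 prime_gt0 | by []|].
rewrite Euclid_dvdM // => /orP[|/(Pw _ pp)[]]; last 2 first.
- by left.
- by move=> h; right; rewrite inE h orbT.
by rewrite dvdn_prime2 // => /eqP ->; right; rewrite mem_head.
Qed.

Lemma inblock_sub d ds Q v : inblock ds Q v -> inblock (d :: ds) Q v.
Proof.
move=> [w -> [w0 vx Pw]]; exists w => //; split=> // p pp /(Pw _ pp)[]; first by left.
by move=> h; right; rewrite inE h orbT.
Qed.

Lemma inblock_ndvd d ds Q v :
  z < d -> prime d -> d \notin ds -> 0 < Q -> inblock ds Q v -> ~~ (Q * d %| v).
Proof.
move=> zd pd dN Q0 [w -> [w0 vx Pw]]; rewrite dvdn_pmul2l //; apply/negP=> dw.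
by case: (Pw _ pd dw) => [|h]; [rewrite leqNgt zd | rewrite h in dN].
Qed.

(** The two claims need a joint induction: the chain of Q on [d :: ds] uses the block of Q d and the
    chain of Q on [ds], and the block of Q uses the chain on the same list. Every block counted in
    the weight may lack one vertex; the links between blocks make up for it, so only one vertex is
    lost in the end. *)
Lemma block_chain ds :
  all prime ds -> all (fun d => z < d) ds -> sorted gtn ds ->
  (forall Q c, 0 < Q -> 12 * Q <= x -> c \in [:: 1; 2] ->
     exists s, block ds Q c s) /\
  (forall Q c, 0 < Q -> 12 * Q <= x -> c \in [:: 1; 2] -> ds != [::] ->
     child Q (head 0 ds) -> exists s, chain ds Q c s).
Proof.
elim: ds => [|d ds IH] /=.
  move=> _ _ _; split=> // Q c Q0 Qx cP.
  have [sl ul [hl ll] Pl] := leafP Q0 Qx.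
  case El: (leaf Q) hl ll => [|k l] //= hl ll; subst k.
  exists (Q :: map (muln Q) (leaf Q)); split=> /=.
  - by split=> //; rewrite El /= last_map ll mulnC.
  - rewrite El /=; apply/andP; split.
      by apply: divisor_adj_dvd; [rewrite dvdn_mulr|lia].
    rewrite path_map; move: sl; rewrite El /=; apply: sub_path => a b /=.
    by rewrite divisor_adj_mul.
  - rewrite map_inj_uniq ?ul ?andbT; last by move=> a b /eqP; rewrite eqn_pmul2l // => /eqP.
    by apply/mapP=> -[k /Pl[k1 _ _ _] /eqP]; rewrite -[X in X == _]muln1 eqn_pmul2l //; move: k1;
      clear; lia.
  - move=> v; rewrite inE => /orP[/eqP->|/mapP[k /Pl[k1 _ kx kz] ->]].
      exists 1; first by rewrite muln1.
      by split=> //; [move: Qx; clear; lia|move=> p pp; rewrite dvdn1 => /eqP p1; rewrite p1 in pp].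
    exists k => //; split; [exact: ltnW|by rewrite mulnC|by move=> p pp pk; left; apply: kz].
  - rewrite muln0 size_map; split=> //.
      rewrite inE; apply/norP; split; first by rewrite -[X in _ == X]mul1n eqn_pmul2r.
      by apply/mapP=> -[k /Pl[_ k6 _ _] /eqP]; rewrite mulnC eqn_pmul2l // eq_sym (negbTE k6).
    rewrite inE; apply/norP; split; first by rewrite neq_ltn Q0.
    by apply/mapP=> -[k /Pl[k1 _ _ _] /esym/eqP]; rewrite muln_eq0; move: Q0 k1; clear; lia.
move=> /andP[pd pds] /andP[zd zds] sds.
have sds' : sorted gtn ds by apply: path_sorted sds.
have dN : d \notin ds.
  apply/negP=> dds; have := order_path_min (fun a b c (h1 : gtn b a) h2 => ltn_trans h2 h1) sds.
  by move=> /allP/(_ _ dds) /=; rewrite ltnn.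
have dlt d' : d' \in ds -> d' < d.
  move=> dds; have := order_path_min (fun a b c (h1 : gtn b a) h2 => ltn_trans h2 h1) sds.
  by move=> /allP/(_ _ dds).
have [IHb IHc] := IH pds zds sds'.
have Hc Q c : 0 < Q -> 12 * Q <= x -> c \in [:: 1; 2] -> child Q d ->
     exists s, chain (d :: ds) Q c s.
  move=> Q0 Qx cP chd.
  have Qd0 : 0 < Q * d by rewrite muln_gt0 Q0 prime_gt0.
  have Qdx : 12 * (Q * d) <= x.
    by apply: child_bound chd _; move: zd z_ge6; clear; lia.
  (* The block of Q d is entered at [c * (Q * d)] and so left at the other end, [e * (Q * d)]; for
     [c] = 2 it is run through backwards. *)
  have [e eP ec] : exists2 e, e \in [:: 1; 2] & e != c.
    by move: cP; rewrite !inE => /orP[]/eqP->; [exists 2|exists 1].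
  have [b [[b0 hb lb] sb ub Pb [b6 be Wb]]] := IHb (Q * d) e Qd0 Qdx eP.
  have {hb lb} [b' [hb' lb' [sb' ub' Pb'] sz']] : exists b', [/\ head 0 b' = c * (Q * d), last 0
    b' = e * (Q * d), [/\ sorted divisor_adj b', uniq b' & b' =i b] & size b' = size b].
    move: cP eP ec; rewrite !inE => /orP[]/eqP-> /orP[]/eqP-> // _.
      by exists b; rewrite mul1n.
    exists (rev b); rewrite rev_sorted rev_uniq size_rev ub; split=> //.
    - by rewrite -lb -nth0 nth_rev // subn1 nth_last.
    - by rewrite -nth_last size_rev nth_rev prednK // subnn nth0 hb mul1n.
    - split=> //; last by move=> v; rewrite mem_rev.
      by move: sb; rewrite (eq_sorted (e' := fun a b => divisor_adj b a)) // => a b0';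
        rewrite divisor_adjC.
  have b'0 : 0 < size b' by rewrite sz'.
  have Pb'' v : v \in b' -> inblock ds (Q * d) v by rewrite Pb'; apply: Pb.
  case Eds: ds => [|d' ds'].
    exists b', e, d; split=> //.
    - by split=> //; [rewrite mem_head | rewrite Pb'].
    - by move=> v /Pb'' Iv; rewrite -Eds; split; [apply: inblock_cons|exists d;
      [rewrite mem_head|case: Iv => w -> _; rewrite dvdn_mulr]].
    - by move: Wb; rewrite Eds /= chd mul1n sz'; clear; lia.
  have d'ds : d' \in ds by rewrite Eds mem_head.
  have d'd := dlt _ d'ds.
  have pd' : prime d' by apply: (allP pds).
  have d'0 := prime_gt0 pd'.
  have chd' : child Q (head 0 ds) by rewrite Eds /=; apply: child_sub chd (ltnW d'd).
  have [t [e' [d1 [[e'P d1P t6] [t0 ht lt] [st ut] Pt Wt]]]] := IHc Q e Q0 Qx eP ltac:(by rewrite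
    Eds) chd'.
  have d1d := dlt _ d1P.
  have pd1 : prime d1 by apply: (allP pds).
  rewrite -Eds.
  (* A common multiple of the end of this block and of [e * (Q * d')], where the remaining chain
     starts; both sides share the coefficient [e]. *)
  pose lk := e * (Q * d) * d'.
  have clt v : v \in t -> ~~ (Q * d %| v).
    by move=> /Pt[Iv _]; apply: (inblock_ndvd zd pd dN Q0 Iv).
  have e0 : 0 < e by move: eP; rewrite !inE => /orP[]/eqP->.
  have e2 : e <= 2 by move: eP; rewrite !inE => /orP[]/eqP->.
  have lkd : Q * d %| lk by rewrite /lk dvdn_mulr // dvdn_mull.
  have lkx : lk <= x by apply: child_leq chd (ltnW d'd) e2.
  have lkb : lk \notin b' by rewrite Pb'; move: be; rewrite Eds /=.
  have Ilk : inblock (d :: ds) Q lk.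
    exists (e * d * d'); first by rewrite /lk; clear; lia.
    split=> //; first by rewrite !muln_gt0 e0 d'0 prime_gt0.
    move=> p pp; rewrite !Euclid_dvdM // => /orP[/orP[]|].
    - by move=> /(dvdn_leq e0) pe; left; move: pe e2 z_ge6; clear; lia.
    - by rewrite dvdn_prime2 // => /eqP->; right; rewrite mem_head.
    - by rewrite dvdn_prime2 // => /eqP->; right; rewrite inE d'ds orbT.
  exists (b' ++ lk :: t), e', d1; split.
  - split=> //; first by rewrite inE d1P orbT.
    rewrite mem_cat inE !negb_or t6 andbT.
    have nd : ~~ (Q * d %| 6 * (Q * d1)).
      rewrite mulnCA dvdn_pmul2l // Euclid_dvdM // negb_or [d %| d1]dvdn_prime2 //.
      apply/andP; split; last by rewrite eqn_leq leqNgt d1d.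
      by apply/negP=> /dvdn_leq; move: zd z_ge6; clear; lia.
    apply/andP; split; last by apply: contraNneq nd => ->.
    by apply: contraNN nd => /Pb''[w -> _]; rewrite dvdn_mulr.
  - rewrite size_cat /= addnS; split=> //; last by rewrite last_cat /=; case: (t) t0 lt.
    by case: (b') hb' b'0.
  - split.
      case: (b') hb' lb' sb' b'0 => // u us _ /= lb' sb' _.
      rewrite cat_path sb' /= lb'; apply/andP; split.
        apply: divisor_adj_dvd; first by rewrite /lk dvdn_mulr.
        by rewrite /lk neq_ltn ltn_Pmulr ?prime_gt1 // muln_gt0 e0.
      case: (t) ht st t0 => // w ws /= -> -> _; rewrite andbT divisor_adjC Eds /=.
      have -> : lk = d * (e * (Q * d')) by rewrite /lk; clear; lia.
      apply: divisor_adj_dvd; first exact: dvdn_mull.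
      by rewrite neq_ltn ltn_Pmull ?prime_gt1 // !muln_gt0 e0 Q0 d'0.
    rewrite cat_uniq ub' /= ut andbT; apply/andP; split.
      rewrite negb_or lkb /=; apply/hasPn=> v vt /=; apply: contraNN (clt _ vt).
      by move=> /Pb''[w -> _]; rewrite dvdn_mulr.
    by apply: contraNN lkb => lkt; have := clt _ lkt; rewrite lkd.
  - move=> v; rewrite mem_cat inE => /or3P[/Pb'' Iv|/eqP->|/Pt[Iv [d2 d2P d2v]]].
    + by split; [apply: inblock_cons|exists d; [rewrite mem_head|case: Iv => w -> _;
      rewrite dvdn_mulr]].
    + by split=> //; exists d; rewrite ?mem_head.
    + by split; [apply: inblock_sub|exists d2; rewrite // inE d2P orbT].
  - by rewrite size_cat /= chd mul1n; move: Wt Wb; rewrite sz'; clear; lia.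
split=> [Q c Q0 Qx cP|Q c Q0 Qx cP _ /= chd]; last exact: Hc.
case chd: (child Q d); last first.
  have [s [[s0 hs ls] ss us Ps [s6 _ Ws]]] := IHb Q c Q0 Qx cP.
  exists s; split=> //=; first by move=> v /Ps; apply: inblock_sub.
  rewrite chd mul0n addn0; split=> //; apply/negP=> /Ps Iv.
  by have := inblock_ndvd zd pd dN Q0 Iv; rewrite -mulnA dvdn_mull.
have [t [e [d1 [[eP d1P t6] [t0 ht lt] [st ut] Pt Wt]]]] := Hc Q c Q0 Qx cP chd.
have [sl ul [hl ll] Pl] := leafP Q0 Qx.
have d1z : z < d1 by move: d1P; rewrite inE => /predU1P[->//|]; apply: (allP zds).
have d1p : prime d1 by move: d1P; rewrite inE => /predU1P[->//|]; apply: (allP pds).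
have d1d : d1 <= d by move: d1P; rewrite inE => /predU1P[->//|/dlt/ltnW].
have x6 : 6 * (Q * d1) <= x.
  by apply: child_bound (child_sub chd d1d) _; move: d1z z_ge6; clear; lia.
(* The head of [t] is [c * (Q * d)], the vertex that the block must leave free; Q can replace it,
   being adjacent to all its proper multiples. The vertex 6 Q d1 is a common multiple of the end of
   the chain, Q d1 or 2 Q d1, and of 3 Q, where the smooth path starts. *)
pose m := behead t ++ 6 * (Q * d1) :: map (muln Q) (leaf Q).
have cl v : v \in t -> exists2 d', Q * d' %| v & [/\ d' \in d :: ds, z < d' & prime d'].
  move=> /Pt[_ [d' d'P d'v]]; exists d' => //; split=> //.
    by move: d'P; rewrite inE => /predU1P[->//|]; apply: (allP zds).
  by move: d'P; rewrite inE => /predU1P[->//|]; apply: (allP pds).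
have Qt : Q \notin t.
  apply/negP=> /cl[d' d'v [_ zd' _]]; move: d'v; rewrite gtnNdvd // ltn_Pmulr //.
  by move: zd' z_ge6; clear; lia.
have leaft k : k \in leaf Q -> Q * k \notin t.
  move=> /Pl[k1 _ _ kz]; apply/negP=> /cl[d']; rewrite dvdn_pmul2l // => d'k [_ zd' pd'].
  by rewrite ltnNge (kz _ pd' d'k) in zd'.
have mulI : injective (muln Q) by move=> a b /eqP; rewrite eqn_pmul2l // => /eqP.
exists (Q :: m); split=> /=.
- by split=> //; rewrite /m last_cat /=; case: (leaf Q) hl ll => //= k l _ ll;
  rewrite last_map ll mulnC.
- have sm : sorted divisor_adj m.
    have s2 : path divisor_adj (6 * (Q * d1)) [seq Q * k | k <- leaf Q].
      case El: (leaf Q) hl => [|k l] //= hk; subst k; apply/andP; split.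
        rewrite divisor_adjC; apply: divisor_adj_dvd.
          by apply/dvdnP; exists (2 * d1); clear; lia.
        by rewrite mulnCA eqn_pmul2l //; move: d1z z_ge6; clear; lia.
      rewrite path_map; move: sl; rewrite El /=; apply: sub_path => a b /=.
      by rewrite divisor_adj_mul.
    rewrite /m; case: (t) lt st t0 => // u [|u' us] //= lt /andP[_ st] _.
    rewrite cat_path st /= lt s2 andbT.
    by apply: divisor_adj_dvd; [rewrite dvdn_mul //; move: eP;
      rewrite !inE => /orP[]/eqP->|by rewrite eqn_pmul2r ?muln_gt0 ?Q0 ?prime_gt0 //; move: eP;
        rewrite !inE => /orP[]/eqP->].
  case Em: m sm => [|u us] //= ->; rewrite andbT.
  have um : u \in m by rewrite Em mem_head.
  apply: divisor_adj_dvd; last first.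
    apply/eqP=> Qu; move: um; rewrite -Qu /m mem_cat inE => /or3P[/mem_behead|/eqP|/mapP[k /Pl[]]].
    + by rewrite (negbTE Qt).
    + by move/eqP; rewrite -[X in X == _]muln1 mulnCA eqn_pmul2l //; move: d1z; clear; lia.
    + by move=> k1 _ _ _ /eqP; rewrite -[X in X == _]muln1 eqn_pmul2l //; move: k1; clear; lia.
  move: um; rewrite /m mem_cat inE => /or3P[/mem_behead/Pt[[w -> _]]|/eqP->|/mapP[k _ ->]].
  + by rewrite dvdn_mulr.
  + by rewrite mulnCA dvdn_mulr.
  + by rewrite dvdn_mulr.
- have bu : uniq (behead t) by case: (t) ut => //= u us /andP[].
  rewrite /m cat_uniq bu /= (map_inj_uniq mulI) ul andbT mem_cat inE !negb_or.
  apply/andP; split.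
    apply/and3P; split.
    + by apply: contraNN Qt; apply: mem_behead.
    + by rewrite -[X in X == _]muln1 mulnCA eqn_pmul2l //; move: d1z; clear; lia.
    + by apply/mapP=> -[k /Pl[k1 _ _ _] /eqP]; rewrite -[X in X == _]muln1 eqn_pmul2l //;
      move: k1; clear; lia.
  rewrite -andbA; apply/and3P; split.
  + by rewrite (contraNN _ t6) //; apply: mem_behead.
  + by apply/hasPn=> _ /mapP[k kl ->]; apply: contraNN (leaft _ kl); apply: mem_behead.
  + apply/mapP=> -[k /Pl[_ _ _ kz] E].
    have E' : k = 6 * d1 by apply: mulI; rewrite -E mulnCA.
    by have := kz _ d1p; rewrite E' dvdn_mull // leqNgt d1z => /(_ isT).
- move=> v; rewrite inE /m mem_cat inE => /or4P[/eqP->|/mem_behead/Pt[]//|/eqP->|/mapP[k /Pl[k1 _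
  kx kz] ->]].
  + exists 1; first by rewrite muln1.
    by split=> //; [move: Qx; clear; lia|move=> p pp; rewrite dvdn1 => /eqP p1; rewrite p1 in pp].
  + exists (6 * d1); first by rewrite mulnCA.
    split; [by rewrite muln_gt0 (prime_gt0 d1p)|exact: x6|].
    move=> p pp; rewrite Euclid_dvdM // => /orP[/dvdn_leq h|]; first by left;
      apply: leq_trans z_ge6; apply: h.
    by rewrite dvdn_prime2 // => /eqP->; right.
  + exists k => //; split; [exact: ltnW|by rewrite mulnC|by move=> p pp pk; left; apply: kz].
- have h6 v : v \in Q :: m -> Q * d %| v -> v \in behead t \/ v = 6 * (Q * d).
    rewrite inE /m mem_cat inE => /or4P[/eqP->|h|/eqP->|/mapP[k /Pl[_ _ _ kz] ->]].
    + by rewrite gtnNdvd // ltn_Pmulr ?prime_gt1.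
    + by left.
    + rewrite mulnCA dvdn_pmul2l // Euclid_dvdM // => /orP[/dvdn_leq|]; first by move: zd z_ge6;
      clear; lia.
      by rewrite dvdn_prime2 // => /eqP <-; right; rewrite mulnCA.
    + by rewrite dvdn_pmul2l // => /(kz _ pd); rewrite leqNgt zd.
  split.
  + rewrite inE /m mem_cat inE !negb_or; apply/and4P; split.
    * by rewrite -[X in _ == X]mul1n eqn_pmul2r.
    * apply/negP=> /mem_behead/cl[d'];
      rewrite [6 * Q]mulnC dvdn_pmul2l // => /dvdn_leq h [_ zd' _]; move: (h isT) zd' z_ge6;
        clear; lia.
    * by rewrite eqn_pmul2l // -[X in X == _]muln1 eqn_pmul2l //; move: d1z z_ge6; clear; lia.
    * by apply/mapP=> -[k /Pl[_ k6 _ _]]; rewrite mulnC => /mulI k6'; rewrite -k6' in k6.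
  + apply/negP=> /h6[]; first by rewrite -mulnA dvdn_mull.
      by rewrite -mulnA; case: (t) ht ut => //= u us -> /andP[/negbTE->].
    by move/eqP; rewrite -mulnA eqn_pmul2r ?muln_gt0 ?Q0 ?prime_gt0 //; move: cP;
      rewrite !inE => /orP[]/eqP->.
  + move: Wt; rewrite /m /= chd size_cat /= size_map size_behead; case: (size t) t0 => //= n _;
    clear; lia.
Qed.

End Blocks.

(** * Sums over products of primes *)

Definition primes_in a b := [seq p <- index_iota a.+1 b.+1 | prime p].

Notation prodn R := (\prod_(p <- R) p).

(* Products are represented by the lists of their prime factors, largest first; [subsum] ranges
   over the ways to adjoin to [R] a subset of the ascending list [l], [possum] over the nonempty
   ones. *)
Fixpoint subsum (f : seq nat -> nat) (l R : seq nat) : nat :=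
  if l is s :: l' then subsum f l' R + subsum f l' (s :: R) else f R.

Fixpoint possum (f : seq nat -> nat) (l R : seq nat) : nat :=
  if l is s :: l' then possum f l' R + (f (s :: R) + possum f l' (s :: R)) else 0.

Lemma subsumE f l R : subsum f l R = f R + possum f l R.
Proof. by elim: l R => [|s l IH] R /=; rewrite ?addn0 // !IH; lia. Qed.

Lemma subsum_rcons f l d R :
  subsum f (rcons l d) R = subsum f l R + subsum (fun S => f (d :: S)) l R.
Proof. by elim: l f R => [|s l IH] f R //=; rewrite !IH addnACA. Qed.

Lemma eq_subsum f g l R : f =1 g -> subsum f l R = subsum g l R.
Proof. by move=> fg; elim: l R => [|s l IH] R /=; rewrite ?fg ?IH. Qed.

Lemma subsum0 l R : subsum (fun=> 0) l R = 0.
Proof. by elim: l R => [|s l IH] R //=; rewrite !IH. Qed.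

Fixpoint dense t (R : seq nat) : bool :=
  if R is p :: R' then dense t R' && (p <= t * prodn R') else true.

Lemma dense_cat t T R : dense t (T ++ R) -> dense t R.
Proof. by elim: T => //= p T IH /andP[/IH]. Qed.

Lemma dense_leq t u R : t <= u -> dense t R -> dense u R.
Proof.
move=> tu; elim: R => //= p R IH /andP[/IH-> /= h].
by apply: leq_trans h _; rewrite leq_mul2r tu orbT.
Qed.

(** A slice (t, k) stands for a smooth path up to 2 t which, together with Q itself, has k vertices.
    The value is 0 when no slice applies. *)
Definition value (sl : seq (nat * nat)) x R :=
  \max_(s <- sl | dense s.1 R && (2 * s.1 * prodn R <= x)) s.2.

Lemma primes_prod_gt0 T : all prime T -> 0 < prodn T.
Proof.
move=> /allP pT; rewrite big_seq; apply: prodn_cond_gt0 => p /pT.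
exact: prime_gt0.
Qed.

Lemma value_leq sl x R k :
  (forall s, s \in sl -> dense s.1 R -> 2 * s.1 * prodn R <= x -> s.2 <= k) ->
  value sl x R <= k.
Proof.
move=> H; rewrite /value; apply/bigmax_leqP_seq => s ssl /andP[d h].
exact: H.
Qed.

Lemma subsum_weight x leaf sl :
  (forall Q s, 0 < Q -> s \in sl -> 2 * s.1 * Q <= x -> s.2 <= (size (leaf Q)).+1) ->
  forall ds T, all prime ds -> all prime T ->
  subsum (fun S => value sl x (T ++ S)) (rev ds) [::] <= weight x leaf (prodn T) ds.
Proof.
move=> Hleaf; elim=> [|d ds IH] T /=.
  move=> _ pT; rewrite cats0; apply: value_leq => s ssl _.
  by apply: Hleaf => //; apply: primes_prod_gt0.
move=> /andP[pd pds] pT; rewrite rev_cons subsum_rcons leq_add ?IH //.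
have E S : value sl x (T ++ d :: S) = value sl x (rcons T d ++ S) by rewrite cat_rcons.
rewrite (eq_subsum _ _ E).
case: (boolP (child x (prodn T) d)) => [_|chd].
  have -> : prodn T * d = prodn (rcons T d) by rewrite -cats1 big_cat big_seq1.
  by rewrite mul1n IH // all_rcons pd.
(* If Q d is not a child, the whole sum must vanish: a product containing d that is dense for t and
   has 2 t n <= x would satisfy 2 d^2 Q <= x. *)
rewrite mul0n leqn0 (@eq_subsum _ (fun=> 0)) ?subsum0 // => S.
apply/eqP; rewrite -leqn0; apply: value_leq => s _ /=; rewrite cat_rcons => ds' h.
case/negP: chd; apply: leq_trans h; move/dense_cat: ds' => /= /andP[_ dS].
rewrite big_cat big_cons /=.
have -> : 2 * s.1 * (prodn T * (d * prodn S)) = 2 * (s.1 * prodn S * d * prodn T) by lia.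
by rewrite leq_mul2l /= leq_mul2r leq_mul2r dS !orbT.
Qed.

Lemma divisor_path_weight z x leaf :
  6 <= z -> 12 <= x ->
  (forall Q, 0 < Q -> 12 * Q <= x ->
     [/\ sorted divisor_adj (leaf Q), uniq (leaf Q),
         head 0 (leaf Q) = 3 /\ last 0 (leaf Q) = 2 &
         forall k, k \in leaf Q ->
           [/\ 1 < k, k != 6, k * Q <= x & forall p, prime p -> p %| k -> p <= z]]) ->
  weight x leaf 1 (rev (primes_in z x)) <= (divisor_path_max x).+1.
Proof.
move=> z6 x12 leafP; set ds := rev _.
have [|||blk _] := block_chain z6 leafP (ds := ds).
- by rewrite all_rev filter_all.
- by rewrite all_rev all_filter; apply/allP=> p; rewrite mem_index_iota => /andP[zp _];
  apply/implyP.
- rewrite rev_sorted (eq_sorted (e' := ltn)) //; apply: sorted_filter; first exact: ltn_trans.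
  exact: iota_ltn_sorted.
have [|s [[_ _ _] ss us Ps [_ _ Ws]]] := blk 1 1 isT _ isT; first by rewrite muln1.
apply: leq_trans Ws _; rewrite ltnS; apply: leq_divisor_path_max.
rewrite /simple_divisor_path us ss !andbT; apply/allP=> v /Ps[w -> [w0 vx _]].
by rewrite vx andbT mul1n.
Qed.

Lemma mem_primes_in p a b : (p \in primes_in a b) = [&& prime p, a < p & p <= b]%N.
Proof. by rewrite mem_filter mem_index_iota ltnS. Qed.

Lemma primes_in_cat a b c : (a <= b <= c) ->
  primes_in a c = primes_in a b ++ primes_in b c.
Proof.
move=> /andP[ab bc]; rewrite /primes_in -filter_cat; congr filter.
rewrite /index_iota (_ : c.+1 - a.+1 = (b.+1 - a.+1) + (c.+1 - b.+1)); last by lia.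
by rewrite iotaD; congr (_ ++ iota _ _); lia.
Qed.

Lemma primes_in_nil a b : (b <= a) -> primes_in a b = [::].
Proof. by move=> ba; rewrite /primes_in /index_iota (eqP (_ : b.+1 - a.+1 == 0)) ?subn_eq0. Qed.

Lemma primes_in1 m : primes_in m m.+1 = if prime m.+1 then [:: m.+1] else [::].
Proof. by rewrite /primes_in /index_iota subSn // subnn. Qed.

Lemma primes_in_recr a m : (a <= m) ->
  primes_in a m.+1 = if prime m.+1 then rcons (primes_in a m) m.+1 else primes_in a m.
Proof.
move=> am; rewrite (@primes_in_cat a m m.+1) ?am ?leqnSn // primes_in1.
by case: ifP => _; rewrite ?cats0 ?cats1.
Qed.

Lemma primes_in_recl m x : (m < x) ->
  primes_in m x = if prime m.+1 then m.+1 :: primes_in m.+1 x else primes_in m.+1 x.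
Proof.
by move=> mx; rewrite (@primes_in_cat m m.+1 x) ?leqnSn // primes_in1; case: ifP.
Qed.

Lemma size_primes_in a b : (size (primes_in a b) <= b - a).
Proof. by rewrite size_filter (leq_trans (count_size _ _)) // size_iota subSS. Qed.

(** * Leaf paths through smooth numbers *)

(** Certificates: a number t with a path of 17-smooth numbers up to 2 t, validated by [leaf_ok].
    Longer paths only improve the final constant. *)
Definition leaf_data : seq (N * seq N) := ([::
  (32, [:: 3;33;11;22;44;4;64;32;16;48;24;8;56;28;14;42;21;63;7;35;5;25;50;10;40;20;60;12;36;18;54;
 27;9;45;15;30;2]);
  (44, [:: 3;51;17;34;68;4;52;26;78;39;13;65;5;35;70;10;50;25;75;15;45;9;81;27;54;18;36;72;24;48;
 12;84;28;56;14;42;21;63;7;77;11;33;66;22;44;88;8;32;64;16;80;40;20;60;30;2]);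
  (54, [:: 3;63;21;42;84;28;56;14;98;49;7;77;11;99;33;66;22;44;88;8;64;32;16;96;48;24;72;12;36;18;
 54;108;27;81;9;45;90;30;60;20;40;80;10;70;35;105;15;75;25;50;100;4;68;34;102;51;17;85;5;65;13;39;
 78;26;104;52;2]);
  (68, [:: 3;66;33;99;11;55;110;22;88;44;132;12;96;16;128;64;32;4;136;68;34;102;51;17;85;5;125;25;
 75;15;45;135;27;81;9;117;39;78;26;52;104;8;48;24;72;36;108;54;18;90;30;60;120;40;80;20;100;50;10;
 130;65;13;91;7;49;98;14;56;112;28;84;42;126;63;21;105;35;70;2]);
  (85, [:: 3;153;51;102;34;68;136;4;24;144;72;36;108;18;54;162;81;27;135;45;90;30;60;120;40;80;160;
 20;140;70;35;105;15;75;150;50;100;25;125;5;65;130;10;170;85;17;119;7;91;13;143;11;77;154;14;98;49;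
 147;21;63;126;42;84;12;156;52;104;26;78;39;117;9;99;33;165;55;110;22;66;132;44;88;8;64;128;32;96;
 48;16;112;56;28;168;2]);
  (110, [:: 3;165;55;110;220;20;180;10;130;65;195;39;117;9;153;51;102;204;12;132;44;176;88;8;208;
 104;52;156;78;26;182;91;13;143;11;187;17;119;7;77;154;22;66;33;99;198;18;162;81;27;189;63;126;42;
 21;147;49;98;196;28;84;168;56;4;136;68;34;170;85;5;125;25;175;35;105;210;70;140;14;112;16;96;24;
 120;60;30;90;45;135;15;75;150;50;100;200;40;80;160;32;128;64;192;48;144;72;36;216;108;54;2]);
  (140, [:: 3;147;49;98;196;28;112;224;56;168;84;42;126;63;189;21;231;77;154;14;182;91;273;39;117;
 234;78;156;52;26;104;208;16;176;44;132;264;88;8;272;136;68;204;102;34;238;119;17;221;13;143;11;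
 121;242;22;66;198;99;33;165;55;275;25;125;250;50;100;200;40;280;70;140;4;260;65;195;15;150;75;225;
 45;135;270;90;30;210;105;35;245;7;175;5;170;85;255;51;153;9;81;243;27;162;54;108;216;18;72;24;144;
 36;252;12;180;60;120;240;48;96;192;64;256;128;32;160;80;20;220;110;10;130;2]);
  (182, [:: 3;243;81;162;54;324;108;27;351;117;234;78;39;273;91;182;364;52;156;312;104;208;26;338;
 169;13;221;17;187;11;143;286;22;242;121;363;33;297;99;198;66;132;264;88;176;44;352;32;256;128;64;
 192;96;48;144;288;36;216;72;18;306;153;51;102;204;68;136;272;34;238;119;357;21;231;77;154;308;28;
 196;98;49;343;7;147;294;42;126;63;189;9;225;75;150;300;60;120;360;180;90;270;135;45;315;105;210;
 30;330;165;55;275;25;125;250;50;100;200;20;220;110;10;130;260;4;340;170;85;255;15;195;65;325;5;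
 245;35;175;350;70;140;280;40;240;12;24;8;80;320;160;16;336;14;112;224;56;168;84;252;2]);
  (234, [:: 3;243;81;162;324;54;108;216;27;297;99;198;66;132;396;33;363;121;242;22;286;143;429;39;
 351;117;234;78;156;312;104;208;416;52;468;26;338;169;13;221;442;34;374;187;11;275;55;165;330;110;
 220;44;176;352;88;264;24;96;192;384;128;256;64;32;448;224;112;56;392;98;196;49;343;7;273;91;182;
 364;28;308;154;77;385;35;245;5;455;65;325;25;175;350;70;140;280;14;238;119;357;51;255;85;425;17;
 459;153;306;102;204;68;272;136;408;12;168;84;336;48;432;72;288;144;36;252;126;378;189;63;441;147;
 294;42;462;231;21;315;105;210;420;60;300;75;375;125;250;50;150;450;225;45;405;135;9;18;270;90;180;
 15;195;390;130;260;20;340;170;10;100;200;400;16;320;160;80;240;30;360;120;4;440;40;8;2]);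
  (294, [:: 3;507;169;338;26;442;221;17;289;578;34;374;187;561;51;459;153;306;102;204;408;136;68;
 272;544;32;512;256;128;64;384;192;96;288;576;48;144;72;216;108;324;162;81;243;486;54;432;27;351;
 117;234;78;156;468;39;429;143;286;572;52;416;208;104;312;24;264;88;352;176;44;484;121;363;33;297;
 99;198;66;132;528;22;242;11;539;77;231;462;154;308;28;476;119;357;21;567;189;378;63;441;147;294;
 98;196;49;343;7;238;14;392;56;448;224;112;336;168;84;588;42;126;252;504;36;396;18;270;135;405;9;
 315;105;525;175;350;70;490;245;35;385;55;275;550;110;330;165;495;45;225;75;375;125;250;500;50;450;
 150;25;425;85;255;510;170;340;20;220;440;8;280;140;560;16;320;160;80;400;200;100;300;12;420;210;
 30;90;540;180;360;60;120;480;4;364;182;546;273;91;455;13;325;65;585;195;15;240;40;520;260;10;390;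
 5;130;2]);
  (385, [:: 3;507;169;338;676;52;572;286;143;429;39;663;221;442;26;234;117;351;702;78;156;468;36;
 324;162;486;243;729;81;405;135;675;225;75;375;125;625;25;425;85;595;119;357;714;238;476;68;272;
 136;544;34;578;289;17;561;187;374;748;44;484;242;121;605;55;275;550;110;220;440;88;352;176;704;64;
 512;256;128;768;384;192;96;576;288;32;416;208;104;312;624;48;144;432;108;54;216;648;72;24;408;204;
 102;306;153;459;51;612;18;198;594;297;99;495;165;330;66;726;363;33;231;693;77;539;11;715;65;325;
 650;130;260;520;13;637;91;455;35;385;770;154;462;22;396;132;264;528;16;448;224;112;336;672;168;56;
 616;308;28;364;182;728;8;392;196;98;686;343;49;245;490;70;350;175;525;105;735;147;441;63;567;189;
 27;378;126;504;252;756;84;588;294;42;546;273;21;315;7;210;14;700;140;280;560;80;640;320;160;480;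
 240;12;420;60;660;4;340;170;680;40;400;200;100;500;250;750;50;150;300;600;120;20;720;360;180;9;
 765;255;510;10;390;195;585;45;450;15;630;30;270;5;90;540;2]);
  (512, [:: 3;867;289;578;34;442;221;663;51;561;187;374;748;68;884;52;676;338;169;507;1014;78;234;
 117;351;702;39;429;143;1001;91;637;49;343;686;98;294;147;441;882;126;378;189;567;63;819;273;546;
 182;364;728;104;208;416;832;26;286;858;66;726;363;121;605;55;935;85;425;850;170;340;680;136;544;
 272;816;204;408;102;306;153;459;918;17;833;119;357;714;238;476;952;56;392;196;784;112;448;224;896;
 128;1024;512;256;768;384;64;192;96;576;288;32;352;704;176;88;968;242;484;44;572;13;845;65;715;11;
 847;77;539;7;595;35;455;910;130;650;325;975;195;585;45;765;255;510;1020;60;780;390;30;330;165;825;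
 275;550;110;770;385;5;625;125;875;175;525;105;735;245;490;980;140;280;70;350;700;100;500;250;750;
 375;75;675;225;450;150;25;1000;50;300;900;180;90;990;495;99;693;231;462;154;616;308;924;132;660;
 220;440;22;198;594;297;891;33;396;792;264;528;48;624;156;312;936;468;36;612;18;486;243;729;81;405;
 135;945;315;630;210;420;15;270;810;162;972;324;54;540;27;648;108;216;432;864;9;756;252;21;588;42;
 14;560;28;504;84;672;336;168;1008;144;72;360;12;840;24;600;200;400;800;160;640;320;16;880;80;720;
 8;520;260;4;120;960;20;40;240;10;480;2]);
  (693, [:: 3;867;289;578;1156;68;884;221;1105;85;935;187;561;1122;374;748;34;442;1326;663;51;1377;
 459;153;765;255;1275;425;850;170;510;102;306;918;17;833;119;1309;77;847;121;1331;11;363;1089;99;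
 891;297;594;198;396;1188;132;264;792;66;726;242;484;968;88;704;352;176;528;1056;44;572;286;143;
 1001;91;1183;169;845;65;715;55;605;1210;110;550;275;1375;125;625;1250;250;500;1000;200;400;800;
 100;1100;220;440;880;22;1078;539;49;637;1274;182;364;728;104;1144;52;676;338;1352;26;1014;507;39;
 858;429;1287;117;351;1053;81;729;243;486;162;972;324;648;108;216;1296;432;54;702;234;468;156;312;
 78;546;273;819;63;1071;357;714;238;476;952;136;544;1088;272;816;204;408;1224;612;36;936;72;864;
 144;288;576;1152;384;128;1024;512;256;768;192;64;832;416;208;624;1248;96;48;336;112;896;448;224;
 32;1280;640;320;160;480;80;1360;340;680;40;5;15;900;30;150;750;10;450;1350;270;45;1080;540;180;
 360;720;9;1260;12;4;300;600;1200;240;8;840;168;504;1008;252;28;756;14;280;1120;560;140;980;490;7;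
 910;70;1190;595;35;420;210;630;315;945;135;1215;405;810;90;1170;390;780;60;1020;20;1300;50;700;
 350;1050;525;21;924;84;1092;42;588;1176;24;1344;672;56;616;308;1232;16;960;120;1320;660;330;990;
 18;882;294;98;392;784;196;1372;686;343;1029;147;441;1323;27;1134;567;189;378;126;1386;462;154;770;
 385;1155;231;693;33;495;165;825;75;675;225;1125;375;25;875;175;1225;245;735;105;1365;455;13;585;
 195;975;325;650;130;1040;260;520;2]);
  (900, [:: 3;867;289;1445;85;1105;221;663;1326;442;884;1768;136;544;1088;272;816;408;204;612;306;
 918;459;1377;153;1071;357;1785;595;1190;238;1666;833;119;1547;91;1183;169;507;1521;117;1053;351;
 702;234;468;1404;156;312;936;78;1014;338;676;1352;104;416;832;1664;208;624;1248;52;572;286;1144;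
 143;1573;121;1331;11;1001;77;847;1694;242;484;968;88;1496;374;748;187;1309;17;935;55;605;1210;110;
 1430;715;65;845;1690;130;650;325;1625;125;625;1250;250;500;1000;200;400;800;1600;320;640;1280;256;
 1024;512;128;1408;704;352;176;1232;308;616;154;1078;539;1617;231;693;1386;462;924;132;1452;363;
 726;66;1122;561;1683;51;1734;578;1156;68;476;952;34;714;102;1224;72;792;198;594;297;891;1782;99;
 1089;33;1287;429;858;1716;39;975;195;585;1755;135;1485;495;165;825;275;1375;25;425;1275;255;765;
 1530;510;170;850;1700;340;680;1360;80;1040;520;260;1300;26;1274;637;13;455;910;182;364;728;1456;
 112;896;1792;448;224;1568;784;392;196;1372;343;1029;147;441;1323;189;1701;567;1134;378;126;1638;
 819;273;546;1092;84;1428;42;294;882;98;686;49;1715;245;1225;175;875;1750;350;700;100;1100;550;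
 1650;330;990;22;396;1188;44;264;528;1056;96;1632;32;1536;768;384;64;192;1152;576;288;864;1728;144;
 1584;48;1344;672;336;168;1176;588;1764;63;945;315;1575;525;1050;50;750;375;1125;225;675;75;1500;
 150;450;1350;270;810;405;1215;243;729;1458;486;81;162;972;324;648;27;54;1296;432;216;108;756;252;
 1512;56;504;1008;21;1365;105;1155;385;770;1540;220;880;440;1760;160;16;960;480;240;1200;300;600;
 24;1320;660;12;1020;60;780;390;1170;18;1620;36;900;9;540;45;630;90;1800;180;1080;360;720;1440;8;
 1560;120;15;735;1470;490;980;28;4;40;1400;20;1120;560;280;14;7;1260;30;10;210;1680;140;70;420;35;
 5;840;2]);
  (1250, [:: 3;867;1734;578;289;2023;119;833;1666;238;476;952;1904;272;544;1088;2176;136;2312;1156;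
 68;884;442;1768;221;1547;91;1183;2366;338;676;1352;169;2197;13;1859;143;1573;121;1331;11;2431;187;
 2057;17;1445;85;1105;2210;170;850;425;2125;125;1625;325;2275;455;1365;273;1911;637;1274;182;2002;
 1001;77;1309;7;847;1694;242;726;363;1089;2178;198;594;297;891;1782;99;1287;429;858;286;572;1144;
 2288;208;832;1664;416;104;728;364;1456;52;2028;507;1521;117;1989;663;1326;102;714;357;2499;147;
 1029;343;2401;49;1715;245;1225;2450;490;980;196;1372;686;2058;294;882;441;1323;189;1701;567;1134;
 378;756;2268;324;972;243;2187;729;1458;486;162;2106;1053;351;2457;819;1638;546;1092;2184;312;624;
 1248;156;1716;78;1014;39;975;195;2145;715;1430;130;1690;845;65;1755;585;1170;390;1950;650;1300;
 260;520;1040;2080;26;910;1820;140;2380;595;1190;70;1750;875;175;1925;385;770;1540;308;2156;539;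
 1617;231;693;2079;63;1071;2142;306;918;459;1377;153;1683;561;1122;374;748;1496;34;1870;935;55;
 1375;275;825;2475;495;1485;165;1815;605;1210;2420;484;968;1936;176;1408;704;352;2464;154;1078;98;
 784;392;1568;224;896;448;1792;256;1024;2048;512;128;1536;768;384;1152;192;2496;64;1280;640;320;
 1600;800;400;2000;500;250;1250;625;1875;375;1125;225;675;2025;81;1215;405;2430;810;135;2295;765;
 255;1275;51;1785;105;735;2205;315;945;1890;126;1386;462;924;1848;616;1232;112;2352;588;1176;168;
 1344;336;672;56;1960;280;560;1120;2240;160;1760;880;440;220;1100;550;110;1650;330;990;33;1155;
 2310;35;525;1575;75;750;2250;450;1350;270;1620;45;1530;510;1020;340;1700;100;2500;25;350;700;1400;
 200;1000;50;2200;88;528;2112;1056;264;66;1452;22;2244;44;132;660;1320;40;680;1360;80;1920;32;1632;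
 816;408;204;1428;28;1764;252;84;21;1470;14;1050;210;630;42;2100;420;840;1680;240;960;96;2304;576;
 288;2016;504;1008;16;1584;396;1188;2376;792;72;1224;612;1836;27;702;234;1404;468;936;1872;144;
 2448;48;1296;648;1944;54;1512;108;1728;864;432;216;18;1260;9;1980;36;2340;780;1560;8;2040;24;480;
 2400;150;1500;300;1200;600;12;900;4;1800;90;540;1080;20;180;15;1440;720;2160;60;5;360;120;30;10;
 2]);
  (1792, [:: 3;2187;729;1458;486;243;3159;1053;351;2457;819;273;3549;1183;2366;338;1014;507;1521;
 3042;169;2197;13;1859;143;1573;3146;286;2002;1001;3003;429;1287;2574;858;1716;572;1144;2288;208;
 2704;676;1352;104;1664;832;3328;416;1248;624;2496;312;3432;156;2028;78;1326;663;1989;221;2873;17;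
 2431;187;3179;289;2023;119;1547;3094;442;884;1768;3536;272;2176;1088;544;1632;816;408;3264;136;
 2312;578;1156;3468;867;2601;153;1377;459;3213;1071;357;2499;833;1666;3332;476;952;1904;238;2618;
 1309;77;847;2541;363;1089;3267;297;2673;891;1782;594;1188;198;2178;726;1452;484;968;242;2662;1331;
 121;2057;11;3025;605;1815;165;2145;715;3575;325;1625;3250;650;1300;2600;520;1040;2080;260;3380;
 845;1690;130;2210;1105;3315;255;2805;935;1870;374;748;1496;2992;68;2652;204;2244;561;1683;3366;
 1122;102;1734;51;1275;425;2125;125;3125;625;1875;375;1125;3375;675;2025;405;1215;2430;810;162;
 2754;918;306;2142;714;1428;2856;34;2890;1445;85;2975;595;1785;3570;1190;2380;340;1700;850;2550;
 510;170;1530;765;2295;135;1485;495;2475;825;275;1375;2750;550;1100;2200;440;880;1760;352;1408;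
 2816;704;176;1936;88;2904;264;1056;528;2112;132;3564;99;2079;693;231;1617;539;2695;385;1925;175;
 1225;2450;245;1715;343;2401;49;1029;3087;441;1323;2646;882;147;1911;637;3185;455;2275;91;1274;
 2548;364;728;1456;182;910;1820;52;2912;224;1568;784;3136;392;2744;686;1372;196;2156;1078;3234;294;
 2058;98;3430;490;980;1960;280;1400;350;1750;875;2625;525;1575;225;2925;975;1950;390;65;2535;195;
 1365;2730;546;1092;2184;26;1430;2860;220;2420;1210;55;1155;3465;315;2205;735;1470;105;945;2835;
 567;1701;189;3402;1134;81;2106;702;1404;468;234;1638;117;1755;585;39;936;1872;144;2448;612;1224;
 72;2808;216;1944;972;2916;324;648;1296;2592;432;864;1728;576;1152;288;2304;768;256;2048;1024;512;
 1536;3072;384;128;1792;3584;896;448;64;1280;2560;640;320;3520;110;770;1540;308;3388;1694;154;1232;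
 616;2464;44;792;396;2376;33;462;1386;66;1584;3168;22;1650;330;990;2970;270;3510;1170;2340;780;
 1560;3120;240;2640;660;1320;120;2040;680;1360;2720;160;3200;1600;800;400;2000;500;2500;1250;250;
 1000;200;3400;100;3500;700;2800;560;2240;32;192;3456;27;1836;108;54;378;2268;756;63;3276;126;2772;
 924;1848;56;3080;140;1120;112;2352;588;1176;3528;1764;252;1512;504;3024;1008;28;1344;2688;96;672;
 168;336;2016;84;21;2310;42;2940;14;1890;7;1050;35;70;630;210;3150;450;1350;75;750;2250;25;3300;50;
 1500;150;2100;420;840;1680;16;48;3360;80;1920;960;480;2400;1200;300;3000;600;8;24;2520;40;1800;
 900;2700;18;1260;36;1980;9;3060;1020;12;4;1620;20;3240;540;45;1080;2160;60;10;180;15;360;5;720;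
 2880;90;1440;30;2]);
  (4096, [:: 3;6591;2197;4394;338;5746;2873;221;3757;7514;578;6358;3179;289;4913;17;2057;6171;561;
 7293;2431;4862;442;3094;1547;4641;663;1989;5967;459;7803;2601;867;4335;1445;7225;425;2125;4250;
 850;1700;3400;680;1360;2720;5440;1088;4352;2176;544;7072;1768;884;3536;272;4624;2312;1156;3468;
 1734;5202;306;2754;1377;4131;243;6561;2187;4374;729;8019;2673;891;4455;1485;7425;2475;825;4125;
 1375;6875;625;3125;6250;1250;2500;5000;1000;2000;500;5500;2750;550;6050;3025;605;6655;1331;3993;
 7986;2662;5324;484;6292;1573;7865;715;3575;275;4675;935;2805;5610;1870;3740;748;1496;2992;374;
 4114;187;1683;5049;297;3267;1089;5445;1815;363;4719;429;5577;1859;3718;7436;676;1352;2704;5408;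
 416;3328;1664;6656;832;4160;2080;1040;520;6760;1690;845;4225;169;1183;5915;455;7735;1105;5525;325;
 8125;1625;4875;975;2925;585;7605;1521;4563;507;2535;5070;1014;3042;6084;2028;4056;8112;208;2288;
 1144;4576;572;2860;1430;7150;650;3250;6500;1300;2600;5200;260;3380;130;2210;4420;340;5780;2890;
 170;1190;595;4165;833;5831;343;2401;7203;1029;3087;6174;2058;686;4802;98;1666;3332;6664;952;1904;
 3808;7616;476;8092;2023;6069;357;2499;7497;1071;3213;6426;918;1836;5508;612;1224;3672;153;2295;
 6885;765;3825;1275;6375;375;1875;5625;1125;3375;675;6075;1215;3645;7290;1458;2916;486;5346;1782;
 594;6534;2178;726;1452;2904;968;1936;3872;7744;242;3146;121;5929;847;4235;385;6545;1309;3927;7854;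
 2618;5236;238;4046;119;2975;5950;85;3315;6630;1326;3978;7956;2652;5304;136;6936;408;1632;3264;816;
 6528;204;2244;1122;3366;6732;68;5984;352;2816;5632;1408;704;2112;1056;4224;528;5808;176;1232;2464;
 4928;616;6776;1694;3388;308;2156;1078;7546;3773;539;7007;1001;5005;143;3861;1287;6435;2145;4290;
 858;286;2002;4004;8008;728;5096;1274;637;4459;91;3549;7098;2366;4732;364;6188;182;2548;7644;1911;
 5733;819;2457;7371;1053;3159;6318;2106;351;5265;1755;3510;702;7722;2574;5148;1716;3432;6864;624;
 2496;1248;4992;312;2184;273;3003;6006;546;3822;294;4998;714;2142;4284;1428;2856;5712;102;2550;255;
 1785;5355;51;4488;34;2380;4760;280;3640;910;6370;3185;65;2275;4550;350;2450;1225;6125;875;4375;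
 125;3750;7500;750;250;1750;3500;7000;700;4900;490;3430;1715;5145;735;3675;245;2695;5390;770;3850;
 1925;5775;1155;8085;1617;4851;693;7623;2541;5082;231;2079;6237;567;5103;1701;3402;1134;7938;3969;
 1323;441;2205;6615;945;2835;405;2025;4050;810;2430;4860;972;5832;1944;81;4212;1404;117;4095;1365;
 6825;175;2625;7875;1575;525;4725;189;2646;882;147;4116;1372;2744;5488;784;3136;1568;6272;392;4312;
 196;6860;980;1960;49;3234;6468;588;1176;2352;4704;672;1344;448;5824;1456;2912;104;5720;52;1820;
 7280;560;3920;7840;1120;2240;224;3584;1792;7168;1024;8192;4096;2048;512;6144;3072;1536;256;5120;
 2560;1280;640;6400;3200;1600;8000;4000;800;400;6800;200;1400;2800;5600;112;896;4480;128;768;4608;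
 2304;384;5376;2688;64;1152;3456;6912;576;1728;192;3840;320;7040;3520;1760;880;4400;1100;2200;440;
 7480;88;4840;1210;2420;7260;3630;165;495;3465;77;462;1386;154;4158;378;4914;1638;234;1170;195;
 1950;5850;390;2730;8190;315;4410;1470;7350;1050;5250;105;3570;510;1530;4590;135;6750;2250;225;
 7650;450;1350;270;2970;990;4950;1650;55;2310;330;110;1540;7700;220;3080;6160;140;2940;5880;35;
 7140;1020;5100;75;1500;3000;6000;25;3900;780;1560;26;1092;4368;78;39;2808;13;468;936;156;1872;
 3744;7488;288;4896;2448;7344;432;5616;216;3888;162;5670;1890;70;5460;210;3150;630;6930;99;4356;
 198;3564;1188;2376;7128;648;1296;324;7776;2592;5184;864;27;6804;2268;756;5292;1764;3528;7056;63;
 3276;6552;126;2772;924;4620;660;3300;33;396;4752;66;792;1584;22;11;3168;6336;44;264;132;1848;3696;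
 7392;336;56;5544;252;4536;54;5940;1980;3960;1320;6600;50;7800;150;4500;100;2100;300;8100;2700;900;
 6300;21;1512;108;7020;2340;4680;45;3060;6120;2040;4080;8160;160;6240;3120;80;2640;5280;32;7680;
 1920;96;4800;2400;1200;600;4200;42;3024;6048;7;14;28;8064;4032;2016;504;168;1008;84;3780;420;1260;
 2520;840;1680;3360;6720;960;16;48;480;240;7920;144;5040;8;24;7560;40;2880;72;5760;9;1620;18;3600;
 36;1800;7200;1440;12;5400;4;720;90;4320;120;20;360;10;2160;540;1080;60;30;5;15;6480;3240;180;2])
])%num.

(* All the smooth numbers of [leaf_data] divide this product. *)
Definition prime_powers : seq N :=
  nseq 13 2%num ++ nseq 8 3%num ++ nseq 5 5%num ++ nseq 4 7%num ++
  nseq 3 11%num ++ nseq 3 13%num ++ nseq 3 17%num.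

Definition prodN (s : seq N) : N := foldr N.mul 1%num s.

Definition adjN (a b : N) : bool :=
  (a != b) && (N.eqb (N.modulo a b) 0 || N.eqb (N.modulo b a) 0).

Definition leaf_entry (P t k : N) : bool :=
  [&& N.ltb 1 k, ~~ N.eqb k 6, N.leb k (N.mul 2 t) &
      N.eqb (N.modulo P k) 0].

(** Distinctness is read off the sorted list, which must be strictly increasing; this avoids a
    quadratic number of comparisons. *)
Definition leaf_ok (d : N * seq N) : bool :=
  [&& head N0 d.2 == 3%num, last N0 d.2 == 2%num, all (leaf_entry (prodN prime_powers) d.1) d.2,
      sorted adjN d.2 & sorted N.ltb (sort N.leb d.2)].

Lemma leaf_data_ok : all leaf_ok leaf_data.
Proof. by vm_compute. Qed.

Lemma N_modulo_dvd a b : N.eqb (N.modulo a b) 0 -> N.to_nat b %| N.to_nat a.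
Proof.
move=> /N.eqb_eq h; have := N.Div0.div_mod a b; rewrite h N.add_0_r => ->.
by rewrite N2Nat.inj_mul; apply: dvdn_mulr.
Qed.

Lemma prime_dvd_prodN p s : prime p -> p %| N.to_nat (prodN s) ->
  exists2 a, a \in s & p %| N.to_nat a.
Proof.
move=> pp; elim: s => [|a s IH] /=.
  by rewrite dvdn1 => /eqP p1; rewrite p1 in pp.
rewrite N2Nat.inj_mul Euclid_dvdM // => /orP[h|/IH[b bs h]].
  by exists a => //; apply: mem_head.
by exists b => //; rewrite inE bs orbT.
Qed.

Lemma leaf_entryP t k : leaf_entry (prodN prime_powers) t k ->
  [/\ 1 < N.to_nat k, N.to_nat k != 6, N.to_nat k <= 2 * N.to_nat t &
      forall p, prime p -> p %| N.to_nat k -> p <= 17].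
Proof.
rewrite /leaf_entry => /and4P[/N.ltb_lt k1 k6 /N.leb_le kt /N_modulo_dvd kd].
split=> [||| p pp pk]; try by lia.
have [a aP pa] := prime_dvd_prodN pp (dvdn_trans pk kd).
have a17 : all (fun a => N.ltb N0 a && N.leb a 17) prime_powers by [].
have /andP[/N.ltb_lt a0 /N.leb_le a1] := allP a17 _ aP.
by apply: leq_trans (dvdn_leq _ pa) _; lia.
Qed.

Lemma adjNP a b : adjN a b -> divisor_adj (N.to_nat a) (N.to_nat b).
Proof.
move=> /andP[ab h]; rewrite /divisor_adj /=; apply/andP; split.
  by apply: contraNneq ab => /N2Nat.inj->.
by case/orP: h => /N_modulo_dvd ->; rewrite ?orbT.
Qed.

Lemma leaf_okP d : leaf_ok d -> let s' := [seq N.to_nat k | k <- d.2] in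
  [/\ sorted divisor_adj s', uniq s', head 0 s' = 3 /\ last 0 s' = 2 &
      forall k, k \in s' -> [/\ 1 < k, k != 6, k <= 2 * N.to_nat d.1 &
                              forall p, prime p -> p %| k -> p <= 17]].
Proof.
case: d => t s; rewrite /leaf_ok [(t, s).1]/= [(t, s).2]/=.
move=> /and5P[/eqP h3 /eqP l2 /allP se sa ss]; split.
- by rewrite sorted_map; apply: sub_sorted sa => a b; apply: adjNP.
- rewrite map_inj_uniq; last exact: N2Nat.inj.
  rewrite -(sort_uniq N.leb); apply: sorted_uniq ss.
    by move=> a b c /N.ltb_lt h1 /N.ltb_lt h2; apply/N.ltb_lt/(N.lt_trans _ _ _ h1 h2).
  by move=> a; apply: N.ltb_irrefl.
- case: s h3 l2 {se sa ss} => [|a s] //= -> /= l2; split=> //.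
  by rewrite -[X in last X](_ : N.to_nat 3 = 3) // last_map l2.
by move=> k /mapP[a /se ae ->]; apply: leaf_entryP.
Qed.

(** The default path 3, 12, 2 is what makes 12 Q <= x the standing assumption on blocks. *)
Definition leaf x Q : seq nat :=
  foldr (fun (d : N * seq N) best =>
    if (2 * N.to_nat d.1 * Q <= x) && (size best <= size d.2) then [seq N.to_nat k | k <- d.2]
    else best) [:: 3; 12; 2] leaf_data.

Lemma leaf_max x Q d : d \in leaf_data -> 2 * N.to_nat d.1 * Q <= x ->
  size d.2 <= size (leaf x Q).
Proof.
rewrite /leaf; elim: leaf_data => // e s IH; rewrite inE => /orP[/eqP->|ds] h /=.
  by rewrite h /=; case: ifP => [_|/negbT]; rewrite ?size_map // -ltnNge => /ltnW.
have {}IH := IH ds h; case: ifP => // /andP[_ h2].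
by apply: leq_trans IH _; rewrite size_map.
Qed.

Lemma leaf_valid x Q : 0 < Q -> 12 * Q <= x ->
  [/\ sorted divisor_adj (leaf x Q), uniq (leaf x Q),
      head 0 (leaf x Q) = 3 /\ last 0 (leaf x Q) = 2 &
      forall k, k \in leaf x Q ->
        [/\ 1 < k, k != 6, k * Q <= x & forall p, prime p -> p %| k -> p <= 17]].
Proof.
move=> Q0 xQ; rewrite /leaf; have := leaf_data_ok.
elim: leaf_data => [_|[t s] r IH /andP[ok /IH {}IH]] /=.
  split=> // k; rewrite !inE => kE; have k12 : k <= 12 by case/or3P: kE => /eqP->.
  split; [by case/or3P: kE => /eqP-> | by case/or3P: kE => /eqP-> | | ].
    by apply: leq_trans xQ; rewrite leq_mul2r k12 orbT.
  by move=> p pp pk; apply: leq_trans (_ : _ <= 12) _ => //; apply: leq_trans k12;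
    apply: dvdn_leq pk; case/or3P: kE => /eqP->.
case: ifP => // /andP[tQ _]; have [h1 h2 h3 h4] := leaf_okP (d := (t, s)) ok.
split=> // k /h4[k1 k6 k2 kp]; split=> //.
by apply: leq_trans tQ; rewrite leq_mul2r k2 orbT.
Qed.

Definition leaf_slices : seq (N * N) :=
  [seq (d.1, N.succ (N.of_nat (size d.2))) | d <- leaf_data].

(** * Integer tables *)

(* Row [i], column [j] of the table concerns the products [n] with [j <= K ln n / ln x < j + 1] to
   which only primes above [x ^ (i / K)] are still adjoined.  [direct_row] counts the adjunction of
   one prime and the rows proper that of at least two, all in units of [1 / D]. *)
Section GridTable.
Variables (K J1 J2 i1 : nat) (D s r b G : N).

Fixpoint row_add (u v : seq N) : seq N :=
  match u, v with
  | a :: u', c :: v' => N.add a c :: row_add u' v'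
  | [::], _ => v
  | _, [::] => u
  end.

Definition direct_row : seq N :=
  nseq (uphalf K) N0 ++
  [seq N.div (N.mul D (N.of_nat K)) (N.of_nat (K - j)) | j <- iota (uphalf K) (K - uphalf K)].

Fixpoint row_bump (w : N) (h u : seq N) : seq N :=
  match h, u with
  | a :: h', c :: (d :: _) as u' =>
      N.add a (N.shiftr (N.mul w (N.min c d)) s) :: row_bump w h' u'
  | _, _ => h
  end.

Definition total_row (e : seq N) i (h : seq N) := row_add h (take (K - i.+1) e).

(** A prime of cell i sends column j to column j + i or j + i + 1, hence the minimum of two
    neighbours in [row_bump]. Only columns j > i are changed, for there the prime does not exceed n
    and density is preserved; the first of them, j = i + 1, looks at column i + (i + 1) of [g]. The
    factor r / 2^s over i + 1 bounds the sum of 1 / p over the cell from below. *)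
Definition next_row i (h g : seq N) :=
  take i.+1 h ++ row_bump (N.div r (N.of_nat i.+1)) (drop i.+1 h) (drop (i + i.+1) g).

Fixpoint slope_test (i c : N) (g : seq N) : bool :=
  if g is a :: g' then
    N.leb (N.mul b (N.mul D (N.min c (N.of_nat J1)))) (N.mul 100 (N.mul a i)) &&
    slope_test i (N.succ c) g'
  else true.

(** Row i1 gets a constant lower bound. The rows above it serve a prime p of cell i - 1 that has
    just carried a product n past x^(J1/K). If p n lies in column j, then ln n is at most min(j + 1
    - (i - 1), J1) cells, and the gain is tested against b / 100 times this number over i - 1.
    Density of p excludes the columns j < 2 (i - 1) - 1. *)
Definition row_test i (g : seq N) : bool :=
  (if i == i1 then (J2 <= size g)%N && all (N.leb G) (take (J2 - J1) (drop J1 g)) else true) &&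
  (if (i1 < i <= J1.+1)%N then
     let j0 := maxn J1 (i.-1).*2.-1 in
     (J1 + i.+1 <= size g)%N &&
     slope_test (N.of_nat i.-1) (N.of_nat (j0.+1 - i.-1)) (take (J1 + i.+1 - j0) (drop j0 g))
   else true).

Fixpoint grid_test e i (h : seq N) : bool :=
  let g := total_row e i h in
  row_test i g &&
  (if i is i'.+1 then if (i' < i1)%N then true else grid_test e i' (next_row i' h g) else true).

Lemma nth_row_add u v j : nth N0 (row_add u v) j = N.add (nth N0 u j) (nth N0 v j).
Proof.
elim: u v j => [|a u IH] v j; first by rewrite nth_nil.
case: v => [|c v]; first by rewrite nth_nil N.add_0_r.
by case: j => //= j; apply: IH.
Qed.

Lemma nth_take_le (u : seq N) m j :
  nth N0 (take m u) j = if (j < m)%N then nth N0 u j else N0.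
Proof.
case: ltnP => h; first exact: nth_take.
by rewrite nth_default // size_take; case: ltnP => // h'; apply: leq_trans h.
Qed.

Lemma nth_row_bump w h u j : let m := N.min (nth N0 u j) (nth N0 u j.+1) in
  nth N0 (row_bump w h u) j = nth N0 h j \/
  nth N0 (row_bump w h u) j = N.add (nth N0 h j) (N.shiftr (N.mul w m) s).
Proof.
elim: h u j => [|a h IH] [|c [|d u]] j /=; try by left.
case: j => [|j] /=; first by right.
exact: IH.
Qed.

Lemma nth_next_row i h g j :
  nth N0 (next_row i h g) j = nth N0 h j \/
  (i < j)%N /\ nth N0 (next_row i h g) j = N.add (nth N0 h j)
    (N.shiftr (N.mul (N.div r (N.of_nat i.+1)) (N.min (nth N0 g (j + i)) (nth N0 g (j + i).+1))) s).
Proof.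
rewrite /next_row; case: (leqP (size h) i.+1) => hi.
  by left; rewrite take_oversize // drop_oversize //= cats0.
rewrite nth_cat size_take hi; case: (ltnP j i.+1) => ji; first by left; rewrite nth_take.
have [->|->] := nth_row_bump (N.div r (N.of_nat i.+1)) (drop i.+1 h) (drop (i + i.+1) g) (j - i.+1).
  by left; rewrite nth_drop subnKC.
right; split=> //; rewrite !nth_drop subnKC //.
by congr (N.add _ (N.shiftr (N.mul _ (N.min (nth _ _ _) (nth _ _ _))) _)); lia.
Qed.

Lemma direct_rowP i j : nth N0 (take (K - i.+1) direct_row) j =
  if (K <= 2 * j)%N && (i + j + 2 <= K)%N then
    N.div (N.mul D (N.of_nat K)) (N.of_nat (K - j)) else N0.
Proof.
rewrite nth_take_le; case: ltnP => h; last by rewrite andbC (_ : (i + j + 2 <= K)%N = false) //;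
  lia.
have -> : (i + j + 2 <= K)%N by lia.
rewrite andbT /direct_row nth_cat size_nseq nth_nseq.
have -> : (K <= 2 * j)%N = (uphalf K <= j)%N by rewrite leq_uphalf_double mul2n.
case: ltnP => jK //.
by rewrite (nth_map 0%N) ?size_iota ?nth_iota ?subnKC //; lia.
Qed.

Lemma slope_testP i c g k : slope_test i c g -> (k < size g)%N ->
  N.leb (N.mul b (N.mul D (N.min (N.add c (N.of_nat k)) (N.of_nat J1)))) (N.mul 100 (N.mul (nth
    N0 g k) i)).
Proof.
elim: g c k => //= a g IH c k /andP[h1 h2]; case: k => [|k] kg; first by rewrite N.add_0_r.
have -> : N.add c (N.of_nat k.+1) = N.add (N.succ c) (N.of_nat k) by lia.
exact: IH.
Qed.

End GridTable.

(** * Logarithms and constants in fixed point *)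

(** The sixteenth power makes the integer part of log_2 resolve steps of 1/16. *)
Definition log16 (a : N) : N := N.log2 (N.pow a 16).

Definition prime_logs : seq (N * N) := Eval vm_compute in
  [seq (N.of_nat p, log16 (N.of_nat p)) | p <- primes_in 0 (N.to_nat 4096)].

Lemma prime_logsE :
  prime_logs = [seq (N.of_nat p, log16 (N.of_nat p)) | p <- primes_in 0 (N.to_nat 4096)].
Proof. by vm_compute. Qed.

Definition logs_in (a b : N) := [seq q <- prime_logs | N.ltb a q.1 && N.leb q.1 b].

Lemma filter_none (T : eqType) (P : pred T) s : {in s, forall y, ~~ P y} -> filter P s = [::].
Proof.
move=> sP; rewrite (eq_in_filter (a2 := pred0)) ?filter_pred0 // => y ys.
exact/negbTE/sP.
Qed.

Lemma primes_in_filter a b c : (b <= c)%N ->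
  primes_in a b = [seq p <- primes_in 0 c | (a < p) && (p <= b)].
Proof.
move=> bc; case: (leqP a b) => ab; last first.
  rewrite primes_in_nil ?(ltnW ab) // (@eq_filter _ _ pred0) ?filter_pred0 // => p /=.
  by apply/negbTE; rewrite negb_and -leqNgt -ltnNge; case: (leqP p a) => //= /(ltn_trans ab).
rewrite (@primes_in_cat 0 a c) ?(leq_trans ab) // (@primes_in_cat a b c) ?ab // !filter_cat.
rewrite (@filter_none _ _ (primes_in 0 a)) ?(@filter_none _ _ (primes_in b c)) ?cats0; last 2 first.
- by move=> p; rewrite mem_primes_in => /and3P[_ bp _];
  rewrite negb_and -[~~ (p <= b)%N]ltnNge bp orbT.
- by move=> p; rewrite mem_primes_in => /and3P[_ _ pa]; rewrite negb_and -leqNgt pa.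
apply/esym/all_filterP/allP => p; rewrite mem_primes_in => /and3P[_ -> ->] //.
Qed.

Lemma logs_inE a b : N.leb b 4096 ->
  logs_in a b = [seq (N.of_nat p, log16 (N.of_nat p)) | p <- primes_in (N.to_nat a) (N.to_nat b)].
Proof.
move=> /N.leb_le b4; rewrite (@primes_in_filter _ _ (N.to_nat 4096)); last by lia.
rewrite /logs_in prime_logsE filter_map; congr map; apply: eq_filter => p /=.
congr (_ && _); apply/idP/idP => h.
- by move/N.ltb_lt: h => h; lia.
- by apply/N.ltb_lt; lia.
- by move/N.leb_le: h => h; lia.
- by apply/N.leb_le; lia.
Qed.

Definition unit40 : N := N.pow 2 40.
(** The argument is a value of [log16]. The fractions are those of 9/13 <= ln 2 <= 43/62 divided by
    16, as 208 = 16 * 13 and 992 = 16 * 62. *)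
Definition ln_lo (a : N) : N := N.div (N.mul (N.mul unit40 a) 9) 208.
Definition ln_hi (a : N) : N := N.succ (N.div (N.mul (N.mul unit40 (N.succ a)) 43) 992).
Definition sumN (s : seq N) : N := foldr N.add N0 s.
(** An upper bound for a constant E with L_m >= ln m - E. The last summand covers the primes above
    4096, since 2 (ln 4096 + 2) < 21. *)
Definition mertens_shift : N := Eval vm_compute in
  N.add (N.add (N.add unit40
    (sumN [seq N.succ (N.div (ln_hi q.2) (N.pred q.1)) | q <- logs_in 0 17]))
    (sumN [seq N.succ (N.div (N.mul 2 (ln_hi q.2)) (N.pred (N.mul q.1 q.1))) | q <- logs_in 17
      4096]))
    (N.succ (N.div (N.mul unit40 21) 4096)).
Lemma mertens_shiftE : mertens_shift = N.add (N.add (N.add unit40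
    (sumN [seq N.succ (N.div (ln_hi q.2) (N.pred q.1)) | q <- logs_in 0 17]))
    (sumN [seq N.succ (N.div (N.mul 2 (ln_hi q.2)) (N.pred (N.mul q.1 q.1))) | q <- logs_in 17
      4096]))
    (N.succ (N.div (N.mul unit40 21) 4096)).
Proof. by vm_compute. Qed.

Definition Pi_lo (t : N) : N :=
  foldl (fun P q => N.div (N.mul P q.1) (N.succ q.1)) unit40 (logs_in 17 t).
Definition Lsum_lo (t : N) : N :=
  sumN [seq N.div (ln_lo q.2) (N.succ q.1) | q <- logs_in 17 t].
(** A lower bound for prod (1 - 1/p) over p <= 17 times prod (1 - 1/p^2) over p > 17. The factor
    4096 / 4097 is the product of 1 - 1/k^2 over all integers k > 4096, a lower bound for the
    product over the primes among them. *)
Definition euler_const : N := Eval vm_compute in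
  N.div (N.mul (foldl (fun P q => N.div (N.mul P (N.pred (N.mul q.1 q.1))) (N.mul q.1 q.1))
    (foldl (fun P q => N.div (N.mul P (N.pred q.1)) q.1) unit40 (logs_in 0 17))
     (logs_in 17 4096)) 4096) 4097.

Lemma euler_constE : euler_const =
  N.div (N.mul (foldl (fun P q => N.div (N.mul P (N.pred (N.mul q.1 q.1))) (N.mul q.1 q.1))
    (foldl (fun P q => N.div (N.mul P (N.pred q.1)) q.1) unit40 (logs_in 0 17))
     (logs_in 17 4096)) 4096) 4097.
Proof. by vm_compute. Qed.

From mathcomp Require Import all_order all_algebra.
From mathcomp Require Import reals sequences exp.
From mathcomp Require Import ring lra.

Import Order.TTheory GRing.Theory Num.Theory.
Local Open Scope ring_scope.

(** * Elementary prime number estimates *)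

Section PrimeSums.
Variable R : realType.
Implicit Types (m n p : nat).

Local Notation lnn n := (ln (n%:R : R)).

Lemma lnn_ge0 n : 0 <= lnn n.
Proof.
case: n => [|n]; first by rewrite ln0.
by apply: ln_ge0; rewrite ler1n.
Qed.

Lemma ler_lnn m n : (0 < m)%N -> (m <= n)%N -> lnn m <= lnn n.
Proof.
move=> m0 mn; rewrite ler_ln ?posrE ?ltr0n ?ler_nat //.
exact: leq_trans mn.
Qed.

Lemma lnnM m n : (0 < m)%N -> (0 < n)%N -> lnn (m * n) = lnn m + lnn n.
Proof. by move=> m0 n0; rewrite natrM lnM ?posrE ?ltr0n. Qed.

Lemma lnn_logn n N : (0 < n)%N -> (forall p, prime p -> p %| n -> p <= N)%N ->
  lnn n = \sum_(0 <= p < N.+1 | prime p) (logn p n)%:R * lnn p.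
Proof.
move=> n0 nN; apply: expR_inj; rewrite lnK ?posrE ?ltr0n // expR_sum.
rewrite {1}(prod_prime_decomp n0) prime_decompE big_map /= natr_prod.
have -> : \prod_(p <- primes n) (p ^ logn p n)%:R =
          \prod_(0 <= p < N.+1 | p \in primes n) ((p ^ logn p n)%:R : R).
  rewrite -[RHS]big_filter; apply: perm_big; apply: uniq_perm.
  - exact: primes_uniq.
  - by rewrite filter_uniq // iota_uniq.
  - move=> p; rewrite mem_filter mem_index_iota /=.
    case: (boolP (p \in _)) => //=; rewrite mem_primes => /and3P[pp _ pn].
    by rewrite ltnS nN.
rewrite [RHS]big_mkcond [LHS]big_mkcond /=; apply: eq_bigr => p _.
case: (boolP (p \in primes n)) => [|pN].
  rewrite mem_primes => /and3P[pp _ _]; rewrite pp.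
  by rewrite expRM_natl lnK ?posrE ?ltr0n ?prime_gt0 // natrX.
case: (boolP (prime p)) => // pp.
by move: pN; rewrite -logn_gt0 lt0n negbK => /eqP ->; rewrite mul0r expR0.
Qed.

Lemma prime_dvd_fact p n : prime p -> (p %| n`!)%N -> (p <= n)%N.
Proof.
move=> pp; elim: n => [|n IH]; first by rewrite fact0 dvdn1 => /eqP p1; rewrite p1 in pp.
by rewrite factS Euclid_dvdM // => /orP[/dvdn_leq->//|/IH/leqW].
Qed.

Lemma lnn_fact n N : (n <= N)%N ->
  lnn n`! = \sum_(0 <= p < N.+1 | prime p) (logn p n`!)%:R * lnn p.
Proof.
move=> nN; apply: lnn_logn => [|p pp /(prime_dvd_fact pp) pn]; first exact: fact_gt0.
exact: leq_trans nN.
Qed.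

Lemma ln_succ_le n : (0 < n)%N -> lnn n.+1 <= lnn n + n%:R^-1.
Proof.
move=> n0; have n0' : (0 : R) < n%:R by rewrite ltr0n.
have -> : n.+1%:R = n%:R * (1 + n%:R^-1) :> R.
  by rewrite mulrDr mulr1 mulfV ?gt_eqF // -natr1.
have i0 : 0 < (n%:R^-1 : R) by rewrite invr_gt0.
rewrite lnM ?posrE // ?addr_gt0 //.
by rewrite lerD2l le_ln1Dx // (lt_trans _ i0) // ltrN10.
Qed.

Lemma ln_succ_ge n : (0 < n)%N -> lnn n + n.+1%:R^-1 <= lnn n.+1.
Proof.
move=> n0; have n0' : (0 : R) < n.+1%:R by rewrite ltr0n.
have n1 : (0 : R) < n%:R by rewrite ltr0n.
have -> : n%:R = n.+1%:R * (1 - n.+1%:R^-1) :> R.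
  by rewrite mulrBr mulr1 mulfV ?gt_eqF // -natr1; ring.
have i0 : (n.+1%:R^-1 : R) < 1 by rewrite invf_lt1 // ltr1n.
rewrite lnM ?posrE ?subr_gt0 //.
have : ln (1 - n.+1%:R^-1) <= - n.+1%:R^-1 :> R.
  by apply: le_ln1Dx; rewrite ltrN2.
move: (_^-1) (ln _) (ln _) => i a b; lra.
Qed.

Lemma lnn_fact_ge n : n%:R * lnn n - n%:R <= lnn n`!.
Proof.
elim: n => [|n IH]; first by rewrite mul0r subr0 fact0 ln1.
rewrite factS lnnM ?fact_gt0 //.
case: n IH => [|n] IH; first by rewrite !fact0 ln1; lra.
have := ln_succ_le (ltn0Sn n); have n0 : (0 : R) < n.+1%:R by rewrite ltr0n.
move=> h; have : n.+1%:R * lnn n.+2 <= n.+1%:R * lnn n.+1 + 1.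
  by apply: le_trans (ler_wpM2l (ltW n0) h) _; rewrite mulrDr mulfV ?gt_eqF.
rewrite -[n.+2%:R]natr1; rewrite natr1; move: IH; rewrite -[n.+2]addn1 natrD.
lra.
Qed.

Lemma lnn_fact_le n : (0 < n)%N -> lnn n`! <= n%:R * lnn n - n%:R + lnn n + 1.
Proof.
case: n => // n _; elim: n => [|n IH]; first by rewrite (_ : 1`! = 1)%N // ln1; lra.
rewrite factS lnnM ?fact_gt0 //.
have n0 : (0 : R) < n.+2%:R by rewrite ltr0n.
have := ln_succ_ge (ltn0Sn n) => h.
have : n.+2%:R * lnn n.+1 + 1 <= n.+2%:R * lnn n.+2.
  by apply: le_trans _ (ler_wpM2l (ltW n0) h); rewrite mulrDr mulfV ?gt_eqF.
move: IH; rewrite -[n.+2]addn1 natrD.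
lra.
Qed.

(** A geometric series in integers: the remainder n %/ p ^ K telescopes because p times the next
    quotient is at most the current one. *)
Lemma logn_fact_geom p n K : (1 < p)%N ->
  ((p - 1) * \sum_(1 <= k < K.+1) n %/ p ^ k <= n - n %/ p ^ K)%N.
Proof.
move=> p1; elim: K => [|K IH]; first by rewrite big_geq // muln0.
rewrite big_nat_recr //= mulnDr.
have h : (n %/ p ^ K.+1 * p <= n %/ p ^ K)%N.
  by rewrite expnSr divnMA leq_trunc_div.
have h2 : (n %/ p ^ K <= n)%N by apply: leq_div.
move: IH h h2; move: (\sum_(1 <= k < K.+1) _)%N (n %/ p ^ K)%N (n %/ p ^ K.+1)%N => S a b.
rewrite [((p - 1) * b)%N]mulnC mulnBr muln1.
have := leq_pmulr b (ltnW p1).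
by move: (b * p)%N ((p - 1) * S)%N => c d; lia.
Qed.

Lemma logn_fact_le p n : prime p -> (logn p n`!)%:R <= n%:R / (p%:R - 1) :> R.
Proof.
move=> pp; have p1 := prime_gt1 pp.
have p0 : (0 : R) < p%:R - 1 by rewrite subr_gt0 ltr1n.
rewrite logn_fact // ler_pdivlMr // mulrC -[1]/(1%:R) -natrB ?(ltnW p1) // -natrM ler_nat.
exact: leq_trans (logn_fact_geom n n p1) (leq_subr _ _).
Qed.

Lemma logn_fact_ge p n : prime p -> n%:R / p%:R - 1 <= (logn p n`!)%:R :> R.
Proof.
move=> pp; have p0 : (0 : R) < p%:R by rewrite ltr0n prime_gt0.
apply: (@le_trans _ _ (n %/ p)%:R).
  rewrite lerBlDr natr1 ler_pdivrMr // -natrM ler_nat.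
  by rewrite ltnW // -ltn_divLR ?prime_gt0.
case: n => [|n]; first by rewrite div0n.
rewrite ler_nat logn_fact // big_nat_recl //= expn1.
exact: leq_addr.
Qed.

(** Legendre's exponents of n! are at most n / (p - 1), and ln n! >= n ln n - n. The constant 1 is
    worth keeping sharp: it enters [mertens_shift] and through it the final constant, unlike the
    crude errors further on. *)
Lemma sum_lnp_pred_ge n : (0 < n)%N ->
  lnn n - 1 <= \sum_(0 <= p < n.+1 | prime p) lnn p / (p%:R - 1).
Proof.
move=> n0; have n0' : (0 : R) < n%:R by rewrite ltr0n.
rewrite -(ler_pM2l n0') mulrBr mulr1; apply: le_trans (lnn_fact_ge n) _.
rewrite (lnn_fact (leqnn n)) mulr_sumr; apply: ler_sum => p pp.
by rewrite [leRHS]mulrCA [leLHS]mulrC ler_wpM2l ?lnn_ge0 ?logn_fact_le.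
Qed.

Lemma lnn_fact_le_mul n : lnn n`! <= n%:R * lnn n.
Proof.
elim: n => [|n IH]; first by rewrite fact0 ln1 mul0r.
rewrite factS lnnM ?fact_gt0 //.
have -> : n.+1%:R * lnn n.+1 = lnn n.+1 + n%:R * lnn n.+1.
  by rewrite -[X in X%:R * _]addn1 natrD mulrDl mul1r addrC.
rewrite lerD2l.
apply: le_trans IH _; rewrite ler_wpM2l //.
by case: n => [|n]; [rewrite ln0 ?lnn_ge0 | apply: ler_lnn].
Qed.

Lemma sum_lnp_le n : (0 < n)%N ->
  \sum_(0 <= p < n.+1 | prime p) lnn p / p%:R <=
  lnn n + (\sum_(0 <= p < n.+1 | prime p) lnn p) / n%:R.
Proof.
move=> n0; have n0' : (0 : R) < n%:R by rewrite ltr0n.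
rewrite -(ler_pM2l n0') mulrDr mulrCA mulfV ?gt_eqF // mulr1 -lerBlDr.
apply: le_trans _ (lnn_fact_le_mul n).
rewrite (lnn_fact (leqnn n)) mulr_sumr -sumrB; apply: ler_sum => p pp.
rewrite mulrCA -[X in _ - X]mulr1 -mulrBr [leRHS]mulrC.
by rewrite ler_wpM2l ?lnn_ge0 ?logn_fact_ge.
Qed.

Lemma ln2_le1 : lnn 2 <= 1.
Proof. by have := @le_ln1Dx R 1; rewrite -[1 + 1]/(2%:R); apply; lra. Qed.

(** Each prime between m and 2 m divides the central binomial coefficient, whose logarithm is 2 m ln
    2 up to logarithmic terms. *)
Lemma theta_dyadic m : (0 < m)%N ->
  \sum_(m.+1 <= p < m.*2.+1 | prime p) lnn p <= 5 * m%:R.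
Proof.
move=> m0; have m20 : (0 < m.*2)%N by rewrite double_gt0.
have mm : (m <= m.*2)%N by rewrite -addnn leq_addr.
have b0 : (0 < 'C(m.*2, m))%N by rewrite bin_gt0.
have bf := bin_fact mm; rewrite -addnn addnK addnn in bf.
have lnb : lnn 'C(m.*2, m) = lnn (m.*2)`! - (lnn m`! + lnn m`!).
  by rewrite -bf !lnnM ?muln_gt0 ?fact_gt0 //; ring.
apply: (@le_trans _ _ (lnn 'C(m.*2, m))).
  rewrite (@lnn_logn _ m.*2) //; last first.
    move=> p pp pb; apply: (prime_dvd_fact pp).
    by rewrite -bf dvdn_mulr.
  rewrite [leRHS](big_cat_nat (n := m.+1)) /=; [|by []|by rewrite ltnS].
  apply: ler_wpDl; first by apply: sumr_ge0 => p _; rewrite mulr_ge0 ?lnn_ge0.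
  rewrite big_nat_cond [leRHS]big_nat_cond; apply: ler_sum => p /andP[/andP[mp pm] pp].
  rewrite -[leLHS]mul1r ler_wpM2r ?lnn_ge0 // ler1n logn_gt0 mem_primes pp b0 /=.
  have : (p %| (m.*2)`!)%N by rewrite dvdn_fact // prime_gt0.
  rewrite -bf !Euclid_dvdM // => /orP[//|].
  by rewrite orbb => /(prime_dvd_fact pp); rewrite leqNgt mp.
rewrite lnb; have := lnn_fact_le m20; have := lnn_fact_ge m.
have -> : lnn m.*2 = lnn 2 + lnn m by rewrite -mul2n lnnM.
have -> : (m.*2)%:R = 2 * m%:R :> R by rewrite -mul2n natrM.
have h2 := ln2_le1.
have hm : lnn m <= m%:R by rewrite ltW // ln_sublinear // ltr0n.
have m1 : (1 : R) <= m%:R by rewrite ler1n.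
have : m%:R * lnn 2 <= m%:R :> R by rewrite -[leRHS]mulr1 ler_wpM2l.
rewrite -mulrA [_ * (lnn 2 + _)]mulrDr.
move: (lnn m`!) (lnn (m.*2)`!) (m%:R * lnn 2) (m%:R * lnn m) => a b c d.
lra.
Qed.

Lemma theta_le n : \sum_(0 <= p < n.+1 | prime p) lnn p <= 10 * n%:R.
Proof.
have [k] := ubnP n; elim: k n => // k IH n; rewrite ltnS => nk.
case: n nk => [|[|[|n]]] nk.
- by rewrite unlock /= mulr0.
- by rewrite unlock /= mulr1.
- by rewrite unlock /= addr0; have := ln2_le1; lra.
(* Half of the number, rounded up: induction at m and the dyadic bound give 15 m, which is at most
   ten times the number from 3 on; hence the three base cases. *)
pose m := (n.+4)./2.
have mE : (n.+3 <= m.*2 <= n.+4)%N.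
  by have := odd_double_half n.+4; rewrite -/m; case: (odd _); lia.
have m0 : (0 < m)%N by lia.
have mn : (m < k)%N by lia.
apply: (@le_trans _ _ (\sum_(0 <= p < m.*2.+1 | prime p) lnn p)).
  rewrite [leRHS](big_cat_nat (n := n.+4)) //=; last by lia.
  by rewrite lerDl sumr_ge0 // => p _; apply: lnn_ge0.
rewrite (big_cat_nat (n := m.+1)) //=; last by lia.
apply: le_trans (lerD (IH _ mn) (theta_dyadic m0)) _.
have : m.*2%:R <= n.+4%:R :> R by rewrite ler_nat; lia.
have : 0 <= n%:R :> R by [].
rewrite -mul2n natrM -[n.+4]addn4 -[n.+3]addn3 !natrD.
lra.
Qed.

End PrimeSums.

(** * Chebyshev's lower bound *)

Section PrimeSums2.
Variable R : realType.
Implicit Types (m n p : nat).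

Local Notation lnn n := (ln (n%:R : R)).

Lemma logn_fact_wide p m N : prime p -> (m <= N)%N ->
  logn p m`! = (\sum_(1 <= k < N.+1) m %/ p ^ k)%N.
Proof.
move=> pp mN; rewrite logn_fact // [RHS](big_cat_nat (n := m.+1)) //=.
rewrite [X in (_ + X)%N]big_nat_cond [X in (_ + X)%N]big1 ?addn0 // => k /andP[/andP[mk _] _].
by rewrite divn_small // (ltn_trans mk) // ltn_expl // prime_gt1.
Qed.

(* Chebyshev's quotient (30 q)! q! / ((15 q)! (10 q)! (6 q)!), one prime power at a time. *)
Lemma chebyshev_comb a :
  (a + a %/ 30 <= a %/ 2 + a %/ 3 + a %/ 5 + (0 < a))%N.
Proof. lia. Qed.

Lemma chebyshev_logn p q : prime p ->
  (logn p (30 * q)`! + logn p q`! <=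
   logn p (15 * q)`! + logn p (10 * q)`! + logn p (6 * q)`! + trunc_log p (30 * q))%N.
Proof.
move=> pp; set n := (30 * q)%N.
rewrite (@logn_fact_wide _ n n) // (@logn_fact_wide _ q n) //; last by lia.
rewrite (@logn_fact_wide _ (15 * q) n) //; last by lia.
rewrite (@logn_fact_wide _ (10 * q) n) //; last by lia.
rewrite (@logn_fact_wide _ (6 * q) n) //; last by lia.
rewrite -!big_split /=.
have hT : (\sum_(1 <= k < n.+1) (0 < n %/ p ^ k) <= trunc_log p n)%N.
  case: (posnP n) => [->|n0]; first by rewrite big_geq.
  apply: (@leq_trans (\sum_(1 <= k < n.+1) (k <= trunc_log p n))).
    rewrite big_nat_cond [leqRHS]big_nat_cond; apply: leq_sum => k /andP[/andP[k1 _] _].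
    rewrite divn_gt0 ?expn_gt0 ?prime_gt0 //.
    by case: (leqP (p ^ k) n) => //= pk; rewrite trunc_log_max ?prime_gt1.
  rewrite -big_mkcond /= sum1_count.
  apply: (@leq_trans (size (iota 1 (trunc_log p n)))); last by rewrite size_iota.
  rewrite -size_filter; apply: uniq_leq_size; first by rewrite filter_uniq ?iota_uniq.
  by move=> k; rewrite mem_filter !mem_iota; lia.
apply: leq_trans (leq_add (leqnn _) hT); rewrite -big_split /=.
apply: leq_sum => k _.
have d30 d : (0 < d)%N -> (30 %/ d * d)%N = 30%N -> (30 %/ d * q %/ p ^ k = n %/ p ^ k %/ d)%N.
  move=> d0 dd; rewrite divnAC; congr (_ %/ _)%N.
  by rewrite /n -[X in _ = (X * _ %/ _)%N]dd mulnAC mulnK.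
have e30 : (q %/ p ^ k = n %/ p ^ k %/ 30)%N by rewrite -(d30 30%N) // divnn mul1n.
have e2 : (15 * q %/ p ^ k = n %/ p ^ k %/ 2)%N by rewrite -(d30 2%N).
have e3 : (10 * q %/ p ^ k = n %/ p ^ k %/ 3)%N by rewrite -(d30 3%N).
have e5 : (6 * q %/ p ^ k = n %/ p ^ k %/ 5)%N by rewrite -(d30 5%N).
by rewrite e30 e2 e3 e5 chebyshev_comb.
Qed.

Lemma big_primes_in (F : nat -> R) a b :
  \sum_(p <- primes_in a b) F p = \sum_(a.+1 <= p < b.+1 | prime p) F p.
Proof. by rewrite big_filter. Qed.

Lemma big_primes_in0 (F : nat -> R) b :
  \sum_(p <- primes_in 0 b) F p = \sum_(0 <= p < b.+1 | prime p) F p.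
Proof.
by rewrite big_primes_in [RHS]big_ltn_cond.
Qed.

(** The terms q ln q cancel, as 30 + 1 = 15 + 10 + 6, and 14 ln 2 + 9 ln 3 + 5 ln 5 equals 30 ln 30
    - 15 ln 15 - 10 ln 10 - 6 ln 6. On the other side every prime contributes at most its largest
    power below 30 q, that is, at most ln (30 q). *)
Lemma chebyshev q : (0 < q)%N ->
  q%:R * (14 * lnn 2 + 9 * lnn 3 + 5 * lnn 5) - 3 * lnn (30 * q) - 3 <=
  (size (primes_in 0 (30 * q)))%:R * lnn (30 * q).
Proof.
move=> q0; set n := (30 * q)%N; have n0 : (0 < n)%N by rewrite muln_gt0.
have H : lnn n`! + lnn q`! <=
    lnn (15 * q)`! + lnn (10 * q)`! + lnn (6 * q)`! + (size (primes_in 0 n))%:R * lnn n.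
  rewrite (@lnn_fact _ n n) // (@lnn_fact _ q n) //; last by rewrite /n; lia.
  rewrite (@lnn_fact _ (15 * q) n); last by rewrite /n; lia.
  rewrite (@lnn_fact _ (10 * q) n); last by rewrite /n; lia.
  rewrite (@lnn_fact _ (6 * q) n); last by rewrite /n; lia.
  have -> : (size (primes_in 0 n))%:R * lnn n = \sum_(0 <= p < n.+1 | prime p) lnn n.
    by rewrite -big_primes_in0 big_const_seq count_predT iter_addr_0 mulr_natl.
  rewrite -!big_split /=; apply: ler_sum => p pp.
  apply: (@le_trans _ _ (((logn p (15 * q)`! + logn p (10 * q)`! + logn p (6 * q)`!)%:R +
     (trunc_log p n)%:R) * lnn p)).
    by rewrite -mulrDl ler_wpM2r ?lnn_ge0 // -!natrD ler_nat chebyshev_logn.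
  rewrite (natrD _ (_ + logn p (10 * q)`!)) (natrD _ (logn _ _)) !mulrDl lerD2l.
  rewrite mulr_natl -lnXn ?ltr0n ?prime_gt0 //.
  rewrite -natrX; apply: ler_lnn; first by rewrite expn_gt0 prime_gt0.
  by rewrite trunc_logP ?prime_gt1.
have l a : (0 < a)%N -> lnn (a * q) = lnn a + lnn q by move=> a0; rewrite lnnM.
have l6 : lnn 6 = lnn 2 + lnn 3 by rewrite -lnnM.
have l10 : lnn 10 = lnn 2 + lnn 5 by rewrite -lnnM.
have l15 : lnn 15 = lnn 3 + lnn 5 by rewrite -lnnM.
have l30 : lnn 30 = lnn 2 + lnn 3 + lnn 5 by rewrite -!lnnM.
have h15 : (0 < 15 * q)%N by rewrite muln_gt0.
have h10 : (0 < 10 * q)%N by rewrite muln_gt0.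
have h6 : (0 < 6 * q)%N by rewrite muln_gt0.
move: H (lnn_fact_ge R n) (lnn_fact_ge R q) (lnn_fact_le R h15) (lnn_fact_le R h10)
  (lnn_fact_le R h6).
have l2 := lnn_ge0 R 2; have l3 := lnn_ge0 R 3; have l5 := lnn_ge0 R 5.
move: (lnn n`!) (lnn q`!) (lnn (15 * q)`!) (lnn (10 * q)`!) (lnn (6 * q)`!).
have -> : lnn n = lnn 2 + lnn 3 + lnn 5 + lnn q by rewrite -l30 -l.
rewrite (l 15%N) // (l 10%N) // (l 6%N) // l6 l10 l15.
move: (size _)%:R; rewrite /n !natrM.
move: (lnn 2) (lnn 3) (lnn 5) l2 l3 l5 (lnn q) (q%:R).
move=> a b c a0 b0 c0 d e S f1 f2 f3 f4 f5; lra.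
Qed.

End PrimeSums2.

(** * Mertens' first theorem with explicit errors *)

Section Mertens.
Variable R : realType.
Implicit Types (m n p : nat).

Local Notation lnn n := (ln (n%:R : R)).

Lemma mertens_le n : (0 < n)%N ->
  \sum_(p <- primes_in 0 n) lnn p / p%:R <= lnn n + 10.
Proof.
move=> n0; rewrite big_primes_in0; apply: le_trans (sum_lnp_le R n0) _.
by rewrite lerD2l ler_pdivrMr ?ltr0n // theta_le.
Qed.

(** The function (ln u + 2) / u has derivative - (ln u + 1) / u^2; the summand 2 gives its
    differences enough room to dominate. *)
Lemma lnp_telescope m : (1 < m)%N ->
  lnn m / (m%:R * (m%:R - 1)) <=
  (lnn m.-1 + 2) / m.-1%:R - (lnn m + 2) / m%:R.
Proof.
case: m => [//|[//|m]] _ /=; set a := m.+1%:R : R.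
have a0 : 0 < a by rewrite ltr0n.
have -> : m.+2%:R = a + 1 :> R by rewrite natr1.
have h : ln (a + 1) <= ln a + a^-1.
  by have := ln_succ_le R (ltn0Sn m); rewrite -[m.+2]addn1 natrD.
have a1 : 1 <= a by rewrite ler1n.
have i1 : a^-1 * a = 1 by rewrite mulVf ?gt_eqF.
have i2 : a^-1 <= 1 by rewrite invf_le1.
rewrite -subr_ge0.
have -> : (ln a + 2) / a - (ln (a + 1) + 2) / (a + 1) - ln (a + 1) / ((a + 1) * (a + 1 - 1)) =
   ((ln a + 2) * (a + 1) - (ln (a + 1) + 2) * a - ln (a + 1)) / (a * (a + 1)).
  by field; apply/andP; split; apply/eqP; lra.
apply: divr_ge0; last by rewrite mulr_ge0; lra.
move: (a^-1) (ln (a + 1)) (ln a) h i1 i2 => i x y h i1 i2.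
have : (x - y) * (a + 1) <= i * (a + 1) by rewrite ler_wpM2r; lra.
lra.
Qed.

Lemma sum_lnp_telescope a b : (0 < a)%N -> (a <= b)%N ->
  \sum_(a.+1 <= m < b.+1) lnn m / (m%:R * (m%:R - 1)) <=
  (lnn a + 2) / a%:R - (lnn b + 2) / b%:R.
Proof.
move=> a0; elim: b => [|b IH]; first by rewrite leqn0; case: (a) a0.
rewrite leq_eqVlt => /orP[/eqP<-|ab]; first by rewrite big_geq // subrr.
rewrite big_nat_recr //=; have := lerD (IH ab) (@lnp_telescope b.+1 _).
rewrite /= addrA => H; apply: le_trans (H _) _; first by lia.
by rewrite addrNK.
Qed.

Lemma mertens_ge n : (0 < n)%N ->
  lnn n - 3 <= \sum_(p <- primes_in 0 n) lnn p / p%:R.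
Proof.
move=> n0; rewrite big_primes_in0.
have h := sum_lnp_telescope (ltn0Sn 0) n0.
have h0 : 0 <= (lnn n + 2) / n%:R by rewrite divr_ge0 // addr_ge0 // lnn_ge0.
have := sum_lnp_pred_ge R n0.
have : \sum_(0 <= p < n.+1 | prime p) lnn p / (p%:R - 1) <=
       \sum_(0 <= p < n.+1 | prime p) lnn p / p%:R +
       \sum_(2 <= m < n.+1) lnn m / (m%:R * (m%:R - 1)).
  have -> : \sum_(0 <= p < n.+1 | prime p) lnn p / (p%:R - 1) =
    \sum_(0 <= p < n.+1 | prime p) lnn p / p%:R +
    \sum_(0 <= m < n.+1 | prime m) lnn m / (m%:R * (m%:R - 1)).
    rewrite -big_split /=; apply: eq_bigr => p pp.
    have p1 : 1 < p%:R :> R by rewrite ltr1n prime_gt1.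
    by field; apply/andP; split; apply/eqP; lra.
  rewrite lerD2l; case: n n0 {h h0} => // n _.
  rewrite 2?big_ltn_cond //= big_mkcond /= big_nat_cond [leRHS]big_nat_cond.
  apply: ler_sum => p /andP[/andP[p2 _] _]; case: ifP => // _.
  rewrite divr_ge0 ?lnn_ge0 // mulr_ge0 // subr_ge0 ler1n; lia.
move: h; rewrite ln1; lra.
Qed.

Lemma mertens_range a b : (0 < a)%N -> (a <= b)%N ->
  lnn b - lnn a - 13 <= \sum_(p <- primes_in a b) lnn p / p%:R <= lnn b - lnn a + 13.
Proof.
move=> a0 ab; have b0 := leq_trans a0 ab.
have := mertens_le b0; have := mertens_ge b0; have := mertens_le a0; have := mertens_ge a0.
rewrite (@primes_in_cat 0 a b) // big_cat /=.
by move=> h1 h2 h3 h4; apply/andP; split; lra.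
Qed.

(** The cell boundaries x^(i/K) are real numbers; their integer parts cut the primes in the same
    places. *)
Definition expn_floor (u : R) : nat := Num.truncn (expR u).

Lemma leq_expn_floor p u : (0 < p)%N -> (p <= expn_floor u)%N = (lnn p <= u).
Proof.
move=> p0; rewrite leqNgt /expn_floor truncn_lt_nat ?expR_ge0 // -leNgt.
by rewrite -{1}[p%:R]lnK ?posrE ?ltr0n // ler_expR.
Qed.

Lemma expn_floor_gt0 u : 0 <= u -> (0 < expn_floor u)%N.
Proof. by move=> u0; rewrite leq_expn_floor // ln1. Qed.

Lemma ln_expn_floor_le u : 0 <= u -> lnn (expn_floor u) <= u.
Proof. by move=> u0; rewrite -leq_expn_floor // expn_floor_gt0. Qed.

Lemma ln_expn_floor_ge u : 0 <= u -> u - 1 <= lnn (expn_floor u).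
Proof.
move=> u0; have y0 := expn_floor_gt0 u0.
have : ~~ (lnn (expn_floor u).+1 <= u) by rewrite -leq_expn_floor // ltnn.
rewrite -ltNge => h.
have := @ler_lnn R (expn_floor u).+1 (2 * expn_floor u) isT _.
rewrite lnnM // => h2; have := h2 ltac:(lia); have := ln2_le1 R; lra.
Qed.

Lemma expn_floor_mono a b : a <= b -> (expn_floor a <= expn_floor b)%N.
Proof. by move=> ab; apply: le_truncn; rewrite ler_expR. Qed.

Lemma expn_floor_ln n : (0 < n)%N -> expn_floor (lnn n) = n.
Proof. by move=> n0; rewrite /expn_floor lnK ?posrE ?ltr0n // natrK. Qed.

Lemma mertens_floor a b : 0 <= a -> a <= b ->
  b - a - 14 <= \sum_(p <- primes_in (expn_floor a) (expn_floor b)) lnn p / p%:R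
  <= b - a + 14.
Proof.
move=> a0 ab; have b0 := le_trans a0 ab.
have /andP[] := mertens_range (expn_floor_gt0 a0) (expn_floor_mono ab).
have := ln_expn_floor_le a0; have := ln_expn_floor_ge a0.
have := ln_expn_floor_le b0; have := ln_expn_floor_ge b0.
move: (\sum_(_ <- _) _) => s; lra.
Qed.

End Mertens.

(** * A lower bound for Euler's product *)

Section EulerProduct.
Variable R : realType.
Implicit Types (m n p : nat).

Local Notation lnn n := (ln (n%:R : R)).

Definition smooth m k := all (fun p => p <= m)%N (primes k).

Lemma smoothP m k : (0 < k)%N ->
  reflect (forall p, prime p -> p %| k -> p <= m)%N (smooth m k).
Proof.
move=> k0; apply: (iffP allP) => H p; last by rewrite mem_primes => /and3P[pp _ /H]; apply.
by move=> pp pk; apply: H; rewrite mem_primes pp k0.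
Qed.

Lemma sum_dvd (F : nat -> R) (P : pred nat) q X : (0 < q)%N ->
  \sum_(1 <= k < X.+1 | (q %| k)%N && P k) F k =
  \sum_(1 <= j < (X %/ q).+1 | P (q * j)%N) F (q * j)%N.
Proof.
move=> q0; rewrite -big_filter -[RHS]big_filter.
rewrite -(@big_map _ _ _ _ _ (fun j => q * j)%N _ xpredT F).
apply: perm_big; apply: uniq_perm.
- by rewrite filter_uniq ?iota_uniq.
- rewrite map_inj_uniq ?filter_uniq ?iota_uniq //.
  by move=> a b /eqP; rewrite eqn_pmul2l // => /eqP.
move=> k; rewrite mem_filter mem_index_iota; apply/idP/mapP.
  move=> /andP[/andP[/dvdnP[j ->] Pk]] /andP[k1 kX].
  exists j; last by rewrite mulnC.
  rewrite ltnS in kX; rewrite mem_filter mem_index_iota ltnS leq_divRL // kX.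
  by rewrite [(q * j)%N]mulnC Pk /=; case: (j) k1.
case=> j; rewrite mem_filter mem_index_iota => /andP[Pj /andP[j1]].
rewrite ltnS leq_divRL // => jX ->.
by rewrite dvdn_mulr // Pj ltnS mulnC jX muln_gt0 j1 q0.
Qed.

Definition harm X : R := \sum_(1 <= k < X.+1) k%:R^-1.

(** Passing to a new prime q, the multiples of q contribute at most 1/q of the whole sum S, so S (1
    - 1/q) is bounded by the previous sum. *)
Lemma smooth_sum_le m X :
  \sum_(1 <= k < X.+1 | smooth m k) (k%:R^-1 : R) <=
  \prod_(p <- primes_in 0 m) (1 - p%:R^-1)^-1.
Proof.
elim: m => [|m IH].
  rewrite big_nil; case: X => [|X]; first by rewrite big_geq.
  rewrite big_ltn_cond //= invr1 big_nat_cond big1 ?addr0 // => k /andP[/andP[k2 _]].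
  move/smoothP => H; have := H ltac:(lia) _ (pdiv_prime k2) (pdiv_dvd k).
  by have := prime_gt0 (pdiv_prime k2); lia.
rewrite (@primes_in_cat 0 m m.+1) ?leqnSn // big_cat /=.
have -> : primes_in m m.+1 = [seq p <- [:: m.+1] | prime p].
  by rewrite /primes_in /index_iota subSS subSnn.
rewrite /=; case: (boolP (prime m.+1)) => pp; last first.
  rewrite big_nil mulr1; apply: le_trans _ IH.
  rewrite big_nat_cond [leRHS]big_nat_cond le_eqVlt; apply/orP; left; apply/eqP.
  apply: eq_bigl => k; case: (boolP (0 < k < X.+1)%N) => //= /andP[k0 _].
  apply/smoothP/smoothP => // H p pq pk; have := H p pq pk; last by lia.
  by rewrite leq_eqVlt ltnS => /orP[/eqP E|//]; rewrite -E pq in pp.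
rewrite big_seq1; set q := m.+1 in pp *; set i : R := q%:R^-1.
have q1 : 1 < q%:R :> R by rewrite ltr1n prime_gt1.
have i1 : i < 1 by rewrite invf_lt1 // (lt_trans _ q1).
have i0 : 0 < i by rewrite invr_gt0 (lt_trans _ q1).
rewrite ler_pdivlMr ?subr_gt0 //.
set S := (X in X * _); rewrite mulrBr mulr1 lerBlDr.
apply: le_trans (lerD IH (lexx _)).
rewrite {1}/S (bigID (fun k => q %| k)%N) /= addrC lerD //.
  rewrite big_nat_cond [leRHS]big_nat_cond.
  rewrite [leRHS](bigID (fun k => smooth q k && ~~ (q %| k)%N)) /=.
  apply: ler_wpDr; first by apply: sumr_ge0 => k _; rewrite invr_ge0.
  rewrite le_eqVlt; apply/orP; left; apply/eqP; apply: eq_bigl => k.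
  case: (boolP (0 < k < X.+1)%N) => //= /andP[k0 _].
  case: (boolP (smooth q k)) => //= [/(smoothP _ k0) H|]; last by rewrite andbF.
  case: (boolP (q %| k)%N) => //= qk; rewrite ?andbF // andbT; symmetry.
  apply/smoothP => // p pq pk; have := H p pq pk; rewrite leq_eqVlt ltnS => /orP[/eqP E|//].
  by rewrite -E pk in qk.
under eq_bigl => k do rewrite andbC.
rewrite sum_dvd // {}/S mulr_suml.
apply: (@le_trans _ _ (\sum_(1 <= j < (X %/ q).+1 | smooth q (q * j)) j%:R^-1 * i)).
  by apply: ler_sum => j _; rewrite natrM invfM mulrC.
rewrite (big_cat_nat (n := (X %/ q).+1) (p := X.+1)) //=; last by rewrite ltnS leq_div.
apply: ler_wpDr; first by apply: sumr_ge0 => k _; rewrite mulr_ge0 ?invr_ge0 // ltW.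
rewrite big_nat_cond [leRHS]big_nat_cond le_eqVlt; apply/orP; left; apply/eqP.
apply: eq_bigl => j; case: (boolP (0 < j < _)%N) => //= /andP[j0 _].
have qj0 : (0 < q * j)%N by rewrite muln_gt0.
apply/smoothP/smoothP => // H p pq pk; first by apply: H => //; rewrite dvdn_mull.
move: pk; rewrite Euclid_dvdM // => /orP[|/(H p pq)//].
by rewrite dvdn_prime2 // => /eqP->.
Qed.

Lemma lnn_le_harm X : lnn X.+1 <= harm X.
Proof.
elim: X => [|X IH]; first by rewrite ln1 /harm big_geq.
rewrite /harm big_nat_recr //= -/(harm X).
exact: le_trans (ln_succ_le R (ltn0Sn X)) (lerD IH (lexx _)).
Qed.

Lemma harm_le X : (0 < X)%N -> harm X <= 1 + lnn X.
Proof.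
case: X => // X _; elim: X => [|X IH]; first by rewrite ln1 /harm big_nat1 invr1 addr0.
rewrite /harm big_nat_recr //= -/(harm X.+1).
apply: le_trans (lerD IH (lexx _)) _; rewrite -addrA lerD2l.
exact: ln_succ_ge.
Qed.

(** From the harmonic sum the multiples of each prime p > n are removed. This union bound is applied
    with N = n^2, where it counts nothing twice: no k <= n^2 has two prime factors above n. *)
Lemma smooth_sum_ge n N : (0 < n)%N ->
  lnn N - \sum_(p <- primes_in n N) p%:R^-1 * (1 + lnn N - lnn p) <=
  \sum_(1 <= k < N.+1 | smooth n k) (k%:R^-1 : R).
Proof.
move=> n0; rewrite lerBlDr.
have hN : lnn N <= harm N.
  by case: N => [|N]; [rewrite ln0 // /harm big_geq | apply: le_trans (lnn_le_harm _);
    apply: ler_lnn].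
apply: le_trans hN _; rewrite /harm (bigID (smooth n)) /= lerD2l.
apply: (@le_trans _ _ (\sum_(p <- primes_in n N) \sum_(1 <= k < N.+1 | (p %| k)%N && true)
  (k%:R^-1 : R))).
  rewrite [leRHS](_ : _ = \sum_(p <- primes_in n N) \sum_(1 <= k < N.+1)
      if (p %| k)%N then k%:R^-1 else 0); last first.
    by apply: eq_bigr => p _; rewrite big_mkcond /=; apply: eq_bigr => k _; rewrite andbT.
  rewrite exchange_big /= big_mkcond /= big_nat_cond [leRHS]big_nat_cond.
  apply: ler_sum => k /andP[/andP[k1 kN] _]; case: ifP => [|_]; last first.
    by apply: sumr_ge0 => p _; case: ifP => // _; rewrite invr_ge0.
  case/allPn => p; rewrite mem_primes => /and3P[pp _ pk]; rewrite -ltnNge => np.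
  have pin : p \in primes_in n N.
    by rewrite mem_primes_in pp np; apply: leq_trans (dvdn_leq k1 pk) _.
  rewrite (big_rem p) //= pk; apply: ler_wpDr => //.
  by apply: sumr_ge0 => q _; case: ifP => // _; rewrite invr_ge0.
rewrite big_seq [leRHS]big_seq; apply: ler_sum => p; rewrite mem_primes_in => /and3P[pp np pN].
have p0 := prime_gt0 pp.
rewrite sum_dvd //.
have -> : \sum_(1 <= j < (N %/ p).+1 | true) ((p * j)%:R^-1 : R) = p%:R^-1 * harm (N %/ p).
  by rewrite /harm mulr_sumr; apply: eq_bigr => j _; rewrite natrM invfM.
rewrite ler_wpM2l ?invr_ge0 //.
have Np0 : (0 < N %/ p)%N by rewrite divn_gt0.
apply: le_trans (harm_le Np0) _; rewrite -addrA lerD2l lerBrDr -lnnM //.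
apply: ler_lnn; first by rewrite muln_gt0 Np0.
exact: leq_trunc_div.
Qed.

Lemma sum_primes_in_cells (F : nat -> R) (y : nat -> nat) K :
  (forall j, (j < K)%N -> (y j <= y j.+1)%N) ->
  \sum_(p <- primes_in (y 0%N) (y K)) F p =
  \sum_(0 <= j < K) \sum_(p <- primes_in (y j) (y j.+1)) F p.
Proof.
elim: K => [|K IH] yK.
  by rewrite [RHS]big_geq // /primes_in /index_iota subnn big_nil.
have y0K j : (j <= K)%N -> (y 0%N <= y j)%N.
  by elim: j => // j IHj jK; apply: leq_trans (IHj (ltnW jK)) (yK _ _); apply: leqW.
rewrite big_nat_recr //= -IH => [|j jK]; last by apply: yK; apply: leqW.
by rewrite -big_cat -primes_in_cat // y0K //= yK.
Qed.

(** With N = n^2 the subtracted sum is asymptotically ln n times the integral of (2 - u) / u over 1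
    <= u <= 2, which is 2 ln 2 - 1. Mertens' theorem on K cells of ln p / ln n turns it into an
    upper Riemann sum, so the attainable coefficient tends to 3 - 2 ln 2 = 1.613... as K grows,
    against the true e^gamma = 1.781... *)
Lemma euler_prod_ge K n : (0 < K)%N -> 1 <= lnn n ->
  (2 - \sum_(0 <= j < K) (K%:R - j%:R) / (K%:R * (K%:R + j%:R))) * lnn n - 29 * K%:R <=
  \prod_(p <- primes_in 0 n) (1 - p%:R^-1)^-1.
Proof.
move=> K0 L1; have n0 : (0 < n)%N by case: n L1 => //; rewrite ln0 // ler10.
apply: le_trans _ (smooth_sum_le n (n ^ 2)); apply: le_trans _ (smooth_sum_ge _ n0).
have lN : lnn (n ^ 2) = 2 * lnn n by rewrite natrX lnXn ?ltr0n // mulr_natl.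
rewrite lN; set L := lnn n in L1 *.
have KR : 0 < K%:R :> R by rewrite ltr0n.
pose u j : R := L * (1 + j%:R / K%:R).
have u0 : u 0%N = L by rewrite /u mul0r addr0 mulr1.
have uK : u K = 2 * L by rewrite /u divff ?gt_eqF // mulrC.
have uS j : u j.+1 = u j + L / K%:R by rewrite /u -[j.+1%:R]natr1; field; rewrite gt_eqF.
have Lpos : 0 < L by rewrite (lt_le_trans _ L1).
have LK : 0 <= L / K%:R by rewrite divr_ge0 // ltW.
have uL j : L <= u j by apply: ler_peMr; [exact: ltW | rewrite lerDl divr_ge0].
have -> : primes_in n (n ^ 2) = primes_in (expn_floor (u 0%N)) (expn_floor (u K)).
  by rewrite u0 uK expn_floor_ln // -lN expn_floor_ln // expn_gt0 n0.
rewrite (@sum_primes_in_cells _ (fun j => expn_floor (u j))); last first.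
  by move=> j _; apply: expn_floor_mono; rewrite uS lerDl.
suff H j : (j < K)%N ->
  \sum_(p <- primes_in (expn_floor (u j)) (expn_floor (u j.+1)))
     p%:R^-1 * (1 + 2 * L - lnn p) <=
  (K%:R - j%:R) / (K%:R * (K%:R + j%:R)) * L + 29.
  have : \sum_(0 <= j < K) \sum_(p <- primes_in (expn_floor (u j)) (expn_floor (u j.+1)))
     p%:R^-1 * (1 + 2 * L - lnn p) <=
     \sum_(0 <= j < K) ((K%:R - j%:R) / (K%:R * (K%:R + j%:R)) * L + 29).
    by rewrite big_nat_cond [leRHS]big_nat_cond; apply: ler_sum => j /andP[/andP[_ /H]].
  rewrite big_split /= -mulr_suml big_const_nat subn0 iter_addr_0 -[29 *+ K]mulr_natr.
  move: (\sum_(0 <= j < K) _) (\sum_(0 <= j < K) _) => s t; lra.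
move=> jK; have uj0 : 0 < u j by apply: lt_le_trans (uL j).
pose c := (1 + 2 * L - u j) / u j.
have uj2 : u j <= 2 * L.
  rewrite /u [2 * L]mulrC; apply: ler_wpM2l; first exact: ltW.
  have : j%:R / K%:R <= 1 :> R by rewrite ler_pdivrMr // mul1r ler_nat ltnW.
  by move: (_ / _) => x; lra.
have c0 : 0 <= c by rewrite divr_ge0 ?ltW //; lra.
apply: (@le_trans _ _ (\sum_(p <- primes_in (expn_floor (u j)) (expn_floor (u j.+1)))
     lnn p / p%:R * c)).
  rewrite big_seq [leRHS]big_seq; apply: ler_sum => p; rewrite mem_primes_in => /and3P[pp up pu].
  have p0 := prime_gt0 pp.
  have up' : u j < lnn p by rewrite ltNge -leq_expn_floor // -ltnNge.
  rewrite [_ / _]mulrC -mulrA ler_wpM2l ?invr_ge0 //.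
  apply: (@le_trans _ _ (u j * c)); first by rewrite /c mulrCA divff ?gt_eqF // mulr1; lra.
  by rewrite ler_wpM2r // ltW.
rewrite -mulr_suml.
have uju : u j <= u j.+1 by rewrite uS lerDl.
have /andP[_ h] := mertens_floor (ltW uj0) uju.
apply: le_trans (ler_wpM2r c0 h) _; rewrite uS.
have -> : u j + L / K%:R - u j + 14 = L / K%:R + 14 by ring.
have jR : 0 <= j%:R :> R by [].
have jK' : j%:R <= K%:R :> R by rewrite ler_nat ltnW.
have KL : 0 < K%:R + j%:R :> R by lra.
pose w : R := (K%:R - j%:R) / (K%:R + j%:R).
have w1 : w <= 1 by rewrite ler_pdivrMr //; lra.
have w0 : 0 <= w by rewrite divr_ge0 //; lra.
have cE : c = w + (u j)^-1.
  rewrite /c /w /u; field; rewrite ?gt_eqF //; lra.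
have ui : (u j)^-1 <= L^-1 by rewrite lef_pV2 ?posrE.
have Li : L^-1 <= 1 by rewrite invf_le1.
have cL : c <= w + L^-1 by rewrite cE lerD2l.
apply: le_trans (ler_wpM2l _ cL) _; first by rewrite addr_ge0.
have -> : (L / K%:R + 14) * (w + L^-1) = L * (w / K%:R) + K%:R^-1 + 14 * w + 14 * L^-1.
  by field; rewrite ?gt_eqF //.
have -> : (K%:R - j%:R) / (K%:R * (K%:R + j%:R)) * L = L * (w / K%:R) :> R.
  by rewrite /w; field; rewrite ?gt_eqF.
have K1 : K%:R^-1 <= 1 :> R by rewrite invf_le1 // ler1n.
move: (L^-1) Li (K%:R^-1) K1 (L * _) => x hx y hy z; lra.
Qed.

Lemma riemann_le K D : (0 < K)%N -> (0 < D)%N ->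
  \sum_(0 <= j < K) (K%:R - j%:R) / (K%:R * (K%:R + j%:R)) <=
  (\sum_(0 <= j < K) ((K - j) * D %/ (K * (K + j))).+1)%:R / D%:R :> R.
Proof.
move=> K0 D0; rewrite natr_sum mulr_suml big_nat_cond [leRHS]big_nat_cond.
apply: ler_sum => j /andP[/andP[_ jK] _].
have Kj : (0 < K * (K + j))%N by rewrite muln_gt0 K0 addn_gt0 K0.
rewrite -natrB ?(ltnW jK) // -natrD -natrM ler_pdivlMr ?ltr0n // mulrAC.
by rewrite ler_pdivrMr ?ltr0n // -!natrM ler_nat ltnW // -ltn_divLR.
Qed.

Lemma euler_prod_lower : exists C : R, forall n, (0 < n)%N ->
  793 / 500 * lnn n - C <= \prod_(p <- primes_in 0 n) (1 - p%:R^-1)^-1.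
Proof.
exists (29 * 20 + 2) => n n0.
case: (lerP 1 (lnn n)) => [h|h]; last first.
  apply: (@le_trans _ _ 0); first by lra.
  rewrite big_seq; apply: prodr_ge0 => p; rewrite mem_primes_in => /and3P[pp _ _].
  by rewrite invr_ge0 subr_ge0 invf_le1 ?ltr0n ?ler1n ?prime_gt0.
(* Twenty cells suffice: 2 - 0.4135 = 1.5865 exceeds 793/500. *)
apply: le_trans _ (@euler_prod_ge 20 n isT h).
have : \sum_(0 <= j < 20) (20%:R - j%:R) / (20%:R * (20%:R + j%:R)) <= 4135 / 10 ^+ 4 :> R.
  apply: le_trans (@riemann_le 20 (10 ^ 4) isT isT) _.
  rewrite natrX ler_wpM2r ?invr_ge0 ?exprn_ge0 // ler_nat.
  by rewrite unlock; vm_compute.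
move: (\sum_(0 <= j < _) _) => s hs.
have : s * lnn n <= 4135 / 10 ^+ 4 * lnn n by rewrite ler_wpM2r ?lnn_ge0.
lra.
Qed.

End EulerProduct.

(** * Rational bounds for logarithms *)

Section LnBounds.
Variable R : realType.

Local Notation lnn n := (ln (n%:R : R)).

Lemma to_nat_pow a k : N.to_nat (N.pow (N.of_nat a) (N.of_nat k)) = (a ^ k)%N.
Proof.
elim: k => [//|k IH]; rewrite Nat2N.inj_succ N.pow_succ_r'.
by rewrite N2Nat.inj_mul IH Nat2N.id expnS.
Qed.

Lemma lnn_expn_le c a k d b m : (0 < a)%N -> (0 < b)%N -> (0 < c)%N -> (0 < d)%N ->
  N.leb (N.of_nat c * N.pow (N.of_nat a) (N.of_nat k))
        (N.of_nat d * N.pow (N.of_nat b) (N.of_nat m)) ->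
  lnn c + k%:R * lnn a <= lnn d + m%:R * lnn b.
Proof.
move=> a0 b0 c0 d0 /N.leb_le h.
have {h} : (c * a ^ k <= d * b ^ m)%N.
  by move: (to_nat_pow a k) (to_nat_pow b m); lia.
have X0 n k' : (0 < n)%N -> 0 < n%:R ^+ k' :> R by move=> n0; rewrite exprn_gt0 // ltr0n.
have ak : (0 < a ^ k)%N by rewrite expn_gt0 a0.
have bm : (0 < b ^ m)%N by rewrite expn_gt0 b0.
move=> h; have cak : (0 < c * a ^ k)%N by rewrite muln_gt0 c0.
have := ler_lnn R cak h; rewrite !lnnM // !natrX !lnXn ?ltr0n //.
by rewrite !mulr_natl.
Qed.

(** From (1 + 1/n)^K <= 2 and ln (1 + 1/n) >= 1 / (n + 1) follows ln 2 >= K / (n + 1); [c] is the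
    common factor cancelled from this fraction. *)
Lemma ln2_ge_frac n K c a b : (0 < n)%N -> (0 < c)%N -> K = (c * a)%N -> n.+1 = (c * b)%N ->
  N.leb (N.of_nat 1 * N.pow (N.of_nat n.+1) (N.of_nat K))
        (N.of_nat 2 * N.pow (N.of_nat n) (N.of_nat K)) ->
  a%:R <= lnn 2 * b%:R.
Proof.
move=> n0 c0 Ka nb h; have nS : 0 < n.+1%:R :> R by rewrite ltr0n.
have := @lnn_expn_le 1 n.+1 K 2 n K isT n0 isT isT h; rewrite ln1 add0r => H.
have K0 : K%:R * (lnn n + n.+1%:R^-1) <= K%:R * lnn n.+1.
  by rewrite ler_wpM2l // ln_succ_ge.
have : K%:R / n.+1%:R <= lnn 2.
  rewrite -(lerD2l (K%:R * lnn n)) -mulrDr; apply: le_trans K0 _.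
  by rewrite addrC.
by rewrite ler_pdivrMr // Ka nb !natrM mulrCA ler_pM2l // ltr0n.
Qed.

Lemma ln2_le_frac n K c a b : (0 < n)%N -> (0 < c)%N -> K = (c * a)%N -> n = (c * b)%N ->
  N.leb (N.of_nat 2 * N.pow (N.of_nat n) (N.of_nat K))
        (N.of_nat 1 * N.pow (N.of_nat n.+1) (N.of_nat K)) ->
  lnn 2 * b%:R <= a%:R.
Proof.
move=> n0 c0 Ka nb h; have nS : 0 < n%:R :> R by rewrite ltr0n.
have := @lnn_expn_le 2 n K 1 n.+1 K n0 isT isT isT h; rewrite ln1 add0r => H.
have K0 : K%:R * lnn n.+1 <= K%:R * (lnn n + n%:R^-1).
  by rewrite ler_wpM2l // ln_succ_le.
have : lnn 2 <= K%:R / n%:R.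
  rewrite -(lerD2r (K%:R * lnn n)); apply: le_trans H _.
  by apply: le_trans K0 _; rewrite mulrDr addrC.
by rewrite ler_pdivlMr // Ka {1}nb !natrM mulrCA ler_pM2l // ltr0n.
Qed.

Lemma ln2_ge : 9 / 13 <= lnn 2.
Proof.
have : 9%:R <= lnn 2 * 13%:R.
  by apply: (@ln2_ge_frac 1000 693 77); vm_compute.
lra.
Qed.

Lemma ln2_le : lnn 2 <= 43 / 62.
Proof.
have : lnn 2 * 62%:R <= 43%:R.
  by apply: (@ln2_le_frac 868 602 14); vm_compute.
lra.
Qed.

(** The exponents come from the convergents 84/53 of log_2 3 and 65/28 of log_2 5, and 276/10 is 30
    times 92/100. *)
Lemma chebyshev_const : 276 / 10 <= 14 * lnn 2 + 9 * lnn 3 + 5 * lnn 5.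
Proof.
have := ln2_ge.
have c3 : N.leb (N.of_nat 1 * N.pow (N.of_nat 2) (N.of_nat 84))
   (N.of_nat 1 * N.pow (N.of_nat 3) (N.of_nat 53)) by vm_compute.
have c5 : N.leb (N.of_nat 1 * N.pow (N.of_nat 2) (N.of_nat 65))
   (N.of_nat 1 * N.pow (N.of_nat 5) (N.of_nat 28)) by vm_compute.
have := @lnn_expn_le 1 2 84 1 3 53 isT isT isT isT c3.
have := @lnn_expn_le 1 2 65 1 5 28 isT isT isT isT c5.
rewrite ln1 !add0r; lra.
Qed.

Lemma chebyshev_lower y :
  92 / 100 * y%:R - 3 * lnn y - 31 <= (size (primes_in 0 y))%:R * lnn y.
Proof.
case: (ltnP y 30) => [y30|y30].
  have : 0 <= (size (primes_in 0 y))%:R * lnn y by rewrite mulr_ge0 ?lnn_ge0.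
  move=> h; apply: le_trans h; have := lnn_ge0 R y.
  have : y%:R <= 30%:R :> R by rewrite ler_nat ltnW.
  lra.
pose q := (y %/ 30)%N.
have q0 : (0 < q)%N by rewrite divn_gt0.
have qy : (30 * q <= y)%N by rewrite mulnC leq_trunc_div.
have q30 : (0 < 30 * q)%N by rewrite muln_gt0.
have sy : (size (primes_in 0 (30 * q)) <= size (primes_in 0 y))%N.
  by rewrite (@primes_in_cat 0 (30 * q) y) ?qy // size_cat leq_addr.
have H : (size (primes_in 0 (30 * q)))%:R * lnn (30 * q) <=
   (size (primes_in 0 y))%:R * lnn y.
  by rewrite ler_pM ?lnn_ge0 ?ler_nat // ler_lnn.
have := chebyshev R q0; have := ler_lnn R q30 qy.
have : y%:R <= 30 * q%:R + 30 :> R.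
  by rewrite -natrM -natrD ler_nat mulnC ltnW // -mulSnr -ltn_divLR.
have := chebyshev_const; move: (14 * _ + _ + _) => c hc hy hl hch.
have : q%:R * (276 / 10) <= q%:R * c by rewrite ler_wpM2l.
by move=> hq; apply: le_trans H; apply: le_trans hch; lra.
Qed.

End LnBounds.

(** * Lower bounds for the number of blocks *)

Section Slices.
Variable R : realType.
Implicit Types (sl : seq (nat * nat)) (f : nat -> R).

(** The values of the slices grow with t, so a maximum over the slices that apply is a sum of jumps.
    Unlike the maximum, this sum can be interchanged with the sum over primes. *)
Fixpoint increments (c : R) sl f : R :=
  if sl is s :: r then (s.2%:R - c) * f s.1 + increments s.2%:R r f else 0.

Definition next_value sl f : R := if sl is s :: _ then f s.1 else 0.

(** [increments] after summation by parts. The coefficient of a slice now depends on the full list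
    only and not on which slices are kept, so sums with different predicates can be compared slice
    by slice. *)
Fixpoint wsum (P : pred nat) sl f (w : nat -> R) : R :=
  if sl is s :: r then
    (P s.1)%:R * (s.2%:R * (f s.1 - next_value r f)) * w s.1 + wsum P r f w
  else 0.

Lemma increments_wsum c sl f :
  increments c sl f = wsum xpredT sl f (fun=> 1) - c * next_value sl f.
Proof.
elim: sl c => [|s r IH] c /=; first by rewrite mulr0 subr0.
by rewrite IH mul1r mulr1; ring.
Qed.

Definition slice_lt (s s' : nat * nat) := (s.1 < s'.1)%N && (s.2 <= s'.2)%N.

Lemma slice_lt_trans : transitive slice_lt.
Proof.
move=> b a c /andP[ab1 ab2] /andP[bc1 bc2]; apply/andP; split.
  exact: ltn_trans bc1.
exact: leq_trans bc2.
Qed.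

Lemma eq_wsum (P Q : pred nat) sl f w :
  (forall s, s \in sl -> P s.1 = Q s.1) -> wsum P sl f w = wsum Q sl f w.
Proof.
elim: sl => //= s r IH PQ; rewrite PQ ?mem_head // IH // => s' s'r.
by rewrite PQ // inE s'r orbT.
Qed.

Lemma wsum_filter (P : pred nat) sl f :
  (forall t u, (t <= u)%N -> P t -> P u) -> sorted slice_lt sl ->
  wsum P sl f (fun=> 1) = increments 0 [seq s <- sl | P s.1] f.
Proof.
move=> Pup; elim: sl => [//|s r IH] sr.
have rS := path_sorted sr.
rewrite /=; case: ifP => Ps; last by rewrite !mul0r add0r IH.
have PA : all (fun s' => P s'.1) r.
  apply/allP => s' s'r; apply: Pup Ps.
  by have /allP/(_ _ s'r)/andP[/ltnW] := order_path_min slice_lt_trans sr.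
rewrite (all_filterP PA) increments_wsum /= mul0r subr0; congr (_ + _).
by apply: eq_wsum => s' /(allP PA).
Qed.

Lemma ler_increments (c : R) sl f g : (forall s, s \in sl -> c <= s.2%:R) ->
  sorted slice_lt sl -> (forall s, s \in sl -> f s.1 <= g s.1) ->
  increments c sl f <= increments c sl g.
Proof.
elim: sl c => [//|s r IH] c cs sr fg /=; apply: lerD.
  by rewrite ler_wpM2l ?fg ?mem_head // subr_ge0 cs // mem_head.
apply: IH => [s' s'r||s' s'r]; last by rewrite fg // inE s'r orbT.
  have /allP/(_ _ s'r)/andP[_] := order_path_min slice_lt_trans sr.
  by rewrite ler_nat.
exact: path_sorted sr.
Qed.

Lemma increments_affine c sl f (a b : R) :
  increments c sl (fun t => a * f t - b) =
  a * increments c sl f - b * (last c [seq s.2%:R | s <- sl] - c).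
Proof.
elim: sl c => [|s r IH] c /=; first by ring.
by rewrite IH; ring.
Qed.

(** Since P is closed downwards, the jumps that are counted telescope to the value of the largest
    slice with P. *)
Lemma increments_le_max c sl (P : pred nat) :
  (forall s, s \in sl -> (c <= s.2)%N) -> sorted slice_lt sl ->
  (forall t u, (t <= u)%N -> P u -> P t) ->
  c%:R + increments c%:R sl (fun t => (P t)%:R) <=
  (maxn c (\max_(s <- sl | P s.1) s.2))%:R :> R.
Proof.
move=> cs sr Pdn; elim: sl c cs sr => [|s r IH] c cs sr /=.
  by rewrite addr0 ler_nat leq_max leqnn.
have rS := path_sorted sr.
have rs s' : s' \in r -> slice_lt s s'.
  by move=> s'r; have /allP/(_ _ s'r) := order_path_min slice_lt_trans sr.
rewrite big_cons; case: ifP => Ps.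
  have -> : c%:R + ((s.2%:R - c%:R) * true%:R + increments s.2%:R r (fun t => (P t)%:R))
    = s.2%:R + increments s.2%:R r (fun t => (P t)%:R) :> R by rewrite mulr1; ring.
  apply: le_trans (IH _ _ rS) _; first by move=> s' /rs/andP[].
  by rewrite ler_nat; apply: leq_maxr.
have -> : increments s.2%:R r (fun t => (P t)%:R) = 0 :> R.
  have : all (fun s' => ~~ P s'.1) r.
    by apply/allP => s' /rs/andP[/ltnW ss' _]; apply: contraFN Ps; apply: Pdn.
  elim: (r) (s.2%:R : R) => //= s' r' IHr c' /andP[/negbTE-> /IHr->].
  by rewrite mulr0 addr0.
by rewrite mulr0 !addr0 ler_nat leq_maxl.
Qed.

Lemma sum_value_ge sl x (l M : seq nat) (A : nat -> R) :
  sorted slice_lt sl ->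
  (forall q s, q \in l -> s \in sl -> dense s.1 M ->
     2 * s.1 * (q * prodn M) <= x -> dense s.1 (q :: M))%N ->
  (forall s, s \in sl -> A s.1 <= (count (fun q => 2 * s.1 * (q * prodn M) <= x)%N l)%:R) ->
  increments 0 [seq s <- sl | dense s.1 M] A <=
  (\sum_(q <- l) value sl x (q :: M))%:R.
Proof.
move=> sS dl hA; set D := [seq s <- sl | _].
have DS : sorted slice_lt D by apply: sorted_filter => //; apply: slice_lt_trans.
have DA s : s \in D -> A s.1 <= (count (fun q => 2 * s.1 * (q * prodn M) <= x)%N l)%:R.
  by rewrite mem_filter => /andP[_]; apply: hA.
pose g t : R := (count (fun q => 2 * t * (q * prodn M) <= x)%N l)%:R.
apply: le_trans (@ler_increments 0 D A g _ DS DA) _ => //.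
have E c D' : increments c D' g =
  \sum_(q <- l) increments c D' (fun t => (2 * t * (q * prodn M) <= x)%N%:R).
  elim: D' c => [|s r IH] c /=; first by rewrite big1.
  rewrite big_split /= -IH -mulr_sumr -natr_sum /g -sum1_count big_mkcond.
  by congr (_ * _%:R + _); apply: eq_bigr => q _; case: ifP.
rewrite E; rewrite natr_sum big_seq [leRHS]big_seq; apply: ler_sum => q ql.
have := @increments_le_max 0 D (fun t => 2 * t * (q * prodn M) <= x)%N (fun _ _ => isT) DS.
rewrite add0r => /(_ _)/le_trans; apply.
  by move=> t u tu; apply: leq_trans; rewrite leq_mul2r leq_mul2l /= tu !orbT.
rewrite max0n ler_nat /value /D big_filter_cond.
apply/bigmax_leqP_seq => s ssl /andP[Ms h].
apply: (leq_bigmax_seq (F := snd)) => //.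
rewrite big_cons h andbT; exact: dl.
Qed.

End Slices.

Section Grid.
Variable R : realType.
Local Notation lnn n := (ln (n%:R : R)).
Local Notation Y := (@expn_floor R).

Lemma count_primes_ge (a x y : nat) (P : pred nat) : (y <= x)%N ->
  (forall q, 0 < q <= y -> P q)%N ->
  (size (primes_in 0 y) <= count P (primes_in a x) + a)%N.
Proof.
move=> yx Py; case: (leqP a y) => ay; last first.
  by apply: leq_trans (size_primes_in 0 y) _; rewrite subn0; lia.
rewrite (@primes_in_cat 0 a y) // (@primes_in_cat a y x) ?ay // size_cat count_cat.
have -> : count P (primes_in a y) = size (primes_in a y).
  apply/eqP; rewrite -all_count; apply/allP => q; rewrite mem_primes_in => /and3P[_ aq qy].
  by apply: Py; rewrite qy andbT; lia.
by have := size_primes_in 0 a; lia.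
Qed.

Variables (sl : seq (nat * nat)) (tmax : nat).
Hypothesis sl_sorted : sorted slice_lt sl.
Hypothesis slP : forall s, s \in sl -> (0 < s.1 <= tmax)%N /\ (0 < s.2)%N.

Definition inv2 (t : nat) : R := (2 * t)%:R^-1.

(** The slice t admits last primes up to x / (2 t n), so this is the factor by which a product n
    with prime list M enters the count, apart from 1 / n. *)
Definition slice_weight (M : seq nat) : R :=
  increments 0 [seq s <- sl | dense s.1 M] inv2.

Definition slice_max : nat := \max_(s <- sl) s.2.

Lemma slice_weight_lt M : has (fun s => dense s.1 M) sl ->
  (2 * tmax)%:R^-1 <= slice_weight M.
Proof.
rewrite /slice_weight has_filter; case E: (filter _ _) => [//|s r] _ /=.
have : s \in [seq s <- sl | dense s.1 M] by rewrite E mem_head.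
rewrite mem_filter => /andP[_ /slP[/andP[t0 tm] l0]].
have sr : sorted slice_lt (s :: r) by rewrite -E; apply: sorted_filter => //; apply: slice_lt_trans.
apply: ler_wpDr.
  have := @ler_increments R s.2%:R r (fun=> 0) inv2 _ (path_sorted sr) _.
  have -> : increments s.2%:R r (fun=> 0) = 0 :> R.
    by elim: (r) (s.2%:R : R) => //= s' r' IH c; rewrite IH mulr0 addr0.
  apply=> s' s'r; last by rewrite invr_ge0.
  by have /allP/(_ _ s'r)/andP[_] := order_path_min slice_lt_trans sr; rewrite ler_nat.
rewrite subr0 /inv2; apply: (@le_trans _ _ (2 * s.1)%:R^-1).
  by rewrite lef_pV2 ?posrE ?ltr0n ?ler_nat ?muln_gt0 //; lia.
by rewrite ler_peMl ?invr_ge0 // ler1n.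
Qed.

Lemma slice_weight_empty M : ~~ has (fun s => dense s.1 M) sl -> slice_weight M = 0.
Proof. by rewrite /slice_weight has_filter negbK => /eqP->. Qed.

Lemma slice_weight_ge0 M : 0 <= slice_weight M.
Proof.
case: (boolP (has (fun s => dense s.1 M) sl)) => h; last by rewrite slice_weight_empty.
by apply: le_trans (slice_weight_lt h); rewrite invr_ge0.
Qed.

Lemma last_slice_le M : last 0 [seq s.2%:R | s <- [seq s <- sl | dense s.1 M]] <= slice_max%:R :> R.
Proof.
set D := filter _ _; have : last 0 [seq s.2%:R | s <- D] \in 0 :: [seq s.2%:R : R | s <- D].
  exact: mem_last.
rewrite inE => /orP[/eqP->//|/mapP[s]]; rewrite mem_filter => /andP[_ ssl] ->.
by rewrite ler_nat /slice_max; apply: (leq_bigmax_seq (F := snd)).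
Qed.

(** Because x <= n^2, the size condition 2 t q n <= x forces q <= n, and q is adjoined densely for
    free. What is subtracted accounts for the primes up to e^u, which are excluded, and for
    Chebyshev's error. *)
Lemma last_prime_sum x (M : seq nat) (u W : R) :
  (0 < prodn M)%N -> 0 <= u -> 1 <= W -> lnn x - lnn (prodn M) <= W ->
  (x <= prodn M * prodn M)%N -> (0 < x)%N ->
  92 / 100 * (x%:R / (prodn M)%:R) / W * slice_weight M - (expR u + 35) * slice_max%:R <=
  (\sum_(q <- primes_in (Y u) x) value sl x (q :: M))%:R.
Proof.
move=> n0 u0 W1 lW xn x0; set n := prodn M in n0 lW xn *.
have W0 : 0 < W by apply: lt_le_trans W1.
have nR : 0 < n%:R :> R by rewrite ltr0n.
set a := 92 / 100 * (x%:R / n%:R) / W.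
have a0 : 0 <= a.
  by rewrite /a divr_ge0 ?(ltW W0) // mulr_ge0 ?divr_ge0 ?ler0n.
apply: (@le_trans _ _ (increments 0 [seq s <- sl | dense s.1 M] (fun t => a * inv2 t - (expR u +
  35)))).
  rewrite increments_affine subr0 lerD2l lerN2 ler_wpM2l ?last_slice_le //.
  by rewrite addr_ge0 ?expR_ge0.
apply: sum_value_ge => // [q s ql ssl|s ssl].
  move=> Ms; rewrite -/n => h /=; rewrite Ms /= -/n.
  have [/andP[t0 _] _] := slP ssl.
  have : (q * n <= n * n)%N.
    apply: leq_trans xn; apply: leq_trans h; rewrite -[leqLHS]mul1n leq_mul2r.
    by rewrite muln_gt0 t0 orbT.
  rewrite leq_mul2r => /orP[/eqP n1|qn]; first by rewrite n1 in n0.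
  by apply: leq_trans qn _; rewrite leq_pmull.
have [/andP[t0 _] _] := slP ssl.
have d0 : (0 < 2 * s.1 * n)%N by rewrite !muln_gt0 t0.
pose y := (x %/ (2 * s.1 * n))%N.
have yx : (y <= x)%N by apply: leq_div.
have := @count_primes_ge (Y u) x y (fun q => 2 * s.1 * (q * n) <= x)%N yx.
have H q : (0 < q <= y)%N -> (2 * s.1 * (q * n) <= x)%N.
  by move=> /andP[_]; rewrite leq_divRL // mulnCA mulnA.
move=> /(_ H); rewrite -(ler_nat R) natrD.
have Yu : (Y u)%:R <= expR u by rewrite /expn_floor truncn_le expR_ge0.
move=> hc; rewrite lerBlDr.
(* With W >= 1, the error 3 ln y + 31 of Chebyshev's bound and the 92/100 lost in rounding down to y
   are together at most 35 W. *)
apply: (@le_trans _ _ ((size (primes_in 0 y))%:R + 35)); last by lra.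
have xy : x%:R / (2 * s.1 * n)%:R <= y%:R + 1 :> R.
  by rewrite ler_pdivrMr ?ltr0n // natr1 -natrM ler_nat ltnW // -ltn_divLR.
have aE : a * inv2 s.1 = 92 / 100 * (x%:R / (2 * s.1 * n)%:R) / W.
  have sR : 0 < (2 * s.1)%:R :> R by rewrite ltr0n muln_gt0 t0.
  rewrite /a /inv2 (natrM _ (2 * s.1)) [(_ * n%:R)^-1]invfM -!mulrA; congr (_ * (_ * (_ * _))).
  by rewrite [RHS]mulrCA [W^-1 * _]mulrC.
rewrite aE ler_pdivrMr // [leRHS]mulrDl.
apply: (@le_trans _ _ (92 / 100 * (y%:R + 1))).
  have c0 : 0 <= 92 / 100 :> R by rewrite divr_ge0 ?ler0n.
  exact: ler_wpM2l xy.
have ly : lnn y <= W.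
  case: (posnP y) => [->|y0]; first by rewrite ln0 // ltW.
  apply: le_trans lW; rewrite lerBrDr -lnnM //; apply: ler_lnn; first by rewrite muln_gt0 y0.
  apply: leq_trans (leq_trunc_div x (2 * s.1 * n)); rewrite -/y leq_mul2l.
  by rewrite leq_pmull ?orbT // muln_gt0 t0.
have := chebyshev_lower R y.
have : (size (primes_in 0 y))%:R * lnn y <= (size (primes_in 0 y))%:R * W by rewrite ler_wpM2l.
move: ((size _)%:R * W) ((size _)%:R * lnn y) => A B hA hB; lra.
Qed.

End Grid.

(** * Adjoining one further prime, or at least two *)

Fixpoint possum2 (f : seq nat -> nat) (l M : seq nat) : nat :=
  if l is s :: l' then (possum2 f l' M + possum f l' (s :: M))%N else 0.

Lemma possumE f l M : possum f l M = (\sum_(q <- l) f (q :: M) + possum2 f l M)%N.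
Proof. by elim: l => [|s l IH] /=; rewrite ?big_nil // big_cons IH; lia. Qed.

Lemma possum_cat f a b M : (possum f b M <= possum f (a ++ b) M)%N.
Proof. by elim: a => //= s a IH; apply: leq_trans IH (leq_addr _ _). Qed.

Lemma possum2_cat f a b M :
  (possum2 f b M + \sum_(s <- a) possum f b (s :: M) <= possum2 f (a ++ b) M)%N.
Proof.
elim: a => [|s a IH] /=; first by rewrite big_nil addn0.
by rewrite big_cons; have := possum_cat f a b (s :: M); lia.
Qed.

Section Grid.
Variable R : realType.
Local Notation lnn n := (ln (n%:R : R)).
Local Notation Y := (@expn_floor R).
Variables (sl : seq (nat * nat)) (tmax : nat).
Hypothesis sl_sorted : sorted slice_lt sl.
Hypothesis slP : forall s, s \in sl -> (0 < s.1 <= tmax)%N /\ (0 < s.2)%N.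

Variables (x N : nat).
Hypothesis N0 : (0 < N)%N.
Definition mesh : R := lnn x / N%:R.
Local Notation H := mesh.
(* 92 / 100 is Chebyshev's constant; what is taken off absorbs the error terms. *)
Definition scale : R := (92 / 100 - (10 ^+ 4)^-1) * (x%:R / lnn x).
Local Notation U := scale.
Hypothesis H1 : 1 <= H.
Hypothesis H_big : 14 * 10 ^+ 6 <= H.
Hypothesis H_exp : 36 * (slice_max sl)%:R * (10 ^+ 4 * (2 * tmax)%:R * lnn x) <= expR H.

Local Notation f := (value sl x).
Local Notation wt := (slice_weight R sl).
Local Notation l i := (primes_in (Y (i%:R * H)) x).

Let NR : 0 < N%:R :> R. Proof. by rewrite ltr0n. Qed.
Let H0 : 0 < H. Proof. exact: lt_le_trans H1. Qed.
Lemma meshE : lnn x = N%:R * H. Proof. by rewrite /mesh mulrC divfK ?gt_eqF. Qed.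
Let L0 : 0 < lnn x. Proof. by rewrite meshE mulr_gt0. Qed.
Let x0 : (0 < x)%N. Proof. by case: x L0 => //; rewrite ln0 // ltxx. Qed.
Lemma scale_ge0 : 0 <= U.
Proof.
rewrite /scale mulr_ge0 ?divr_ge0 ?(ltW L0) //.
have : (10 ^+ 4 : R)^-1 <= 1 / 100.
  rewrite div1r lef_pV2 ?posrE ?exprn_gt0 ?ltr0n //.
  by rewrite -natrX ler_nat.
lra.
Qed.

Let U0 := scale_ge0.

Let wt0 M : 0 <= wt M. Proof. exact: (slice_weight_ge0 R sl_sorted slP). Qed.

Definition in_cell j n := (j%:R * H <= lnn n) && (lnn n < j.+1%:R * H).

Lemma direct_gain M i j : all prime M -> in_cell j (prodn M) -> (N <= 2 * j)%N ->
  (i + j + 2 <= N)%N ->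
  N%:R / (N - j)%:R * (U * (wt M / (prodn M)%:R)) <= (\sum_(q <- l i) f (q :: M))%:R.
Proof.
move=> pM /andP[jn nj] Nj ijN; set n := prodn M in jn nj *.
have n0 : (0 < n)%N := primes_prod_gt0 pM.
have nR : 0 < n%:R :> R by rewrite ltr0n.
case: (boolP (has (fun s => dense s.1 M) sl)) => hM; last first.
  by rewrite slice_weight_empty // mul0r !mulr0.
have wM := slice_weight_lt R sl_sorted slP hM.
have jN : (j < N)%N by move: ijN; clear; lia.
have NjR : 0 < (N - j)%:R :> R by rewrite ltr0n subn_gt0.
have NjE : (N - j)%:R = N%:R - j%:R :> R by rewrite natrB // ltnW.
have Nj1 : 1 <= (N - j)%:R :> R by rewrite ler1n subn_gt0.
have W1 : 1 <= (N - j)%:R * H by rewrite (le_trans H1) // ler_peMl // ltW.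
have lW : lnn x - lnn n <= (N - j)%:R * H by rewrite NjE meshE mulrBl lerD2l lerN2.
have xn : (x <= n * n)%N.
  rewrite -(ler_nat R) -ler_ln ?posrE ?ltr0n ?muln_gt0 ?n0 // lnnM // meshE.
  apply: (@le_trans _ _ ((2 * j)%:R * H)); first by rewrite ler_wpM2r ?ler_nat // ltW.
  by rewrite mul2n -addnn natrD mulrDl lerD.
have iH0 : 0 <= i%:R * H by rewrite mulr_ge0 // ltW.
have := last_prime_sum sl_sorted slP n0 iH0 W1 lW xn x0; rewrite -/n; apply: le_trans.
rewrite /scale meshE.
have xE : x%:R = expR (N%:R * H) :> R by rewrite -meshE lnK // posrE ltr0n.
have nE : n%:R <= expR (j.+1%:R * H) by rewrite -[n%:R]lnK ?posrE // ler_expR ltW.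
set E := (expR (i%:R * H) + 35) * _.
set X : R := x%:R / n%:R * wt M / ((N - j)%:R * H).
have -> : 92 / 100 * (x%:R / n%:R) / ((N - j)%:R * H) * wt M = 92 / 100 * X.
  by rewrite /X; ring.
have -> : N%:R / (N - j)%:R * ((92 / 100 - (10 ^+ 4)^-1) * (x%:R / (N%:R * H)) * (wt M / n%:R)) =
   (92 / 100 - (10 ^+ 4)^-1) * X.
  rewrite /X; move: (92 / 100 - _) => c; field.
  by rewrite !gt_eqF.
suff : E <= (10 ^+ 4)^-1 * X by rewrite [(92 / 100 - _) * _]mulrBl; lra.
rewrite ler_pdivlMl ?exprn_gt0 ?ltr0n // /X ler_pdivlMr ?mulr_gt0 ?invr_gt0 //.
have Xn : expR (i%:R * H) * expR H <= x%:R / n%:R.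
  rewrite ler_pdivlMr // xE; apply: le_trans (ler_wpM2l _ nE) _;
    first by rewrite mulr_ge0 ?expR_ge0.
  rewrite -!expRD ler_expR.
  have -> : i%:R * H + H + j.+1%:R * H = (i + j + 2)%:R * H.
    by rewrite !natrD -[j.+1%:R]natr1; ring.
  by rewrite ler_wpM2r ?ler_nat // ltW.
have t0 : 0 < (2 * tmax)%:R :> R.
  by case/hasP: hM => s /slP[/andP[t0 tm] _] _; rewrite ltr0n muln_gt0 (leq_trans t0 tm).
have E36 : E <= 36 * expR (i%:R * H) * (slice_max sl)%:R.
  rewrite ler_wpM2r //; have : 1 <= expR (i%:R * H) by rewrite -[leLHS]expR0 ler_expR.
  by lra.
apply: (@le_trans _ _ (expR (i%:R * H) * expR H * (2 * tmax)%:R^-1)); last first.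
  by rewrite ler_pM // ?mulr_ge0 ?expR_ge0 ?invr_ge0.
rewrite ler_pdivlMr //.
apply: (@le_trans _ _ (expR (i%:R * H) * (36 * (slice_max sl)%:R * (10 ^+ 4 * (2 * tmax)%:R * lnn
  x)))); last first.
  by rewrite ler_wpM2l ?expR_ge0.
have -> : expR (i%:R * H) * (36 * (slice_max sl)%:R * (10 ^+ 4 * (2 * tmax)%:R * lnn x)) =
   10 ^+ 4 * (36 * expR (i%:R * H) * (slice_max sl)%:R) * lnn x * (2 * tmax)%:R by ring.
rewrite ler_wpM2r ?(ltW t0) // meshE; apply: ler_pM.
- by rewrite mulr_ge0 ?exprn_ge0 // mulr_ge0 // addr_ge0 ?expR_ge0.
- by rewrite mulr_ge0 // ltW.
- by rewrite ler_wpM2l ?exprn_ge0.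
- by rewrite ler_wpM2r ?ler_nat ?leq_subr // ltW.
Qed.

(** Mertens gives at least H - 14 for the sum of ln p / p over the cell, and ln p <= (i + 1) H
    there; 14 is at most 10^-6 H. *)
Lemma cell_inverse_sum i :
  (1 - (10 ^+ 6)^-1) / i.+1%:R <=
  \sum_(s <- primes_in (Y (i%:R * H)) (Y (i.+1%:R * H))) s%:R^-1 :> R.
Proof.
have iH0 k : 0 <= k%:R * H by rewrite mulr_ge0 // ltW.
have iR : 0 < i.+1%:R :> R by rewrite ltr0n.
have ii : i%:R * H <= i.+1%:R * H by rewrite ler_wpM2r ?ler_nat // ltW.
have /andP[h _] := mertens_floor (iH0 i) ii.
rewrite ler_pdivrMr // -(ler_pM2r H0).
apply: (@le_trans _ _ (H - 14)).
  rewrite mulrBl mul1r lerB // mulrC ler_pdivlMr ?exprn_gt0 ?ltr0n //.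
apply: le_trans (_ : _ <= i.+1%:R * H - i%:R * H - 14) _.
  by rewrite -[i.+1%:R]natr1; lra.
apply: le_trans h _; rewrite -mulrA mulr_suml big_seq [leRHS]big_seq.
apply: ler_sum => s; rewrite mem_primes_in => /and3P[ps s1 s2].
have s0 := prime_gt0 ps.
by rewrite mulrC ler_wpM2l ?invr_ge0 // -leq_expn_floor.
Qed.

Definition row_ok i (h : nat -> R) := forall M j, all prime M ->
  in_cell j (prodn M) -> h j * (U * (wt M / (prodn M)%:R)) <= (possum2 f (l i) M)%:R.

(** A prime not exceeding the product satisfies the density condition for every t >= 1, so the same
    slices remain. *)
Lemma wt_cons s M : (0 < s <= prodn M)%N -> all prime M -> wt (s :: M) = wt M.
Proof.
move=> /andP[s0 sM] pM; rewrite /slice_weight; congr increments.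
apply: eq_in_filter => t /slP[/andP[t0 _] _] /=.
by case: (dense _ _) => //=; apply: leq_trans sM _; rewrite leq_pmull.
Qed.

Lemma total_gain i (h E : nat -> R) M j : row_ok i h -> all prime M -> in_cell j (prodn M) ->
  (E j <= if (N <= 2 * j)%N && (i + j + 2 <= N)%N then N%:R / (N - j)%:R else 0) ->
  (E j + h j) * (U * (wt M / (prodn M)%:R)) <= (possum f (l i) M)%:R.
Proof.
move=> hok pM jM hE; rewrite possumE natrD mulrDl lerD //; last exact: hok.
have w0 : 0 <= U * (wt M / (prodn M)%:R) by rewrite mulr_ge0 // divr_ge0 // wt0.
apply: le_trans (ler_wpM2r w0 hE) _.
case: ifP => [/andP[a b]|_]; last by rewrite mul0r.
exact: direct_gain.
Qed.

(** The smallest of the further primes lies either above cell i, which the row of i + 1 counts, or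
    at a prime s of the cell. In the latter case the total of row i + 1 at the column of s n
    applies, with the weight divided by s. *)
Lemma row_step i (h h' E : nat -> R) : (i < N)%N -> row_ok i.+1 h ->
  (forall j, 0 <= E j + h j) ->
  (forall j, E j <= if (N <= 2 * j)%N && (i.+1 + j + 2 <= N)%N then N%:R / (N - j)%:R else 0) ->
  (forall j, h' j <= h j + if (i < j)%N then
      Num.min (E (j + i)%N + h (j + i)%N) (E (j + i).+1 + h (j + i).+1)
       * ((1 - (10 ^+ 6)^-1) / i.+1%:R) else 0) ->
  row_ok i h'.
Proof.
move=> iN hok g0 hE hh M j pM jM; set n := prodn M.
have n0 : (0 < n)%N := primes_prod_gt0 pM.
have nR : 0 < n%:R :> R by rewrite ltr0n.
have w0 : 0 <= U * (wt M / n%:R) by rewrite mulr_ge0 // divr_ge0 // wt0.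
apply: le_trans (ler_wpM2r w0 (hh j)) _.
have iH0 k : 0 <= k%:R * H by rewrite mulr_ge0 // ltW.
have ii : i%:R * H <= i.+1%:R * H by rewrite ler_wpM2r ?ler_nat // ltW.
have yx : (Y (i.+1%:R * H) <= x)%N.
  rewrite -[X in (_ <= X)%N](@expn_floor_ln R) //; apply: expn_floor_mono.
  by rewrite meshE ler_wpM2r ?ler_nat // ltW.
rewrite (@primes_in_cat _ (Y (i.+1%:R * H))); last by rewrite yx expn_floor_mono.
apply: le_trans (_ : _ <= (possum2 f (l i.+1) M + \sum_(s <- primes_in (Y (i%:R * H)) (Y (i.+1%:R
  * H))) possum f (l i.+1) (s :: M))%:R) _; last first.
  by rewrite ler_nat possum2_cat.
rewrite natrD mulrDl lerD //; first exact: hok.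
case: ifP => [ij|_]; last by rewrite mul0r.
set mn := Num.min _ _.
rewrite mulrAC natr_sum.
apply: le_trans (ler_wpM2l _ (cell_inverse_sum i)) _.
  by rewrite mulr_ge0 // le_min !g0.
rewrite mulr_sumr big_seq [leRHS]big_seq; apply: ler_sum => s.
rewrite mem_primes_in => /and3P[ps s1 s2]; have s0 := prime_gt0 ps.
have {}s1 : i%:R * H < lnn s by rewrite ltNge -leq_expn_floor // -ltnNge.
have {}s2 : lnn s <= i.+1%:R * H by rewrite -leq_expn_floor.
have sn : (s <= n)%N.
  rewrite -(ler_nat R) -ler_ln ?posrE ?ltr0n //; apply: le_trans s2 _.
  case/andP: jM => jM _; apply: le_trans jM; rewrite ler_wpM2r ?ler_nat // ltW //.
have pS : all prime (s :: M) by rewrite /= ps.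
have wS : wt (s :: M) = wt M by apply: wt_cons; rewrite ?s0.
have -> : mn * (U * (wt M / n%:R)) / s%:R = mn * (U * (wt (s :: M) / (prodn (s :: M))%:R)).
  by rewrite wS big_cons natrM invfM -/n; ring.
have wS0 : 0 <= U * (wt (s :: M) / (prodn (s :: M))%:R).
  by rewrite mulr_ge0 // divr_ge0 // wt0.
have lE : lnn (prodn (s :: M)) = lnn s + lnn n by rewrite big_cons lnnM.
case/andP: jM => jM Mj.
case: (ltrP (lnn (prodn (s :: M))) ((j + i).+1%:R * H)) => hc.
  apply: le_trans (total_gain (j := j + i) hok pS _ (hE _)).
    by rewrite ler_wpM2r // ge_min lexx.
  rewrite /in_cell hc andbT lE natrD mulrDl; move: jM; rewrite -/n; lra.
apply: le_trans (total_gain (j := (j + i).+1) hok pS _ (hE _)).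
  by rewrite ler_wpM2r // ge_min lexx orbT.
rewrite /in_cell hc lE.
have -> : (j + i).+2%:R = j.+1%:R + i.+1%:R :> R by rewrite -natrD addSn addnS.
by rewrite mulrDl; move: Mj; rewrite -/n; lra.
Qed.

End Grid.

(** * From binary integers to real numbers *)

Section BinaryToReal.
Variable R : realType.

(* Locked, lest unification evaluate large binary numbers in unary. *)
Definition toR : N -> R := locked (fun a => (N.to_nat a)%:R).

Lemma toRE a : toR a = (N.to_nat a)%:R.
Proof. by rewrite /toR -lock. Qed.

Lemma toR_ge0 a : 0 <= toR a. Proof. by rewrite toRE. Qed.

Lemma toR0 : toR N0 = 0. Proof. by rewrite toRE. Qed.

Lemma toR_nat n : toR (N.of_nat n) = n%:R.
Proof. by rewrite !toRE Nat2N.id. Qed.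

Lemma toRD a b : toR (N.add a b) = toR a + toR b.
Proof. by rewrite !toRE N2Nat.inj_add -natrD. Qed.

Lemma toRM a b : toR (N.mul a b) = toR a * toR b.
Proof. by rewrite !toRE N2Nat.inj_mul -natrM. Qed.

Lemma toRX a b : toR (N.pow a b) = toR a ^+ N.to_nat b.
Proof.
rewrite -[in LHS](N2Nat.id b); elim: (N.to_nat b) => [|k IH]; first by rewrite toRE expr0.
by rewrite Nat2N.inj_succ N.pow_succ_r' toRM IH exprS.
Qed.

Lemma toR_le a b : (N.leb a b) -> toR a <= toR b.
Proof. by move/N.leb_le => h; rewrite !toRE ler_nat; lia. Qed.

Lemma toR_gt0 a : N.ltb N0 a -> 0 < toR a.
Proof. by move/N.ltb_lt => h; rewrite toRE ltr0n; lia. Qed.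

Lemma toR_min a b : toR (N.min a b) = Num.min (toR a) (toR b).
Proof.
case: (N.min_spec a b) => -[h ->]; rewrite !toRE.
  by apply/esym/min_idPl; rewrite ler_nat; lia.
by apply/esym/min_idPr; rewrite ler_nat; lia.
Qed.

Lemma toR_div a b : N.ltb N0 b -> toR (N.div a b) <= toR a / toR b.
Proof.
move=> b0; rewrite ler_pdivlMr ?toR_gt0 // mulrC -toRM; apply: toR_le.
apply/N.leb_le/N.Div0.mul_div_le.
Qed.

Lemma toR_shiftr a s : toR (N.shiftr a s) <= toR a / 2 ^+ N.to_nat s.
Proof.
have -> : 2 ^+ N.to_nat s = toR (N.pow 2 s) by rewrite toRX (toRE 2).
rewrite N.shiftr_div_pow2; apply: toR_div.
apply/N.ltb_lt; have : N.pow 2 s <> N0 by apply: N.pow_nonzero.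
lia.
Qed.

End BinaryToReal.

(** * Soundness of the table *)

Section GridGain.
Variable R : realType.
Local Notation lnn n := (ln (n%:R : R)).
Local Notation Y := (@expn_floor R).
Variables (sl : seq (nat * nat)) (tmax : nat).
Hypothesis sl_sorted : sorted slice_lt sl.
Hypothesis slP : forall s, s \in sl -> (0 < s.1 <= tmax)%N /\ (0 < s.2)%N.
Variables (x K : nat).
Hypothesis K0 : (0 < K)%N.
Local Notation H := (mesh R x K).
Local Notation U := (scale R x).
Hypothesis H1 : 1 <= H.
Hypothesis H_big : 14 * 10 ^+ 6 <= H.
Hypothesis H_exp : 36 * (slice_max sl)%:R * (10 ^+ 4 * (2 * tmax)%:R * lnn x) <= expR H.
Local Notation f := (value sl x).
Local Notation wt := (slice_weight R sl).
Local Notation l i := (primes_in (Y (i%:R * H)) x).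

Variables (J1 J2 i1 : nat) (D s r b G : N).
Hypothesis D0 : N.ltb N0 D.
Hypothesis r_small : N.leb (N.mul r (N.pow 10 6)) (N.mul (N.pred (N.pow 10 6)) (N.pow 2 s)).

Definition rowR (h : seq N) (j : nat) : R := toR R (nth N0 h j) / toR R D.

Let DR : 0 < toR R D. Proof. exact: toR_gt0. Qed.

Lemma rowR_ge0 h j : 0 <= rowR h j.
Proof. by rewrite divr_ge0 ?toR_ge0. Qed.

Lemma rowR_add u v j : rowR (row_add u v) j = rowR u j + rowR v j.
Proof. by rewrite /rowR nth_row_add toRD mulrDl. Qed.

Lemma rowR_direct i j : rowR (take (K - i.+1) (direct_row K D)) j <=
  if (K <= 2 * j)%N && (i + j + 2 <= K)%N then K%:R / (K - j)%:R else 0.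
Proof.
rewrite /rowR direct_rowP; case: ifP => [/andP[_ h]|_]; last by rewrite toR0 mul0r.
rewrite ler_pdivrMr //; apply: le_trans (toR_div _ _ _) _.
  by apply/N.ltb_lt; lia.
by rewrite toRM !toR_nat -mulrA mulrC.
Qed.

Local Notation row_good i h := (@row_ok R sl x K i (rowR h)).
Local Notation total i h := (total_row K (direct_row K D) i h).

Lemma total_row_gain i h M j : row_good i h -> all prime M -> in_cell R x K j (prodn M) ->
  rowR (total i h) j * (U * (wt M / (prodn M)%:R)) <= (possum f (l i) M)%:R.
Proof.
move=> hok pM jM; rewrite /total_row rowR_add addrC.
exact: (total_gain sl_sorted slP K0 H1 H_exp hok pM jM (rowR_direct _ _)).
Qed.

Lemma next_row_good i h : (i < K)%N -> row_good i.+1 h -> row_good i (next_row s r i h (total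
  i.+1 h)).
Proof.
move=> iK hok.
apply: (row_step sl_sorted slP K0 H1 H_big H_exp (E := rowR (take (K - i.+2) (direct_row K D)))
  iK hok).
- by move=> j; rewrite addr_ge0 ?rowR_ge0.
- exact: rowR_direct.
move=> j; rewrite {1}/rowR; have [->|[ij ->]] := nth_next_row s r i h (total i.+1 h) j.
  rewrite lerDl; case: ifP => // _; rewrite mulr_ge0 //.
    by rewrite le_min !addr_ge0 ?rowR_ge0.
  rewrite divr_ge0 // subr_ge0 invf_le1 ?exprn_gt0 ?ltr0n // exprn_ege1 // ler1n //.
rewrite ij toRD mulrDl lerD2l ler_pdivrMr //.
apply: le_trans (toR_shiftr _ _ _) _; rewrite toRM toR_min.
rewrite ler_pdivrMr ?exprn_gt0 ?ltr0n //.
set a := nth N0 _ (j + i); set c := nth N0 _ (j + i).+1.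
have -> : rowR (take (K - i.+2) (direct_row K D)) (j + i) + rowR h (j + i) = toR R a / toR R D.
  by rewrite addrC -rowR_add.
have -> : rowR (take (K - i.+2) (direct_row K D)) (j + i).+1 + rowR h (j + i).+1 = toR R c / toR
  R D.
  by rewrite addrC -rowR_add.
rewrite -minr_pMl ?invr_ge0 ?(ltW DR) //; set m := Num.min _ _.
have m0 : 0 <= m by rewrite le_min !toR_ge0.
have iS : 0 < i.+1%:R :> R by rewrite ltr0n.
have S0 : 0 < 2 ^+ N.to_nat s :> R by rewrite exprn_gt0 ?ltr0n.
have -> : m / toR R D * ((1 - (10 ^+ 6)^-1) / i.+1%:R) * toR R D * 2 ^+ N.to_nat s =
  (1 - (10 ^+ 6)^-1) * 2 ^+ N.to_nat s / i.+1%:R * m.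
  move: (10 ^+ 6)^-1 (2 ^+ _) (i.+1%:R^-1) (toR R D) DR => e S w d d0; field.
  by rewrite gt_eqF.
rewrite ler_wpM2r //; apply: le_trans (toR_div _ _ _) _; first by apply/N.ltb_lt; clear; lia.
rewrite toR_nat ler_pM2r ?invr_gt0 //.
have := toR_le R r_small; rewrite !toRM !toRX.
have -> : toR R 10 = 10 by rewrite toRE.
have -> : toR R 2 = 2 by rewrite toRE.
have -> : toR R (N.pred (N.pow 10 6)) = 10 ^+ 6 - 1.
  apply: (@addIr _ 1); rewrite subrK.
  have := toRD R (N.pred (N.pow 10 6)) 1; rewrite (toRE R 1 : toR R 1 = 1) => <-.
  by rewrite (_ : N.add _ _ = N.pow 10 6) // toRX (toRE R 10 : toR R 10 = 10).
have -> : N.to_nat 6 = 6%N by [].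
have T0 : 0 < 10 ^+ 6 :> R by rewrite exprn_gt0 ?ltr0n.
move: (10 ^+ 6) (2 ^+ _) T0 => T S T0; rewrite -ler_pdivlMr // => h1; apply: le_trans h1 _.
rewrite le_eqVlt; apply/orP; left; apply/eqP; field.
by rewrite gt_eqF.
Qed.

Lemma grid_scan i h : (i <= K)%N ->
  grid_test K J1 J2 i1 D s r b G (direct_row K D) i h -> row_good i h ->
  forall k, (i1 <= k <= i)%N -> exists h', row_good k h' /\ row_test J1 J2 i1 D b G k (total k h').
Proof.
elim: i h => [|i IH] h iK /= /andP[t1 t2] hok k /andP[k1 k2].
  by exists h; move: k2; rewrite leqn0 => /eqP->.
move: k2; rewrite leq_eqVlt => /orP[/eqP->|k2]; first by exists h.
have {}t2 : grid_test K J1 J2 i1 D s r b G (direct_row K D) i (next_row s r i h (total i.+1 h)).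
  by move: t2; case: ltnP => // ii1; lia.
apply: (IH _ (ltnW iK) t2); last by rewrite k1.
exact: next_row_good.
Qed.

Variable i0 : nat.
Hypothesis i0K : (i0 <= K)%N.
Hypothesis J1i0 : (J1 < i0)%N.
Hypothesis i1J1 : (0 < i1 <= J1)%N.
Hypothesis testP : grid_test K J1 J2 i1 D s r b G (direct_row K D) i0 (nseq K N0).

(** The zero row is a valid start at any height, since [possum2] is nonnegative. *)
Lemma grid_scan0 k : (i1 <= k <= i0)%N ->
  exists h', row_good k h' /\ row_test J1 J2 i1 D b G k (total k h').
Proof.
apply: (grid_scan i0K testP) => M j pM _.
by rewrite /rowR nth_nseq if_same toR0 !mul0r.
Qed.

Lemma grid_slope i M j : (i1 <= i <= J1)%N -> all prime M -> in_cell R x K j (prodn M) ->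
  (maxn J1 i.*2.-1 <= j <= J1 + i.+1)%N ->
  toR R b / 100 * (minn (j.+1 - i) J1)%:R / i%:R * (U * (wt M / (prodn M)%:R)) <=
  (possum f (l i.+1) M)%:R.
Proof.
move=> /andP[ii1 iJ] pM jM /andP[j0 j1].
have [|h [hok]] := @grid_scan0 i.+1; first by move: ii1 iJ J1i0; clear; lia.
rewrite /row_test /= !ltnS ii1 iJ /= => /andP[_ /andP[sz st]].
apply: le_trans (total_row_gain hok pM jM); apply: ler_wpM2r.
  rewrite mulr_ge0 ?divr_ge0 //; last exact: (slice_weight_ge0 R sl_sorted slP).
  exact: (scale_ge0 K0 H1).
set g := total _ _ in st sz *; set jm := maxn _ _ in j0 st.
have kg : (j - jm < size (take (J1 + i.+2 - jm) (drop jm g)))%N.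
  by rewrite size_take size_drop; rewrite -/(minn _ _); move: j0 j1 sz; clear; lia.
have := slope_testP st kg; rewrite nth_take ?nth_drop ?subnKC //; last by move: j0 j1; clear; lia.
have -> : N.add (N.of_nat (jm.+1 - i)) (N.of_nat (j - jm)) = N.of_nat (j.+1 - i).
  have : (i <= jm.+1)%N by rewrite /jm; clear; lia.
  by move: j0; clear; lia.
move/(toR_le R); rewrite !toRM toR_min !toR_nat /rowR => hh.
have iR : 0 < i%:R :> R by rewrite ltr0n; move: i1J1 ii1; clear; lia.
rewrite ler_pdivrMr // [leRHS]mulrAC ler_pdivlMr // natr_min.
move: hh; have -> : toR R 100 = 100 by rewrite toRE.
lra.
Qed.

Lemma grid_level M j : all prime M -> in_cell R x K j (prodn M) -> (J1 <= j < J2)%N ->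
  toR R G / toR R D * (U * (wt M / (prodn M)%:R)) <= (possum f (l i1) M)%:R.
Proof.
move=> pM jM /andP[j1 j2].
have [|h [hok]] := @grid_scan0 i1; first by move: i1J1 J1i0; clear; lia.
rewrite /row_test eqxx => /andP[/andP[sz al] _].
apply: le_trans (total_row_gain hok pM jM); apply: ler_wpM2r.
  rewrite mulr_ge0 ?divr_ge0 //; last exact: (slice_weight_ge0 R sl_sorted slP).
  exact: (scale_ge0 K0 H1).
rewrite ler_pM2r ?invr_gt0 //; apply: toR_le.
have /all_nthP := al; move=> /(_ N0 (j - J1)%N); rewrite nth_take ?nth_drop ?subnKC //;
  last by move: j1 j2; clear; lia.
apply; rewrite size_take size_drop; rewrite -/(minn _ _); move: j1 j2 sz; clear; lia.
Qed.

End GridGain.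

Section WeightedSums.
Variable R : realType.

(** The coefficients of [wsum] are nonnegative because f decreases; the inequality may then be
    checked for each slice separately. *)
Lemma ler_wsum2 (P0 P1 P2 : pred nat) sl (f w0 w1 w2 : nat -> R) :
  (forall t u, (0 < t <= u)%N -> f u <= f t) -> (forall t, 0 <= f t) ->
  (forall s, s \in sl -> (0 < s.1)%N) -> sorted slice_lt sl ->
  (forall s, s \in sl -> (P0 s.1)%:R * w0 s.1 <= (P1 s.1)%:R * w1 s.1 + (P2 s.1)%:R * w2 s.1) ->
  wsum P0 sl f w0 <= wsum P1 sl f w1 + wsum P2 sl f w2.
Proof.
move=> fd f0; elim: sl => [|s r IH] /= t0 sr H; first by rewrite addr0.
have {}IH := IH (fun s' s'r => t0 s' (mem_behead (s := s :: r) s'r)) (path_sorted sr) (fun s' s'r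
  => H s' (mem_behead (s := s :: r) s'r)).
rewrite addrACA; apply: lerD IH.
have c0 : 0 <= s.2%:R * (f s.1 - next_value r f).
  rewrite mulr_ge0 // subr_ge0; case: (r) sr => [|s' r'] /=; first by rewrite f0.
  by case/andP => /andP[/ltnW ss' _] _; apply: fd; rewrite t0 ?mem_head.
have := ler_wpM2l c0 (H s (mem_head _ _)).
move: (_ * (_ - _)) (P0 _)%:R (P1 _)%:R (P2 _)%:R (w0 _) (w1 _) (w2 _) => c q0 q1 q2 u0 u1 u2.
lra.
Qed.

End WeightedSums.

(** * Potentials and the main induction *)

Section Potentials.
Variable R : realType.
Local Notation lnn n := (ln (n%:R : R)).
Variable z : nat.

Definition Pi m : R := \prod_(p <- primes_in z m) (1 + p%:R^-1)^-1.
Definition Lsum m : R := \sum_(p <- primes_in z m) lnn p / (p%:R + 1).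
Definition pot (n m : nat) (k : R) : R := Pi m / n%:R * (lnn n - Lsum m + k).

Lemma Pi_gt0 m : 0 < Pi m.
Proof. by apply: prodr_gt0 => p _; rewrite invr_gt0 ltr_wpDr ?invr_ge0. Qed.

(* The additivity on which the main induction rests. *)
Lemma pot_prime n m k : (z <= m)%N -> prime m.+1 -> (0 < n)%N ->
  pot n m k = pot n m.+1 k + pot (m.+1 * n) m.+1 k.
Proof.
move=> zm pm n0; have p0 : 0 < m.+1%:R :> R by rewrite ltr0n.
have nR : 0 < n%:R :> R by rewrite ltr0n.
rewrite /pot lnnM // /Pi /Lsum primes_in_recr // pm -cats1 !big_cat /= !big_seq1 natrM.
move: (\prod_(_ <- _) _) (\sum_(_ <- _) _) (lnn n) (lnn m.+1) => A B u v.
move: (m.+1%:R) (n%:R) p0 nR => p q p0 q0; field.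
by rewrite !gt_eqF ?addr_gt0.
Qed.

Lemma pot_nonprime n m k : (z <= m)%N -> ~~ prime m.+1 -> pot n m.+1 k = pot n m k.
Proof. by move=> zm /negbTE pm; rewrite /pot /Pi /Lsum primes_in_recr // pm. Qed.

Lemma Lsum_le m : (0 < m)%N -> Lsum m <= lnn m + 10.
Proof.
move=> m0; case: (leqP z m) => [zm|mz]; last first.
  rewrite /Lsum /primes_in /index_iota (_ : m.+1 - z.+1 = 0)%N ?big_nil; last by apply/eqP;
    rewrite subn_eq0 ltnW.
  by rewrite addr_ge0 ?lnn_ge0.
apply: le_trans (mertens_le R m0); rewrite (@primes_in_cat 0 z m) // big_cat /=.
apply: ler_wpDl; first by apply: sumr_ge0 => p _; rewrite divr_ge0 ?lnn_ge0.
rewrite /Lsum big_seq [leRHS]big_seq; apply: ler_sum => p; rewrite mem_primes_in => /and3P[pp _ _].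
have p0 : 0 < p%:R :> R by rewrite ltr0n prime_gt0.
rewrite ler_wpM2l ?lnn_ge0 // lef_pV2 ?posrE ?addr_gt0 //.
by rewrite lerDl.
Qed.

End Potentials.

Section MainInduction.
Variable R : realType.
Local Notation lnn n := (ln (n%:R : R)).
Local Notation Y := (@expn_floor R).
Variables (sl : seq (nat * nat)) (tmax : nat).
Hypothesis sl_sorted : sorted slice_lt sl.
Hypothesis slP : forall s, s \in sl -> (0 < s.1 <= tmax)%N /\ (0 < s.2)%N.
Variables (x z : nat) (U H : R).
Hypothesis H0 : 0 < H.
Hypothesis U0 : 0 <= U.
Local Notation f := (value sl x).
Local Notation wt := (slice_weight R sl).
Local Notation l i := (primes_in (Y (i%:R * H)) x).
Local Notation Pi := (Pi R z).
Local Notation L := (Lsum R z).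
Local Notation cell j n := ((j%:R * H <= lnn n) && (lnn n < j.+1%:R * H)).

Variables (J1 J2 i1 : nat) (be g0 C3 C1 E kmax : R) (kap : nat -> R).
Hypothesis slope : forall i M j, (i1 <= i <= J1)%N -> all prime M -> cell j (prodn M) ->
  (maxn J1 i.*2.-1 <= j <= J1 + i.+1)%N ->
  be * (minn (j.+1 - i) J1)%:R / i%:R * (U * (wt M / (prodn M)%:R)) <= (possum f (l i.+1) M)%:R.
Hypothesis level : forall M j, all prime M -> cell j (prodn M) -> (J1 <= j < J2)%N ->
  g0 * (U * (wt M / (prodn M)%:R)) <= (possum f (l i1) M)%:R.
Hypothesis g0_ge0 : 0 <= g0.
Hypothesis i1J : (0 < i1)%N && (i1 < J1)%N && (J1 < J2)%N.
Hypothesis Pi_le : forall m, Pi m * (C3 * lnn m - C1) <= 1.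
Hypothesis L_ge : forall m, (0 < m)%N -> lnn m - E <= L m.
Hypothesis C3_gt0 : 0 < C3.
Hypothesis C1_ge0 : 0 <= C1.
Hypothesis E_ge0 : 0 <= E.
Hypothesis kap_le : forall s, s \in sl -> kap s.1 <= lnn s.1 - E.
Hypothesis kap_max : forall s, s \in sl -> kap s.1 <= kmax.
Hypothesis kmax_ge0 : 0 <= kmax.
Hypothesis i1H_big : C1 <= C3 * (i1%:R * H - 1).
Hypothesis m1_le : (Y (i1%:R * H) <= x)%N.
Hypothesis z_small : (z <= Y (i1%:R * H))%N.

Let m1 := Y (i1%:R * H).
(** As L at m1 is at most i1 H + 10, the factor D' - ln n + L is nonpositive once ln n >= J2 H, and
    at most (J2 - J1) H from ln n = J1 H on. The scale c' makes the resulting decreasing linear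
    function stay below the step function with value g0 that the table provides. *)
Let D' : R := (J2%:R - i1%:R) * H - 10.
Let c' : R := g0 * (C3 * (i1%:R * H - 1) - C1) / ((J2%:R - J1%:R) * H).

Let iH0 k : 0 <= k%:R * H. Proof. by rewrite mulr_ge0 // ltW. Qed.
Let J21 : 0 < (J2%:R - J1%:R) * H.
Proof. by rewrite mulr_gt0 // subr_gt0 ltr_nat; case/andP: i1J. Qed.
Let c'0 : 0 <= c'.
Proof. by rewrite /c' divr_ge0 ?(ltW J21) // mulr_ge0 // subr_ge0. Qed.
Let wt0 M : 0 <= wt M. Proof. exact: (slice_weight_ge0 R sl_sorted slP). Qed.

Lemma cell_exists n : (0 < n)%N -> exists j, cell j n.
Proof.
move=> n0; exists (Num.truncn (lnn n / H)).
have h : 0 <= lnn n / H by rewrite divr_ge0 ?lnn_ge0 // ltW.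
by have /andP[a b] := Num.Theory.truncn_itv h; rewrite -ler_pdivlMr // a -ltr_pdivrMr.
Qed.

(** For products beyond x^(J1/K) and primes below x^(i1/K). The bound is a positive multiple of
    minus the potential with k = - D', hence additive as well; its boundary values at m1 come from
    [level]. All primes concerned are below n, so the slice weight stays constant. *)
Lemma small_gain d m M : (m + d = m1)%N -> (z <= m)%N -> all prime M ->
  J1%:R * H <= lnn (prodn M) ->
  c' * (U * (wt M / (prodn M)%:R)) * (Pi m * (D' - lnn (prodn M) + L m)) <=
  (possum f (primes_in m x) M)%:R.
Proof.
elim: d m M => [|d IH] m M md zm pM JM; set n := prodn M in JM *.
  have {}md : m = m1 by rewrite -md addn0.
  have n0 : (0 < n)%N := primes_prod_gt0 pM.
  have W0 : 0 <= U * (wt M / n%:R) by rewrite mulr_ge0 // divr_ge0.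
  have m10 : (0 < m1)%N by apply: expn_floor_gt0.
  have Lm : L m1 <= i1%:R * H + 10.
    by apply: le_trans (Lsum_le R z m10) _; rewrite lerD2r ln_expn_floor_le.
  have P0 := Pi_gt0 R z m1.
  rewrite md; case: (lerP (J2%:R * H) (lnn n)) => hJ.
    apply: (@le_trans _ _ 0) => //; apply: mulr_ge0_le0; first by rewrite mulr_ge0.
    by apply: mulr_ge0_le0 (ltW P0) _; rewrite /D' mulrBl; lra.
  have [j jM] := cell_exists n0.
  have hj : (J1 <= j < J2)%N.
    case/andP: (jM) => a b; apply/andP; split.
      by have := le_lt_trans JM b; rewrite ltr_pM2r // ltr_nat ltnS.
    by have := le_lt_trans a hJ; rewrite ltr_pM2r // ltr_nat.
  apply: le_trans (level pM jM hj); rewrite [leLHS]mulrAC; apply: ler_wpM2r => //.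
  apply: (@le_trans _ _ (c' * (Pi m1 * ((J2%:R - J1%:R) * H)))).
    rewrite ler_wpM2l // ler_wpM2l ?(ltW P0) // /D' !mulrBl; lra.
  have -> : c' * (Pi m1 * ((J2%:R - J1%:R) * H)) = g0 * (Pi m1 * (C3 * (i1%:R * H - 1) - C1)).
    rewrite /c'; move: J21; move: ((J2%:R - J1%:R) * H) (_ - C1) (Pi m1) => w q p w0; field.
    by rewrite gt_eqF.
  rewrite -[leRHS]mulr1.
  rewrite ler_wpM2l //; apply: le_trans (Pi_le m1); rewrite ler_wpM2l ?(ltW P0) //.
  by rewrite lerD2r ler_wpM2l ?(ltW C3_gt0) // ln_expn_floor_ge.
have md' : (m.+1 + d = m1)%N by rewrite addSnnS.
have zm' := leqW zm.
have n0 : (0 < n)%N := primes_prod_gt0 pM.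
have m1n : (m1 <= n)%N.
  rewrite -[X in (_ <= X)%N](@expn_floor_ln R) //.
  apply: expn_floor_mono; apply: le_trans JM; rewrite ler_wpM2r ?ler_nat ?(ltW H0) //.
  by case/andP: i1J => /andP[_ /ltnW].
have potE n' m' w : c' * (U * (w / n'%:R)) * (Pi m' * (D' - lnn n' + L m')) =
    c' * U * w * (- pot z n' m' (- D')).
  by rewrite /pot; ring.
have mx : (m < x)%N by apply: leq_trans m1_le; rewrite -/m1 -md addnS ltnS leq_addr.
rewrite (primes_in_recl mx) potE; case: ifP => pm; last first.
  by rewrite -(pot_nonprime n (- D') zm (negbT pm)) -potE; apply: IH.
have pS : all prime (m.+1 :: M) by rewrite /= pm.
have wS : wt (m.+1 :: M) = wt M.
  apply: (wt_cons R slP) => //=; apply: leq_trans m1n; rewrite -md addnS ltnS leq_addr //.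
rewrite (pot_prime (- D') zm pm n0) /= natrD opprD mulrDr; apply: lerD.
  by rewrite -potE; apply: IH.
apply: (@le_trans _ _ (possum f (primes_in m.+1 x) (m.+1 :: M))%:R);
  last by rewrite ler_nat leq_addl.
have := IH m.+1 (m.+1 :: M) md' zm' pS; rewrite wS big_cons -/n potE; apply.
by apply: le_trans JM _; apply: ler_lnn; rewrite // leq_pmull.
Qed.

Variable Kc : R.
Hypothesis Kc0 : 0 <= Kc.
Local Notation B := (E + kmax).
Hypothesis be0 : 0 <= be.
Hypothesis K_slope : Kc * (H + B) <= be * (C3 * H - C1).
Hypothesis K_small : Kc * (J1%:R * H + B) <= c' * ((J2%:R - i1%:R - J1%:R) * H - 10 - E).
Hypothesis tmax_lt : lnn tmax < H.
Hypothesis top_le : (tmax * Y (J1.+1%:R * H) <= x)%N.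

(** The prime p carries the product past x^(J1/K), where the potential of the main induction must be
    paid for. If p is below x^(i1/K), [small_gain] pays; otherwise the table row just above the cell
    of p does, and the decay of Pi p like 1 / ln p matches the division by i in [slope]. *)
Lemma crossing_gain p M : all prime (p :: M) -> (z <= p)%N -> (p <= tmax * prodn M)%N ->
  lnn (prodn M) <= J1%:R * H -> J1%:R * H < lnn (prodn (p :: M)) ->
  Kc * (U * (wt (p :: M) / (prodn (p :: M))%:R)) * (Pi p * (lnn (prodn M) + B)) <=
  (possum f (primes_in p x) (p :: M))%:R.
Proof.
move=> pS zp pt nJ Jpn; have /andP[pp pM] := pS.
set n := prodn M in pt nJ *; have n0 : (0 < n)%N := primes_prod_gt0 pM.
have p0 : (0 < p)%N := prime_gt0 pp.
have t0 : (0 < tmax)%N by case: (tmax) pt => //; rewrite mul0n leqNgt p0.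
have lE : lnn (prodn (p :: M)) = lnn p + lnn n by rewrite big_cons lnnM.
clearbody n.
have W0 : 0 <= U * (wt (p :: M) / (prodn (p :: M))%:R) by rewrite mulr_ge0 // divr_ge0.
have P0 := Pi_gt0 R z p.
have pn : lnn p <= lnn tmax + lnn n by rewrite -lnnM //; apply: ler_lnn.
rewrite lE in Jpn.
case: (leqP p m1) => pm1.
  have [d dE] : exists d, (p + d = m1)%N by exists (m1 - p)%N; rewrite subnKC.
  have Jpn' : J1%:R * H <= lnn (prodn (p :: M)) by rewrite lE ltW.
  apply: le_trans (small_gain dE zp pS Jpn').
  rewrite [leLHS]mulrAC [leRHS]mulrAC; apply: ler_wpM2r => //.
  rewrite [leLHS]mulrCA [leRHS]mulrCA; apply: ler_wpM2l; first exact: ltW.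
  apply: (@le_trans _ _ (Kc * (J1%:R * H + B))); first by rewrite ler_wpM2l // lerD2r.
  apply: le_trans K_small _; rewrite ler_wpM2l //.
  have := L_ge p0; rewrite lE /D'; move: nJ; rewrite !mulrBl; lra.
have i1p : i1%:R * H < lnn p by rewrite ltNge -leq_expn_floor // -ltnNge.
have [i /andP[ip pi]] := cell_exists p0.
have [j jM] := cell_exists (primes_prod_gt0 pS).
have /andP[jn nj] := jM; rewrite lE in jn nj.
have ii1 : (i1 <= i)%N by have := lt_trans i1p pi; rewrite ltr_pM2r // ltr_nat ltnS.
have iJ : (i <= J1)%N.
  rewrite -ltnS -(ltr_nat R) -(ltr_pM2r H0) -natr1 mulrDl mul1r.
  apply: le_lt_trans ip _; apply: le_lt_trans pn _; rewrite addrC; exact: ler_ltD.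
have jJ : (J1 <= j)%N.
  by rewrite -ltnS -(ltr_nat R) -(ltr_pM2r H0); apply: lt_trans nj.
have jJi : (j <= J1 + i.+1)%N.
  rewrite ltnW // -(ltr_nat R) -(ltr_pM2r H0) natrD mulrDl.
  by apply: le_lt_trans jn _; rewrite addrC; apply: ler_ltD.
(* Density: p is at most tmax n, and ln tmax is less than one cell. *)
have ji : (i.*2 <= j.+1)%N.
  rewrite -ltnS -(ltr_nat R) -(ltr_pM2r H0) -addnn natrD -[j.+2%:R]natr1 !mulrDl mul1r.
  apply: (@le_lt_trans _ _ (lnn p + (lnn tmax + lnn n))); first exact: lerD (le_trans ip pn).
  by rewrite addrCA addrC; apply: ltrD.
have i0 : (0 < i)%N by apply: leq_trans ii1; case/andP: i1J => /andP[].
have iR : 0 < i%:R :> R by rewrite ltr0n.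
set m := minn (j.+1 - i) J1.
have m1' : (1 <= m)%N by rewrite /m leq_min; move: ji i0 i1J; clear; lia.
(* Two bounds for ln n: it is at most J1 H before the crossing, and ln (p n) - ln p is below (j + 1
   - i) H. *)
have nm : lnn n <= m%:R * H.
  rewrite /m natr_min; have [_|_] := leP ((j.+1 - i)%:R : R) J1%:R => //.
  rewrite natrB; last by move: ji i0; clear; lia.
  by rewrite mulrBl; lra.
have m1R : 1 <= m%:R :> R by rewrite ler1n.
have yx : (Y (i.+1%:R * H) <= x)%N.
  apply: leq_trans top_le; apply: leq_trans (leq_pmull _ t0).
  by apply: expn_floor_mono; rewrite ler_wpM2r ?ler_nat // ltW.
rewrite (@primes_in_cat p (Y (i.+1%:R * H)) x); last first.
  by rewrite yx andbT leq_expn_floor // ltW.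
apply: (@le_trans _ _ (possum f (l i.+1) (p :: M))%:R); last by rewrite ler_nat possum_cat.
have hj : (maxn J1 i.*2.-1 <= j <= J1 + i.+1)%N.
  by rewrite geq_max jJ jJi !andbT /=; move: ji; clear; lia.
have hi : (i1 <= i <= J1)%N by rewrite ii1.
apply: le_trans (slope hi pS jM hj); rewrite -/m [leLHS]mulrAC; apply: ler_wpM2r => //.
have B0 : 0 <= B by rewrite addr_ge0.
have H1 : C1 <= C3 * H * i%:R.
  apply: le_trans i1H_big _; rewrite -mulrA ler_wpM2l ?(ltW C3_gt0) // mulrC.
  rewrite lerBlDr; apply: (@le_trans _ _ (i%:R * H)); last by rewrite mulrC lerDl.
  by rewrite mulrC ler_wpM2r ?ler_nat // ltW.
apply: (@le_trans _ _ (Pi p * (m%:R * (Kc * (H + B))))).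
  rewrite mulrCA ler_wpM2l ?(ltW P0) // mulrCA ler_wpM2l // mulrDr.
  rewrite lerD // ler_peMl //.
apply: (@le_trans _ _ (Pi p * (m%:R * (be * (C3 * H - C1))))).
  by rewrite !ler_wpM2l // ltW.
have -> : be * m%:R / i%:R = be * m%:R / i%:R * 1 by rewrite mulr1.
apply: (@le_trans _ _ (be * m%:R / i%:R * (Pi p * (C3 * lnn p - C1)))); last first.
  by rewrite ler_wpM2l ?Pi_le // mulr_ge0 ?invr_ge0 // mulr_ge0.
have -> : Pi p * (m%:R * (be * (C3 * H - C1))) = be * m%:R / i%:R * (Pi p * (i%:R * (C3 * H - C1))).
  by field; rewrite gt_eqF.
rewrite ler_wpM2l // ?mulr_ge0 ?invr_ge0 //; rewrite ler_wpM2l ?(ltW P0) //.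
rewrite mulrBr lerB //; last by rewrite ler_peMl // ler1n.
by rewrite mulrCA ler_wpM2l ?(ltW C3_gt0).
Qed.

(* Makes the potential of the empty product vanish at [m = t], where it stops being counted. *)
Definition end_value t : R := - pot z 1 t (kap t).
Definition slice_pot M m t : R := pot z (prodn M) m (kap t) + (M == [::])%:R * end_value t.
(** The next prime exceeds m and must be at most t n to be adjoined densely, so a slice is dropped
    as soon as m reaches t n. *)
Definition alive M m t := dense t M && (m < t * prodn M)%N.
Definition potential M m : R := wsum (alive M m) sl (inv2 R) (slice_pot M m).

Lemma inv2_le t u : (0 < t <= u)%N -> inv2 R u <= inv2 R t.
Proof.
move=> /andP[t0 tu]; rewrite /inv2 lef_pV2 ?posrE ?ltr0n ?muln_gt0 ?t0 ?(leq_trans t0 tu) //.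
by rewrite ler_nat leq_mul2l.
Qed.

Lemma inv2_ge0 t : 0 <= inv2 R t. Proof. by rewrite invr_ge0. Qed.

Let sl_gt0 s : s \in sl -> (0 < s.1)%N. Proof. by case/slP => /andP[]. Qed.

(** This is where kap t <= ln t - E comes from: at m = t n one has ln n - L_m + kap t <= ln n - (ln
    t + ln n - E) + (ln t - E) = 0, so dropping the slice costs nothing. *)
Lemma dead_pot s M : s \in sl -> all prime M ->
  slice_pot M (s.1 * prodn M) s.1 <= 0.
Proof.
move=> ssl pM; have n0 := primes_prod_gt0 pM; have t0 := sl_gt0 ssl.
rewrite /slice_pot; case: M pM n0 => [|p M] pM n0 /=.
  by rewrite big_nil muln1 mul1r /end_value subrr.
rewrite mul0r addr0 /pot; apply: mulr_ge0_le0; first by rewrite divr_ge0 ?(ltW (Pi_gt0 _ _ _)).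
set n := prodn _ in n0 *; have tn0 : (0 < s.1 * n)%N by rewrite muln_gt0 t0.
have := L_ge tn0; have := kap_le ssl; rewrite lnnM //; lra.
Qed.

Lemma potential_step m M : (z <= m)%N -> prime m.+1 -> all prime M ->
  potential M m <= potential M m.+1 + potential (m.+1 :: M) m.+1.
Proof.
move=> zm pm pM; have n0 := primes_prod_gt0 pM.
apply: ler_wsum2 => //; [exact: inv2_le | exact: inv2_ge0 |] => s ssl.
have t0 := sl_gt0 ssl.
case: (boolP (alive M m s.1)) => [/andP[dM mt]|na]; last first.
  have -> : alive M m.+1 s.1 = false.
    by apply/negP => /andP[dM /ltnW mt]; rewrite /alive dM mt in na.
  have -> : alive (m.+1 :: M) m.+1 s.1 = false.
    by apply/negP => /andP[/= /andP[dM mt] _]; rewrite /alive dM mt in na.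
  by rewrite !mul0r addr0.
have -> : alive (m.+1 :: M) m.+1 s.1.
  rewrite /alive /= dM mt big_cons mulnCA -[ltnLHS]muln1 ltn_pmul2l //.
  exact: leq_trans (prime_gt1 pm) mt.
rewrite !mul1r.
have potE : slice_pot M m s.1 = slice_pot M m.+1 s.1 + slice_pot (m.+1 :: M) m.+1 s.1.
  by rewrite /slice_pot (pot_prime (kap s.1) zm pm n0) /= big_cons mul0r addr0 addrAC.
rewrite potE lerD2r; move: mt; rewrite /alive dM /= leq_eqVlt => /orP[/eqP mt|->];
  last by rewrite mul1r.
by rewrite mt ltnn mul0r; apply: dead_pot.
Qed.

Lemma potential_stay m M : (z <= m)%N -> ~~ prime m.+1 -> all prime M ->
  potential M m <= potential M m.+1.
Proof.
move=> zm pm pM.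
suff : potential M m <= potential M m.+1 + wsum pred0 sl (inv2 R) (fun=> 0).
  have -> : wsum pred0 sl (inv2 R) (fun=> 0) = 0 by elim: (sl) => //= s r ->; rewrite mulr0 addr0.
  by rewrite addr0.
apply: ler_wsum2 => //; [exact: inv2_le | exact: inv2_ge0 |] => s ssl.
have potE : slice_pot M m.+1 s.1 = slice_pot M m s.1 by rewrite /slice_pot pot_nonprime.
rewrite mulr0 addr0 -potE /alive; case: (dense _ _) => /=; last by rewrite !mul0r.
case: (ltngtP m.+1 (s.1 * prodn M)) => mt //.
by rewrite mul1r mul0r mt dead_pot.
Qed.

(** In ln (p n) - L_p the term ln p cancels up to E, which leaves ln n + E + kmax as a common bound
    for all slices. *)
Lemma potential_crossing p M : all prime (p :: M) -> (0 < p)%N ->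
  potential (p :: M) p <= Pi p / (prodn (p :: M))%:R * (lnn (prodn M) + B) * wt (p :: M).
Proof.
move=> pS p0; have pM : all prime M by case/andP: pS.
have n0 := primes_prod_gt0 pM.
set c := Pi p / _ * _.
have B0 : 0 <= B by rewrite addr_ge0.
have c0 : 0 <= c.
  by rewrite /c !mulr_ge0 ?invr_ge0 ?(ltW (Pi_gt0 _ _ _)) // addr_ge0 ?lnn_ge0.
rewrite /slice_weight -(wsum_filter _ (P := fun t => dense t (p :: M))) //; last first.
  by move=> t u; apply: dense_leq.
have -> : c * wsum (dense^~ (p :: M)) sl (inv2 R) (fun=> 1) =
          wsum (dense^~ (p :: M)) sl (inv2 R) (fun=> c) + wsum pred0 sl (inv2 R) (fun=> 0).
  by elim: (sl) => [|s r IH] /=; [ring | rewrite mulrDr IH; ring].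
apply: ler_wsum2 => //; [exact: inv2_le | exact: inv2_ge0 |] => s ssl.
rewrite mul0r addr0 /alive; case: (dense _ _) => /=; last by rewrite !mul0r.
rewrite mul1r; case: ltnP => _; last by rewrite mul0r.
rewrite mul1r /slice_pot /= mul0r addr0 /pot /c ler_wpM2l //.
  by rewrite divr_ge0 ?(ltW (Pi_gt0 _ _ _)).
rewrite big_cons lnnM //.
have := L_ge p0; have := kap_max ssl; lra.
Qed.

(** Downward induction on m from tmax x^(J1/K), where every slice has been dropped and the potential
    is nonpositive. *)
Lemma main_gain d m M : (m + d = tmax * Y (J1%:R * H))%N -> (z <= m)%N -> all prime M ->
  lnn (prodn M) <= J1%:R * H ->
  Kc * U * potential M m <= (possum f (primes_in m x) M)%:R.
Proof.
elim: d m M => [|d IH] m M md zm pM nJ; set n := prodn M in nJ *.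
  have n0 : (0 < n)%N := primes_prod_gt0 pM.
  apply: (@le_trans _ _ 0) => //; apply: mulr_ge0_le0; first by rewrite mulr_ge0.
  suff : potential M m <= wsum pred0 sl (inv2 R) (fun=> 0) + wsum pred0 sl (inv2 R) (fun=> 0).
    have -> : wsum pred0 sl (inv2 R) (fun=> 0) = 0 by elim: (sl) => //= s r ->; rewrite mulr0 addr0.
    by rewrite addr0.
  apply: ler_wsum2 => //; [exact: inv2_le | exact: inv2_ge0 |] => s ssl.
  rewrite mulr0 addr0 /alive; have -> : (m < s.1 * prodn M)%N = false.
    apply/negbTE; rewrite -leqNgt -[m]addn0 md leq_mul //; first by case/slP: ssl => /andP[].
    by rewrite leq_expn_floor.
  by rewrite andbF mul0r.
have md' : (m.+1 + d = tmax * Y (J1%:R * H))%N by rewrite addSnnS.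
have zm' := leqW zm.
have mx : (m < x)%N.
  apply: leq_trans top_le; apply: leq_trans (_ : _ <= tmax * Y (J1%:R * H))%N _.
    by rewrite -md addnS ltnS leq_addr.
  by rewrite leq_mul2l; apply/orP; right; apply: expn_floor_mono; rewrite ler_wpM2r ?ler_nat // ltW.
have KU : 0 <= Kc * U by rewrite mulr_ge0.
rewrite (primes_in_recl mx); case: ifP => pm; last first.
  apply: le_trans (IH _ _ md' zm' pM nJ); rewrite ler_wpM2l //.
  by apply: potential_stay => //; rewrite pm.
apply: le_trans (ler_wpM2l KU (potential_step zm pm pM)) _.
rewrite mulrDr /= natrD; apply: lerD; first exact: IH.
apply: (@le_trans _ _ (possum f (primes_in m.+1 x) (m.+1 :: M))%:R);
  last by rewrite ler_nat leq_addl.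
have pS : all prime (m.+1 :: M) by rewrite /= pm.
case: (lerP (lnn (prodn (m.+1 :: M))) (J1%:R * H)) => hc; first exact: IH.
case: (boolP (has (fun s => dense s.1 (m.+1 :: M)) sl)) => hd; last first.
  apply: le_trans (ler_wpM2l KU (potential_crossing pS _)) _ => //.
  by rewrite slice_weight_empty // !mulr0.
have pt : (m.+1 <= tmax * prodn M)%N.
  case/hasP: hd => s ssl /= /andP[_ h]; apply: leq_trans h _.
  by rewrite leq_mul2r; case/slP: ssl => /andP[_ ->]; rewrite orbT.
apply: le_trans (crossing_gain pS zm' pt nJ hc).
apply: le_trans (ler_wpM2l KU (potential_crossing pS _)) _ => //.
by rewrite le_eqVlt; apply/orP; left; apply/eqP; ring.
Qed.

End MainInduction.

(** * Numerical constants *)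

Section Constants.
Variable R : realType.
Local Notation lnn n := (ln (n%:R : R)).

Lemma prime_ge2 p : prime p -> 2 <= p%:R :> R.
Proof. by move=> /prime_gt1 pp; rewrite (ler_nat R 2 p). Qed.

Lemma tail_square_sum M m : (0 < M)%N ->
  \sum_(p <- primes_in M m) 2 * lnn p / (p%:R ^+ 2 - 1) <= 2 * (lnn M + 2) / M%:R.
Proof.
move=> M0; have MR : 0 <= 2 * (lnn M + 2) / M%:R.
  by rewrite divr_ge0 // mulr_ge0 // addr_ge0 ?lnn_ge0.
case: (leqP m M) => [mM|/ltnW Mm]; first by rewrite primes_in_nil // big_nil.
have := sum_lnp_telescope R M0 Mm.
have h0 : 0 <= (lnn m + 2) / m%:R by rewrite divr_ge0 // addr_ge0 ?lnn_ge0.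
move=> h; rewrite big_primes_in -mulrA.
apply: (@le_trans _ _ (2 * \sum_(M.+1 <= p < m.+1) lnn p / (p%:R * (p%:R - 1)))); last first.
  by rewrite ler_wpM2l //; move: h h0; lra.
rewrite mulr_sumr big_mkcond /= !big_seq; apply: ler_sum => p;
  rewrite mem_index_iota => /andP[Mp _].
have p1 : 1 < p%:R :> R by rewrite ltr1n (leq_ltn_trans M0).
have q0 : 0 < p%:R * (p%:R - 1) :> R by rewrite mulr_gt0 ?subr_gt0 // (lt_trans _ p1).
case: ifP => _; last by rewrite mulr_ge0 // divr_ge0 ?lnn_ge0 // ltW.
rewrite -mulrA ler_wpM2l // ler_wpM2l ?lnn_ge0 // lef_pV2 ?posrE //; first by nra.
by nra.
Qed.

(** Termwise, ln p / (p + 1) = ln p / (p - 1) - 2 ln p / (p^2 - 1), and the second series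
    converges. *)
Lemma Lsum_ge z M m : (z <= M)%N -> (0 < M)%N -> (0 < m)%N ->
  lnn m - (1 + \sum_(p <- primes_in 0 z) lnn p / (p%:R - 1) +
   \sum_(p <- primes_in z M) 2 * lnn p / (p%:R ^+ 2 - 1) + 2 * (lnn M + 2) / M%:R) <=
  Lsum R z m.
Proof.
move=> zM M0 m0; have := sum_lnp_pred_ge R m0; rewrite -big_primes_in0.
have t0 a b (F : nat -> R) : (forall p, prime p -> 0 <= F p) -> 0 <= \sum_(p <- primes_in a b) F p.
  by move=> F0; rewrite big_seq; apply: sumr_ge0 => p; rewrite mem_primes_in => /and3P[/F0].
have f0 p : prime p -> 0 <= lnn p / (p%:R - 1).
  by move=> pp; rewrite divr_ge0 ?lnn_ge0 // subr_ge0 ler1n prime_gt0.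
have g0 p : prime p -> 0 <= 2 * lnn p / (p%:R ^+ 2 - 1).
  move=> pp; rewrite divr_ge0 ?mulr_ge0 ?lnn_ge0 //; have := prime_ge2 pp; nra.
have MR : 0 <= 2 * (lnn M + 2) / M%:R.
  by rewrite divr_ge0 // mulr_ge0 // addr_ge0 ?lnn_ge0.
case: (leqP z m) => zm; last first.
  rewrite /Lsum (primes_in_nil (ltnW zm)) big_nil (@primes_in_cat 0 m z) ?(ltnW zm) // big_cat /=.
  have := t0 m z _ f0; have := t0 z M _ g0; lra.
rewrite (@primes_in_cat 0 z m) ?zm // big_cat /=.
have sE : \sum_(p <- primes_in z m) lnn p / (p%:R - 1) =
    Lsum R z m + \sum_(p <- primes_in z m) 2 * lnn p / (p%:R ^+ 2 - 1).
  rewrite -big_split /= big_seq [RHS]big_seq; apply: eq_bigr => p;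
    rewrite mem_primes_in => /and3P[pp _ _].
  have p2 := prime_ge2 pp; rewrite subr_sqr_1; field.
  by apply/andP; split; apply: lt0r_neq0; lra.
have tl : \sum_(p <- primes_in z m) 2 * lnn p / (p%:R ^+ 2 - 1) <=
   \sum_(p <- primes_in z M) 2 * lnn p / (p%:R ^+ 2 - 1) + 2 * (lnn M + 2) / M%:R.
  case: (leqP m M) => [mM|/ltnW Mm].
    rewrite (@primes_in_cat z m M) ?zm // big_cat /=; have := t0 m M _ g0; lra.
  rewrite (@primes_in_cat z M m) ?zM // big_cat /= lerD2l; exact: tail_square_sum.
rewrite sE; lra.
Qed.

(** Over all integers of the range the product telescopes to the left-hand side; leaving out
    composite factors only increases it. *)
Lemma tail_square_prod M m : (0 < M)%N -> (M <= m)%N ->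
  M%:R / (M%:R + 1) * ((m%:R + 1) / m%:R) <= \prod_(p <- primes_in M m) (1 - p%:R ^- 2) :> R.
Proof.
move=> M0; have MR : 0 < M%:R :> R by rewrite ltr0n.
elim: m => [|m IH]; first by rewrite leqn0 => /eqP M00; rewrite M00 in M0.
rewrite leq_eqVlt => /orP[/eqP<-|]; last rewrite ltnS => Mm.
  rewrite primes_in_nil // big_nil mulrA divfK ?gt_eqF ?addr_gt0 // mulfV // gt_eqF //.
have m0 : 0 < m%:R :> R by rewrite ltr0n (leq_trans M0).
have {}IH := IH Mm; rewrite primes_in_recr // -natr1.
have c0 : 0 <= M%:R / (M%:R + 1) :> R by rewrite divr_ge0 // addr_ge0.
case: ifP => _.
  rewrite -cats1 big_cat big_seq1 /=.
  have s0 : 0 <= 1 - (m%:R + 1) ^- 2 :> R.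
    by rewrite subr_ge0 invf_le1 ?exprn_gt0 ?addr_gt0 // exprn_ege1 // lerDr ltW.
  rewrite -natr1; apply: le_trans (ler_wpM2r s0 IH); rewrite -[leRHS]mulrA ler_wpM2l //.
  rewrite le_eqVlt; apply/orP; left; apply/eqP; field.
  by rewrite !gt_eqF ?addr_gt0.
apply: le_trans IH; rewrite ler_wpM2l // ler_pdivrMr ?addr_gt0 // mulrAC ler_pdivlMr //.
by lra.
Qed.

(** By 1 + 1/p = (1 - 1/p^2) / (1 - 1/p), the inverse of Pi m is Euler's product up to m with its
    factors up to z removed, times a convergent product. The constant also makes the bound trivial
    for m <= M. *)
Lemma Pi_bound z M (q c C : R) : 0 <= c ->
  (forall n, (0 < n)%N -> c * lnn n - C <= \prod_(p <- primes_in 0 n) (1 - p%:R^-1)^-1) ->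
  (z <= M)%N -> (0 < M)%N -> 0 <= q ->
  q <= \prod_(p <- primes_in 0 z) (1 - p%:R^-1) * \prod_(p <- primes_in z M) (1 - p%:R ^- 2)
       * (M%:R / (M%:R + 1)) ->
  exists2 C1 : R, 0 <= C1 & forall m, Pi R z m * (c * q * lnn m - C1) <= 1.
Proof.
move=> c0 hC zM M0 q0 qle.
pose D := c * q * lnn M + q * `|C|.
have D0 : 0 <= D.
  by rewrite addr_ge0 ?mulr_ge0 ?lnn_ge0.
exists D => // m.
have P0 := Pi_gt0 R z m.
case: (leqP m M) => mM.
  apply: (@le_trans _ _ 0) => //; apply: mulr_ge0_le0; first exact: ltW.
  rewrite subr_le0 /D; apply: ler_wpDr; first by rewrite mulr_ge0.
  case: (posnP m) => [->|m0]; first by rewrite ln0 // mulr0 !mulr_ge0 ?lnn_ge0.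
  by rewrite ler_wpM2l ?ler_lnn // !mulr_ge0.
have m0 : (0 < m)%N by apply: leq_trans mM.
suff : c * q * lnn m - D <= (Pi R z m)^-1.
  by move=> h; rewrite -[leRHS](@mulfV _ (Pi R z m)) ?gt_eqF // ler_wpM2l // ltW.
have zm : (z <= m)%N by apply: leq_trans zM (ltnW mM).
apply: (@le_trans _ _ (q * (c * lnn m - C))).
  rewrite mulrBr; have := ler_norm C => hn; have := ler_wpM2l q0 hn.
  have : 0 <= c * q * lnn M by rewrite !mulr_ge0 ?lnn_ge0.
  rewrite /D; lra.
apply: (@le_trans _ _ (q * \prod_(p <- primes_in 0 m) (1 - p%:R^-1)^-1)).
  by rewrite ler_wpM2l // hC.
have pp0 p : prime p -> 0 < 1 - p%:R^-1 :> R.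
  by move=> pp; rewrite subr_gt0 invf_lt1 ?ltr0n ?prime_gt0 // ltr1n prime_gt1.
have Q0 : 0 <= \prod_(p <- primes_in 0 m) (1 - p%:R^-1)^-1 :> R.
  by rewrite big_seq; apply: prodr_ge0 => p; rewrite mem_primes_in => /and3P[/pp0 h _ _];
    rewrite invr_ge0 ltW.
apply: le_trans (ler_wpM2r Q0 qle) _.
have E0 : \prod_(p <- primes_in 0 z) (1 - p%:R^-1) * \prod_(p <- primes_in 0 z) (1 - p%:R^-1)^-1
  = 1 :> R.
  rewrite -big_split /= big_seq big1 // => p; rewrite mem_primes_in => /and3P[/pp0 h _ _].
  by rewrite mulfV // gt_eqF.
have s0 p : prime p -> 0 <= 1 - p%:R ^- 2 :> R.
  move=> pp; rewrite subr_ge0 invf_le1 ?exprn_gt0 ?ltr0n ?prime_gt0 //.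
  by rewrite exprn_ege1 // ler1n prime_gt0.
have PiE : (Pi R z m)^-1 = \prod_(p <- primes_in z m) (1 - p%:R ^- 2) *
   \prod_(p <- primes_in z m) (1 - p%:R^-1)^-1.
  rewrite /Pi -prodfV -big_split /= big_seq [RHS]big_seq; apply: eq_bigr => p.
  rewrite mem_primes_in => /and3P[pp _ _]; have p2 := prime_ge2 pp.
  field; do ![apply/andP; split]; apply: lt0r_neq0; lra.
rewrite PiE (@primes_in_cat 0 z m) ?zm // big_cat /= [X in _ <= X * _](_ : _ = \prod_(p <-
  primes_in z M) (1 - p%:R ^- 2) * \prod_(p <- primes_in M m) (1 - p%:R ^- 2)); last first.
  by rewrite (@primes_in_cat z M m) ?zM ?(ltnW mM) // big_cat.
have S0 : 0 <= \prod_(p <- primes_in z M) (1 - p%:R ^- 2) :> R.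
  by rewrite big_seq; apply: prodr_ge0 => p; rewrite mem_primes_in => /and3P[/s0].
have F0 : 0 <= \prod_(p <- primes_in z m) (1 - p%:R^-1)^-1 :> R.
  by rewrite big_seq; apply: prodr_ge0 => p; rewrite mem_primes_in => /and3P[/pp0 h _ _];
    rewrite invr_ge0 ltW.
have tl : M%:R / (M%:R + 1) <= \prod_(p <- primes_in M m) (1 - p%:R ^- 2) :> R.
  apply: le_trans (tail_square_prod M0 (ltnW mM)); rewrite ler_peMr ?divr_ge0 ?addr_ge0 //.
  by rewrite ler_pdivlMr ?ltr0n // mul1r lerDl.
move: (\prod_(_ <- primes_in 0 z) _) (\prod_(_ <- primes_in 0 z) _) E0 S0 F0 tl => B A AB.
move: (\prod_(_ <- primes_in z M) _) (\prod_(_ <- primes_in M m) _) (\prod_(_ <- primes_in z m)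
  _) => S T F S0 F0 tl.
have -> : A * S * (M%:R / (M%:R + 1)) * (B * F) = A * B * (S * (M%:R / (M%:R + 1)) * F) by ring.
by rewrite AB mul1r ler_wpM2r // ler_wpM2l.
Qed.

End Constants.

(* Unfolding these under [N.to_nat] would produce huge unary numbers. *)
Opaque unit40 mertens_shift euler_const.

#[local] Arguments N.mul : simpl never.
#[local] Arguments N.add : simpl never.
#[local] Arguments N.pred : simpl never.
#[local] Arguments N.succ : simpl never.

Section RealBounds.
Variable R : realType.
Local Notation lnn n := (ln (n%:R : R)).
Local Notation r := (@toR R).
Local Notation D := unit40.

Lemma D_gt0 : 0 < r D. Proof. exact: toR_gt0. Qed.
Local Notation D0 := D_gt0.

Lemma toR_div_succ a b : N.ltb N0 b -> r a / r b <= r (N.succ (N.div a b)).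
Proof.
move=> b0; have b0' := toR_gt0 R b0; rewrite ler_pdivrMr // -toRM; apply: toR_le.
apply/N.leb_le; have := N.mul_succ_div_gt a b; move/N.ltb_lt: b0 => b0 /(_ _).
lia.
Qed.

Lemma toR_succ a : r (N.succ a) = r a + 1.
Proof. by rewrite -N.add_1_r toRD (toRE R 1). Qed.

Lemma toR_pred a : N.ltb N0 a -> r (N.pred a) = r a - 1.
Proof.
by move=> /N.ltb_lt a0; apply: (@addIr _ 1); rewrite subrK -toR_succ N.succ_pred //; lia.
Qed.

Lemma log16_bounds n : (0 < n)%N ->
  r (log16 (N.of_nat n)) * lnn 2 <= 16 * lnn n <= (r (log16 (N.of_nat n)) + 1) * lnn 2.
Proof.
move=> n0; have nN : (N.lt N0 (N.pow (N.of_nat n) 16)).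
  by apply/N.neq_0_lt_0/N.pow_nonzero; lia.
have [h1 /N.lt_le_incl h2] := N.log2_spec _ nN.
have lnr a b : N.lt N0 a -> N.le a b -> ln (r a) <= ln (r b).
  move=> /N.ltb_lt a0 /N.leb_le ab; have a0' := toR_gt0 R a0.
  by rewrite ler_ln ?posrE ?toR_le // (lt_le_trans a0') ?toR_le.
have p2 : N.lt N0 (N.pow 2 (N.log2 (N.pow (N.of_nat n) 16))) by apply/N.neq_0_lt_0/N.pow_nonzero.
have := lnr _ _ p2 h1; have := lnr _ _ nN h2.
rewrite !toRX toR_nat (toRE R 2 : r 2 = 2%:R) (_ : N.to_nat 16 = 16%N) // !lnXn ?ltr0n //.
move=> h3 h4; apply/andP; split; rewrite [16 * _](mulr_natl (lnn n) 16).
  by rewrite toRE [_ * _]mulr_natl.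
by rewrite -toR_succ toRE [_ * _]mulr_natl.
Qed.

Lemma ln_lo_le n : (0 < n)%N -> r (ln_lo (log16 (N.of_nat n))) / r D <= lnn n.
Proof.
move=> n0; have /andP[h _] := log16_bounds n0.
rewrite ler_pdivrMr ?D0 //; apply: le_trans (toR_div _ _ _) _ => //.
rewrite !toRM (toRE R 9 : r 9 = 9) (toRE R 208 : r 208 = 208) ler_pdivrMr //.
have := ln2_ge R; have := toR_ge0 R (log16 (N.of_nat n)); have := D_gt0.
move: (r D) (r (log16 _)) (lnn n) (lnn 2) h => d a l t h d0 a0 t9.
have : a * (9 / 13) <= a * t by rewrite ler_wpM2l.
move=> h9; have : d * (a * (9 / 13)) <= d * (16 * l) by rewrite ler_wpM2l ?(ltW d0) //; lra.
lra.
Qed.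

Lemma ln_hi_ge n : (0 < n)%N -> lnn n <= r (ln_hi (log16 (N.of_nat n))) / r D.
Proof.
move=> n0; have /andP[_ h] := log16_bounds n0.
rewrite ler_pdivlMr ?D0 //; apply: le_trans _ (toR_div_succ _ _) => //.
rewrite !toRM (toRE R 43 : r 43 = 43) (toRE R 992 : r 992 = 992) ler_pdivlMr // toR_succ.
have := ln2_le R; have := toR_ge0 R (log16 (N.of_nat n)); have := D_gt0.
move: (r D) (r (log16 _)) (lnn n) (lnn 2) h => d a l t h d0 a0 t9.
have : (a + 1) * t <= (a + 1) * (43 / 62) by rewrite ler_wpM2l // addr_ge0.
move=> h9; have : d * (16 * l) <= d * ((a + 1) * (43 / 62)) by rewrite ler_wpM2l ?(ltW d0) //; lra.
lra.
Qed.

Lemma big_logs_in (S : Type) (idx : S) (op : S -> S -> S) (F : N * N -> S) a b : N.leb b 4096 ->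
  \big[op/idx]_(q <- logs_in a b) F q =
  \big[op/idx]_(p <- primes_in (N.to_nat a) (N.to_nat b)) F (N.of_nat p, log16 (N.of_nat p)).
Proof. by move=> b4; rewrite logs_inE // big_map. Qed.

Lemma toR_sumN s : r (sumN s) = \sum_(a <- s) r a.
Proof. by elim: s => [|a s IH] /=; [rewrite big_nil toR0 | rewrite toRD IH big_cons]. Qed.

Opaque sumN logs_in prime_logs log16.

Lemma foldl_div_le (num den : N * N -> N) s P : (forall q, q \in s -> N.ltb N0 (den q)) ->
  r (foldl (fun P q => N.div (N.mul P (num q)) (den q)) P s) <=
  r P * \prod_(q <- s) (r (num q) / r (den q)).
Proof.
elim: s P => [|q s IH] P sP; first by rewrite big_nil mulr1.
have d0 := sP q (mem_head _ _); apply: le_trans (IH _ _) _ => [q' q's|].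
  by rewrite sP // inE q's orbT.
rewrite big_cons mulrA; apply: ler_wpM2r.
  by apply: prodr_ge0 => q' _; rewrite divr_ge0 ?toR_ge0.
by apply: le_trans (toR_div _ _ d0) _; rewrite toRM mulrA.
Qed.

Lemma mem_logs_in a b q : N.leb b 4096 -> q \in logs_in a b ->
  exists2 p, q = (N.of_nat p, log16 (N.of_nat p)) & [&& prime p, N.to_nat a < p & p <= N.to_nat
    b]%N.
Proof. by move=> b4; rewrite logs_inE // => /mapP[p]; rewrite mem_primes_in => h ->; exists p. Qed.

Lemma prime_pred_gt0 p : prime p -> N.ltb N0 (N.pred (N.of_nat p)).
Proof. by move/prime_gt1 => h; apply/N.ltb_lt; lia. Qed.

Lemma prime_sqr_pred_gt0 p : prime p -> N.ltb N0 (N.pred (N.mul (N.of_nat p) (N.of_nat p))).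
Proof. by move/prime_gt1 => h; apply/N.ltb_lt; nia. Qed.

Local Notation M := (N.to_nat 4096).

Lemma lnn_M : lnn M = 12 * lnn 2.
Proof.
have -> : M%:R = 2%:R ^+ 12 :> R by rewrite -[LHS](toRE R (N.pow 2 12)) toRX (toRE R 2).
by rewrite lnXn ?ltr0n // [12 * _](mulr_natl (lnn 2) 12).
Qed.

Lemma mertens_shift_ge :
  1 + \sum_(p <- primes_in 0 17) lnn p / (p%:R - 1) +
  \sum_(p <- primes_in 17 M) 2 * lnn p / (p%:R ^+ 2 - 1) + 2 * (lnn M + 2) / M%:R <=
  r mertens_shift / r D.
Proof.
have d0 := D0; have dn : r D != 0 by rewrite gt_eqF.
have split4 (a b c d t : R) : (a + b + c + d) / t = a / t + b / t + c / t + d / t.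
  by rewrite !mulrDl.
rewrite mertens_shiftE 3!toRD split4 [r D / r D]mulfV //.
apply: lerD; [apply: lerD; [apply: lerD|]|] => //.
- rewrite toR_sumN big_map big_logs_in // mulr_suml big_seq [leRHS]big_seq.
  apply: ler_sum => p; rewrite mem_primes_in /= => /and3P[pp _ _].
  have p0 := prime_gt0 pp; have q0 := prime_pred_gt0 pp; have q0' := toR_gt0 R q0.
  have pE : p%:R - 1 = r (N.pred (N.of_nat p)).
    by rewrite toR_pred ?toR_nat //; apply/N.ltb_lt; lia.
  rewrite pE ler_pdivlMr // mulrAC; apply: le_trans _ (toR_div_succ _ q0).
  by rewrite ler_wpM2r ?invr_ge0 ?toR_ge0 // -ler_pdivlMr // ln_hi_ge.
- rewrite toR_sumN big_map big_logs_in // mulr_suml big_seq [leRHS]big_seq.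
  apply: ler_sum => p; rewrite mem_primes_in /= => /and3P[pp _ _].
  have p0 := prime_gt0 pp; have q0 := prime_sqr_pred_gt0 pp; have q0' := toR_gt0 R q0.
  have pE : p%:R ^+ 2 - 1 = r (N.pred (N.mul (N.of_nat p) (N.of_nat p))).
    by rewrite toR_pred ?toRM ?toR_nat ?expr2 //; apply/N.ltb_lt; nia.
  rewrite pE ler_pdivlMr // mulrAC; apply: le_trans _ (toR_div_succ _ q0).
  rewrite ler_wpM2r ?invr_ge0 ?toR_ge0 // toRM (toRE R 2 : r 2 = 2) -mulrA ler_wpM2l //.
  by rewrite -ler_pdivlMr // ln_hi_ge.
rewrite ler_pdivlMr //; apply: le_trans _ (toR_div_succ _ _) => //.
rewrite toRM lnn_M (toRE R 21 : r 21 = 21) -[M%:R](toRE R 4096) [leLHS]mulrAC ler_wpM2r ?invr_ge0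
  ?toR_ge0 //.
rewrite mulrC ler_wpM2l ?(ltW d0) //; have := ln2_le R; lra.
Qed.

Lemma Lsum_ge17 m : (0 < m)%N -> lnn m - r mertens_shift / r D <= Lsum R 17 m.
Proof.
move=> m0; apply: le_trans (@Lsum_ge R 17 M m _ _ m0); try by lia.
by rewrite lerD2l lerN2 mertens_shift_ge.
Qed.

Lemma euler_const_le : r euler_const / r D <=
  \prod_(p <- primes_in 0 17) (1 - p%:R^-1) * \prod_(p <- primes_in 17 M) (1 - p%:R ^- 2)
       * (M%:R / (M%:R + 1)).
Proof.
have d0 := D0; have dn : r D != 0 by rewrite gt_eqF.
rewrite ler_pdivrMr // euler_constE; apply: le_trans (toR_div _ _ _) _ => //.
rewrite toRM -[4097%num]/(N.succ 4096) toR_succ -mulrA -[M%:R](toRE R 4096).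
rewrite [leRHS]mulrAC; apply: ler_wpM2r; first by rewrite divr_ge0 ?addr_ge0 ?toR_ge0.
have p1 p : prime p -> 1 - p%:R^-1 = r (N.pred (N.of_nat p)) / r (N.of_nat p).
  move=> pp; have p0 : p%:R != 0 :> R by rewrite pnatr_eq0 -lt0n prime_gt0.
  rewrite toR_pred ?toR_nat; last by apply/N.ltb_lt; have := prime_gt0 pp; lia.
  by field.
have p2 p : prime p -> 1 - p%:R ^- 2 = r (N.pred (N.mul (N.of_nat p) (N.of_nat p))) / r (N.mul
  (N.of_nat p) (N.of_nat p)).
  move=> pp; have p0 : p%:R != 0 :> R by rewrite pnatr_eq0 -lt0n prime_gt0.
  rewrite toR_pred ?toRM ?toR_nat; last by apply/N.ltb_lt; have := prime_gt0 pp; nia.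
  by field.
apply: le_trans (foldl_div_le _ _ _) _.
  by move=> q /(mem_logs_in _)[] // p -> /and3P[/prime_gt0 pp _ _]; apply/N.ltb_lt => /=; nia.
rewrite big_logs_in // [leRHS]mulrAC; apply: ler_pM.
- exact: toR_ge0.
- by apply: prodr_ge0 => p _; rewrite divr_ge0 ?toR_ge0.
- apply: le_trans (foldl_div_le _ _ _) _.
    by move=> q /(mem_logs_in _)[] // p -> /and3P[/prime_gt0 pp _ _]; apply/N.ltb_lt => /=; lia.
  rewrite big_logs_in // mulrC; apply: ler_wpM2r; first exact: ltW.
  rewrite le_eqVlt; apply/orP; left; apply/eqP; rewrite big_seq [RHS]big_seq.
  by apply: eq_bigr => p; rewrite mem_primes_in => /and3P[/p1-> _ _].
rewrite le_eqVlt; apply/orP; left; apply/eqP; rewrite big_seq [RHS]big_seq.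
by apply: eq_bigr => p; rewrite mem_primes_in => /and3P[/p2-> _ _].
Qed.

Lemma Pi_bound17 : exists2 C1 : R, 0 <= C1 &
  forall m, Pi R 17 m * (793 / 500 * (r euler_const / r D) * lnn m - C1) <= 1.
Proof.
have [C hC] := euler_prod_lower R.
apply: (Pi_bound _ hC (M := M)).
- by rewrite divr_ge0.
- by lia.
- by lia.
- by rewrite divr_ge0 ?toR_ge0.
exact: euler_const_le.
Qed.

End RealBounds.

(** * The initial potential as an integer computation *)

Definition slice_slack (t : N) : N := N.sub unit40 (Pi_lo t).
Definition slice_gain (t : N) : N :=
  N.add (N.mul (ln_lo (log16 t)) (slice_slack t)) (N.mul (Pi_lo t) (Lsum_lo t)).
Definition slice_loss (t : N) : N := N.mul mertens_shift (slice_slack t).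
(** As Pi = 1 and L = 0 at m = 17, the empty product starts with the potential kap (1 - Pi_t) + Pi_t
    L_t, where kap = ln t - E. Gain and loss are kept apart because subtraction in [N] truncates. *)
Definition slice_value (t : N) : N := N.div (N.sub (slice_gain t) (slice_loss t)) unit40.
Definition slice_test (t : N) : bool :=
  [&& N.leb (Pi_lo t) unit40, N.leb (slice_loss t) (slice_gain t), N.ltb 17 t & N.leb t 4096].
Definition slice_gap (t : N) (rest : seq (N * N)) : N :=
  if rest is q :: _ then N.div (N.mul unit40 (N.sub q.1 t)) (N.mul (N.mul 2 t) q.1)
  else N.div unit40 (N.mul 2 t).
Fixpoint slice_total (s : seq (N * N)) : N :=
  if s is q :: rest then
    N.add (N.mul (N.mul q.2 (slice_gap q.1 rest)) (slice_value q.1)) (slice_total rest)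
  else N0.

#[local] Arguments N.sub : simpl never.

Section SliceTotal.
Variable R : realType.
Local Notation lnn n := (ln (n%:R : R)).
Local Notation r := (@toR R).
Local Notation D := unit40.

Definition kappa (t : nat) : R := (r (ln_lo (log16 (N.of_nat t))) - r mertens_shift) / r D.

Lemma toR_sub a b : N.leb b a -> r (N.sub a b) = r a - r b.
Proof.
move=> /N.leb_le ba; apply: (@addIr _ (r b)); rewrite subrK -toRD; congr toR; lia.
Qed.

Let D0 : 0 < r D. Proof. exact: D_gt0. Qed.

Lemma kappa_le t : (0 < t)%N -> kappa t <= lnn t - r mertens_shift / r D.
Proof. by move=> t0; rewrite /kappa mulrBl lerD2r ln_lo_le. Qed.

Lemma Pi_lo_le t : N.leb t 4096 -> r (Pi_lo t) / r D <= Pi R 17 (N.to_nat t).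
Proof.
move=> t4; rewrite ler_pdivrMr // mulrC /Pi_lo;
  apply: le_trans (@foldl_div_le R (fun q => q.1) (fun q => N.succ q.1) _ _ _) _.
  by move=> q /(mem_logs_in t4)[p -> _] /=; apply/N.ltb_lt; lia.
rewrite big_logs_in // ler_wpM2l ?(ltW D0) // /Pi le_eqVlt; apply/orP; left; apply/eqP.
rewrite big_seq [RHS]big_seq; apply: eq_bigr => p;
  rewrite mem_primes_in => /and3P[/prime_gt0 p0 _ _] /=.
have p0' : 0 < p%:R :> R by rewrite ltr0n.
by rewrite toR_succ toR_nat; field; rewrite !gt_eqF ?addr_gt0.
Qed.

Lemma Lsum_lo_le t : N.leb t 4096 -> r (Lsum_lo t) / r D <= Lsum R 17 (N.to_nat t).
Proof.
move=> t4; rewrite /Lsum_lo toR_sumN big_map big_logs_in // mulr_suml big_seq [leRHS]big_seq.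
apply: ler_sum => p; rewrite mem_primes_in => /and3P[/prime_gt0 p0 _ _] /=.
have p0' : 0 < p%:R + 1 :> R by rewrite addr_gt0 ?ltr0n.
rewrite ler_pdivlMr // mulrAC; apply: le_trans (ln_lo_le R p0).
rewrite ler_wpM2r ?invr_ge0 ?(ltW D0) // -ler_pdivlMr //.
apply: le_trans (toR_div _ _ _) _; first by apply/N.ltb_lt; lia.
by rewrite toR_succ toR_nat.
Qed.

Lemma slice_value_le t : slice_test t ->
  r (slice_value t) / r D <= slice_pot 17 kappa [::] 17 (N.to_nat t).
Proof.
rewrite /slice_test => /and4P[PD lg t17 t4].
have t0 : (0 < N.to_nat t)%N by move/N.ltb_lt: t17; lia.
rewrite /slice_pot /= mul1r /end_value /pot big_nil ln1 divr1.
rewrite [Pi R 17 17]/Pi [Lsum R 17 17]/Lsum primes_in_nil // !big_nil.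
rewrite ler_pdivrMr //; apply: le_trans (toR_div _ _ _) _ => //.
rewrite toR_sub // /slice_gain /slice_loss toRD !toRM /slice_slack toR_sub // ler_pdivrMr //.
have := Pi_lo_le t4; have := Lsum_lo_le t4; have := Lsum_ge17 R t0; have := kappa_le t0.
have Pt := Pi_gt0 R 17 (N.to_nat t).
rewrite /kappa N2Nat.id -[(N.to_nat t)%:R](toRE R).
have P0 := toR_ge0 R (Pi_lo t).
move: (Pi R 17 _) (Lsum R 17 _) (ln _) Pt => P L l Pt.
move: (r (ln_lo _)) (r mertens_shift) (r (Pi_lo t)) (r (Lsum_lo t)) P0 => a e p s p0.
have d0 := D0; move: (r D) d0 => d d0; clear PD lg t17 t4 t0.
set k := (a - e) / d => h1 h2 h3 h4.
(* Nonnegativity of L - kap makes the potential increase with Pi, so lower bounds may replace both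
   Pi and L. *)
have kL : 0 <= L - k by lra.
have q0 : 0 <= p / d by rewrite divr_ge0 // ltW.
have m1 : p / d * (s / d - k) <= p / d * (L - k) by rewrite ler_wpM2l // lerD2r.
have m2 : p / d * (L - k) <= P * (L - k) by rewrite ler_wpM2r.
have -> : a * (d - p) + p * s - e * (d - p) =
    (k + p / d * (s / d - k)) * (d * d).
  by rewrite /k; field; rewrite gt_eqF.
rewrite -[leRHS]mulrA ler_wpM2r ?mulr_ge0 ?(ltW d0) //; lra.
Qed.

Lemma slice_gap_le t rest : N.ltb N0 t -> (forall q, q \in rest -> N.ltb t q.1) ->
  r (slice_gap t rest) / r D <=
  inv2 R (N.to_nat t) - next_value [seq (N.to_nat q.1, N.to_nat q.2) | q <- rest] (inv2 R).
Proof.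
move=> t0 tr; have tR := toR_gt0 R t0.
have inv2E u : inv2 R (N.to_nat u) = (2 * r u)^-1 by rewrite /inv2 natrM -(toRE R).
rewrite ler_pdivrMr //; case: rest tr => [_|q rest tr] /=.
  rewrite subr0 inv2E mulrC; apply: le_trans (toR_div _ _ _) _.
    by move/N.ltb_lt: t0 => t0; apply/N.ltb_lt; lia.
  by rewrite toRM (toRE R 2 : r 2 = 2).
have tq := tr q (mem_head _ _).
have q0 : N.ltb N0 q.1.
  by move/N.ltb_lt: (tq) => tq'; apply/N.ltb_lt/(N.le_lt_trans _ _ _ (N.le_0_l t) tq').
have qR := toR_gt0 R q0.
rewrite !inv2E; apply: le_trans (toR_div _ _ _) _.
  apply/N.ltb_lt/N.mul_pos_pos; last exact/N.ltb_lt.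
  by apply/N.mul_pos_pos => //; apply/N.ltb_lt.
rewrite !toRM (toRE R 2 : r 2 = 2) toR_sub; last first.
  exact/N.leb_le/N.lt_le_incl/N.ltb_lt.
rewrite le_eqVlt; apply/orP; left; apply/eqP; field.
by rewrite !gt_eqF.
Qed.

Definition slices (s : seq (N * N)) := [seq (N.to_nat q.1, N.to_nat q.2) | q <- s].

Lemma slice_test_gt t : slice_test t -> N.ltb 17 t.
Proof. by rewrite /slice_test => /and4P[]. Qed.

Lemma alive_nil t : N.ltb 17 t -> alive [::] 17 (N.to_nat t).
Proof. by move=> /N.ltb_lt h; rewrite /alive big_nil muln1; apply/andP; split => //; lia. Qed.

Lemma slice_total_le s : all (fun q => slice_test q.1) s ->
  sorted (fun q q' => N.ltb q.1 q'.1) s ->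
  r (slice_total s) / (r D * r D) <= potential (slices s) 17 kappa [::] 17.
Proof.
rewrite ler_pdivrMr ?mulr_gt0 // /potential.
elim: s => [|q s IH] /=; first by rewrite toR0 mul0r.
move=> /andP[tq ts] ss.
have trq : transitive (fun q q' : N * N => N.ltb q.1 q'.1).
  by move=> a b c /N.ltb_lt h1 /N.ltb_lt h2; apply/N.ltb_lt/(N.lt_trans _ _ _ h1 h2).
rewrite toRD mulrDl; apply: lerD; last exact: IH ts (path_sorted ss).
have t17 := slice_test_gt tq; have al := alive_nil t17.
have t0 : N.ltb N0 q.1 by apply/N.ltb_lt/(N.lt_trans _ 17) => //; apply/N.ltb_lt.
have h1 := slice_value_le tq.
have h2 : r (slice_gap q.1 s) / r D <= inv2 R (N.to_nat q.1) - next_value (slices s) (inv2 R).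
  apply: slice_gap_le => // q' q's.
  by have /allP/(_ _ q's) := order_path_min trq ss.
rewrite al mul1r !toRM (toRE R q.2) -/(slices s).
have -> : (N.to_nat q.2)%:R * r (slice_gap q.1 s) * r (slice_value q.1) =
  (N.to_nat q.2)%:R * (r (slice_gap q.1 s) / r D) * (r (slice_value q.1) / r D) * (r D * r D).
  by field; rewrite gt_eqF.
rewrite ler_wpM2r ?mulr_ge0 ?(ltW D0) //; apply: ler_pM => //.
- by rewrite mulr_ge0 // divr_ge0 ?toR_ge0.
- by rewrite divr_ge0 ?toR_ge0.
by rewrite ler_wpM2l.
Qed.

End SliceTotal.

(** * Choice of the thresholds *)

(** After multiplication by w H both sides are polynomials in H. The hypothesis says that the
    surplus of the quadratic terms outweighs the linear ones; the remaining constant term has the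
    right sign. *)
Lemma small_margin (R : realType) (g C3 i d j w be B F C1 H : R) :
  0 <= g -> 0 < C3 -> 0 <= C1 -> 0 <= F -> 0 <= i -> 0 <= d -> 0 < w -> 0 < H -> 0 <= be -> 0 <=
    B ->
  g * (C3 * i * F + (C3 + C1) * d) + be * C3 * B * w <= C3 * (g * i * d - be * j * w) * H ->
  be * C3 * (j * H + B) <= g * (C3 * (i * H - 1) - C1) / (w * H) * (d * H - F).
Proof.
move=> g0 C30 C10 F0 i0 d0 w0 H0 be0 B0 hT.
rewrite [leRHS]mulrAC ler_pdivlMr ?mulr_gt0 //.
have e0 : 0 <= g * ((C3 + C1) * F) by rewrite mulr_ge0 // mulr_ge0 // addr_ge0 // ltW.
have := ler_wpM2r (ltW H0) hT.
set X := (_ <= _) => h.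
have -> : be * C3 * (j * H + B) * (w * H) = be * C3 * B * w * H + C3 * (be * j * w) * H * H by ring.
have -> : g * (C3 * (i * H - 1) - C1) * (d * H - F) =
   C3 * (g * i * d) * H * H - g * (C3 * i * F + (C3 + C1) * d) * H + g * ((C3 + C1) * F) by ring.
move: h e0; rewrite /X mulrDl mulrBr mulrBl mulrBl.
move: (g * ((C3 + C1) * F)) (C3 * (g * i * d) * H * H) (C3 * (be * j * w) * H * H).
move: (g * (C3 * i * F + (C3 + C1) * d) * H) (be * C3 * B * w * H) => *; lra.
Qed.

Lemma summands_le (R : realType) (a b c d e f g H : R) :
  0 <= a -> 0 <= b -> 0 <= c -> 0 <= d -> 0 <= e -> 0 <= f -> 0 <= g ->
  1 + a + b + c + d + e + f + g <= H ->
  [/\ 1 <= H, a <= H, b <= H & c <= H] /\ [/\ d <= H, e <= H, f <= H & g <= H].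
Proof. by move=> *; do !split; lra. Qed.

Section Asymptotic.
Variable R : realType.
Local Notation lnn n := (ln (n%:R : R)).
Local Notation Y := (@expn_floor R).
Variables (sl : seq (nat * nat)) (tmax : nat).
Hypothesis sl_sorted : sorted slice_lt sl.
Hypothesis slP : forall s, s \in sl -> (0 < s.1 <= tmax)%N /\ (0 < s.2)%N.
Hypothesis tmax0 : (0 < tmax)%N.
Variables (K J1 J2 i1 i0 : nat) (D s r b G : N).
Hypothesis D0 : N.ltb N0 D.
Hypothesis r_small : N.leb (N.mul r (N.pow 10 6)) (N.mul (N.pred (N.pow 10 6)) (N.pow 2 s)).
Hypothesis i0K : (i0 <= K)%N.
Hypothesis J1i0 : (J1 < i0)%N.
Hypothesis J1K : (J1.+2 <= K)%N.
Hypothesis i1J1 : (0 < i1 < J1)%N.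
Hypothesis J12 : (J1 + i1 <= J2)%N.
Hypothesis testP : grid_test K J1 J2 i1 D s r b G (direct_row K D) i0 (nseq K N0).
Local Notation be := (toR R b / 100).
Local Notation g0 := (toR R G / toR R D).
Variable eta : R.
Hypothesis eta01 : 0 <= eta < 1.
Hypothesis b_gt0 : 0 < be.
Hypothesis strict : eta * be * J1%:R * (J2%:R - J1%:R) < g0 * i1%:R * (J2%:R - i1%:R - J1%:R).
Variables (z : nat) (C3 C1 E kmax : R) (kap : nat -> R).
Hypothesis Pi_le : forall m, Pi R z m * (C3 * lnn m - C1) <= 1.
Hypothesis L_ge : forall m, (0 < m)%N -> lnn m - E <= Lsum R z m.
Hypothesis C3_gt0 : 0 < C3.
Hypothesis C1_ge0 : 0 <= C1.
Hypothesis E_ge0 : 0 <= E.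
Hypothesis kap_le : forall s, s \in sl -> kap s.1 <= lnn s.1 - E.
Hypothesis kap_max : forall s, s \in sl -> kap s.1 <= kmax.
Hypothesis kmax_ge0 : 0 <= kmax.

(** With Kc = eta be C3, the slope condition of the main induction holds to leading order in H
    because eta < 1, and the condition for small primes because of [strict]. Large H then absorbs
    the rest. *)
Lemma gain_asymptotic : exists S : R, forall x, S <= lnn x ->
  eta * be * C3 * scale R x * potential sl z kap [::] z <=
  (possum (value sl x) (primes_in z x) [::])%:R.
Proof.
case/andP: eta01 => et0 et1.
have KR : 0 < K%:R :> R by rewrite ltr0n (leq_trans _ J1K).
pose sg : R := g0 * i1%:R * (J2%:R - i1%:R - J1%:R) - eta * be * J1%:R * (J2%:R - J1%:R).
have sg0 : 0 < sg by rewrite subr_gt0.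
pose B := E + kmax; pose F := 10 + E; pose d : R := J2%:R - i1%:R - J1%:R.
pose w : R := J2%:R - J1%:R.
pose T := g0 * (C3 * i1%:R * F + (C3 + C1) * d) + eta * be * C3 * B * w.
pose cexp : R := 36 * (slice_max sl)%:R * (10 ^+ 4 * (2 * tmax)%:R).
(* One threshold for H per largeness condition: h1 for Mertens' error in a cell, h2 for e^H to beat
   the error in the last prime (by e^H >= H^2 / 2), h3 for C1 <= C3 (i1 H - 1), h4 and h5 for the
   two conditions on Kc, h6 for ln tmax < H, h7 for z to lie below the first cells used. *)
pose h1 : R := 14 * 10 ^+ 6.
pose h2 := 2 * cexp * K%:R.
pose h3 := (C3 + C1) / C3.
pose h4 := (be * C1 + eta * be * C3 * B) / ((1 - eta) * be * C3).
pose h5 := T / (C3 * sg).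
pose h6 := lnn tmax + 1.
pose h7 := lnn z.
have B0 : 0 <= B by rewrite addr_ge0.
have F0 : 0 <= F by rewrite addr_ge0.
have d0 : 0 <= d by rewrite /d -addrA -opprD subr_ge0 -natrD ler_nat addnC.
have w0 : 0 < w by rewrite subr_gt0 ltr_nat; move: i1J1 J12; clear; lia.
have g00 : 0 <= g0 by rewrite divr_ge0 ?toR_ge0.
have be0 : 0 <= be by exact: ltW.
have T0 : 0 <= T.
  have C30 := ltW C3_gt0; have w0' := ltW w0; have cc := addr_ge0 C30 C1_ge0.
  by rewrite /T; do ?[by [] | exact: toR_ge0 | apply: addr_ge0 | apply: mulr_ge0 | rewrite
    invr_ge0].
have c0 : 0 <= cexp by rewrite !mulr_ge0 ?exprn_ge0.
have p1 : 0 <= h1 by rewrite mulr_ge0 ?exprn_ge0.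
have p2 : 0 <= h2 by rewrite !mulr_ge0.
have p3 : 0 <= h3 by rewrite divr_ge0 ?addr_ge0 // ltW.
have p4 : 0 <= h4.
  by rewrite divr_ge0 ?addr_ge0 ?mulr_ge0 ?subr_ge0 ?toR_ge0 ?invr_ge0 ?(ltW et1) ?(ltW C3_gt0).
have p5 : 0 <= h5 by rewrite divr_ge0 // mulr_ge0 // ltW.
have p6 : 0 <= h6 by rewrite addr_ge0 ?lnn_ge0.
have p7 : 0 <= h7 by rewrite lnn_ge0.
exists (K%:R * (1 + h1 + h2 + h3 + h4 + h5 + h6 + h7)) => x.
set H0s := 1 + _ + _ + _ + _ + _ + _ + _ => xS.
pose H := mesh R x K.
have LE : lnn x = K%:R * H by rewrite /H /mesh mulrC divfK // gt_eqF.
have HS : H0s <= H by move: xS; rewrite LE ler_pM2l.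
have [[H1 Hh1 Hh2 Hh3] [Hh4 Hh5 Hh6 Hh7]] := summands_le p1 p2 p3 p4 p5 p6 p7 HS.
have H0 : 0 < H by apply: lt_le_trans H1.
have K0 : (0 < K)%N by rewrite -(ltr0n R).
have Hexp : 36 * (slice_max sl)%:R * (10 ^+ 4 * (2 * tmax)%:R * lnn x) <= expR H.
  rewrite mulrA -/cexp LE.
  apply: le_trans (_ : _ <= 1 + H ^+ 2 / 2`!%:R) (expR_ge1Dxn 1 (ltW H0)).
  have -> : 2`!%:R = 2 :> R by [].
  apply: ler_wpDl => //; rewrite ler_pdivlMr // expr2.
  have -> : cexp * (K%:R * H) * 2 = h2 * H by rewrite /h2; ring.
  by rewrite ler_wpM2r // ltW.
have x0 : (0 < x)%N.
  by case: (x) LE => // L0; move: (mulr_gt0 KR H0); rewrite -L0 ln0 // ltxx.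
have le_x m : (0 < m)%N -> lnn m <= K%:R * H -> (m <= x)%N.
  by move=> m0; rewrite -LE ler_ln ?posrE ?ltr0n // ler_nat.
have H0j j : 0 <= j%:R * H by rewrite mulr_ge0 // ltW.
have top : (tmax * Y (J1.+1%:R * H) <= x)%N.
  apply: le_x; first by rewrite muln_gt0 tmax0 expn_floor_gt0.
  rewrite lnnM ?expn_floor_gt0 //.
  apply: (@le_trans _ _ (H + J1.+1%:R * H)).
    by rewrite lerD ?ln_expn_floor_le //; move: Hh6; rewrite /h6; lra.
  have -> : H + J1.+1%:R * H = J1.+2%:R * H by rewrite -[J1.+2%:R]natr1; ring.
  by rewrite ler_wpM2r ?ler_nat // ltW.
have i1H : H <= i1%:R * H by rewrite ler_peMl ?ler1n ?(ltW H0) //; case/andP: i1J1.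
have m1x : (Y (i1%:R * H) <= x)%N.
  apply: leq_trans top; apply: leq_trans (leq_pmull _ tmax0); apply: expn_floor_mono.
  by rewrite ler_wpM2r ?ler_nat ?(ltW H0) //; move: i1J1; clear; lia.
have zm1 : (z <= Y (J1%:R * H))%N.
  case: (posnP z) => [->//|z0]; rewrite leq_expn_floor //; apply: le_trans Hh7 _.
  apply: le_trans i1H _; rewrite ler_wpM2r ?ler_nat ?(ltW H0) //; move: i1J1; clear; lia.
have [dd dE] : exists dd, (z + dd = tmax * Y (J1%:R * H))%N.
  exists (tmax * Y (J1%:R * H) - z)%N; rewrite subnKC //.
  by apply: leq_trans zm1 _; rewrite leq_pmull.
have i1J1' : (0 < i1 <= J1)%N by move: i1J1; clear; lia.
have i1J : (0 < i1)%N && (i1 < J1)%N && (J1 < J2)%N by move: i1J1 J12; clear; lia.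
have U0 : 0 <= scale R x by apply: scale_ge0 K0 H1.
have slope := grid_slope sl_sorted slP K0 H1 Hh1 Hexp D0 r_small i0K J1i0 i1J1' testP.
have level := grid_level sl_sorted slP K0 H1 Hh1 Hexp D0 r_small i0K J1i0 i1J1' testP.
apply: (main_gain sl_sorted slP H0 U0 slope level g00 i1J Pi_le L_ge C3_gt0 C1_ge0 E_ge0
   kap_le kap_max kmax_ge0 _ m1x _ be0 _ _ _ top dE) => //.
- have : C3 * h3 <= C3 * (i1%:R * H) by rewrite ler_wpM2l ?(ltW C3_gt0) // (le_trans Hh3).
  rewrite /h3 mulrCA mulfV ?gt_eqF // mulr1 mulrBr mulr1; lra.
- exact: mulr_ge0 (mulr_ge0 et0 be0) (ltW C3_gt0).
- have e0 : 0 < (1 - eta) * be * C3 by rewrite mulr_gt0 // mulr_gt0 // subr_gt0.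
  have := Hh4; rewrite /h4 ler_pdivrMr //; rewrite -/B.
  move: (be) (B) (H) => b' B' H' hh; lra.
- rewrite -/w -/d -/B (_ : d * H - 10 - E = d * H - F); last by rewrite /F; ring.
  apply: small_margin => //; first by rewrite mulr_ge0.
  by rewrite -/T -/sg; move: Hh5; rewrite /h5 ler_pdivrMr ?mulr_gt0 // [H * _]mulrC.
- by move: Hh6; rewrite /h6; lra.
by rewrite big_nil ln1.
Qed.

End Asymptotic.

(* Numerical instance and conclusion *)
From mathcomp Require Import all_classical all_reals all_analysis.

Definition grid_unit : N := N.pow 2 20.
Definition grid_size : nat := N.to_nat 840.
Definition grid_J1 : nat := N.to_nat 104.
Definition grid_J2 : nat := N.to_nat 829.
Definition grid_i1 : nat := N.to_nat 10.
(** Half of K: two further primes above the square root of x have a product above x, so starting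
    there from a zero row loses nothing. *)
Definition grid_top : nat := N.to_nat 420.
(** The number 10.2 in units of 2^-20, rounded down. *)
Definition grid_level_bound : N := 10695475.

(* 16777199 is the integer part of (1 - 10^-6) 2^24. *)
Lemma grid_testP : grid_test grid_size grid_J1 grid_J2 grid_i1 grid_unit 24 16777199 96
  grid_level_bound (direct_row grid_size grid_unit) grid_top (nseq grid_size N0).
Proof. by vm_compute. Qed.

Lemma grid_ratio_test : N.leb (N.mul 16777199 (N.pow 10 6)) (N.mul (N.pred (N.pow 10 6)) (N.pow 2
  24)).
Proof. by []. Qed.

Lemma leaf_slices_test : all (fun q : N * N => slice_test q.1) leaf_slices.
Proof. by vm_compute. Qed.

Lemma leaf_slices_sorted :
  sorted (fun q q' : N * N => N.ltb q.1 q'.1 && N.leb q.2 q'.2) leaf_slices.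
Proof. by vm_compute. Qed.

Lemma leaf_slices_range : all (fun q : N * N => [&& N.ltb 0 q.1, N.leb q.1 4096 & N.ltb 0 q.2])
  leaf_slices.
Proof. by vm_compute. Qed.

Lemma leaf_slices_total :
  N.leb (N.mul 31 (N.mul unit40 unit40)) (N.mul 10 (slice_total leaf_slices)).
Proof. by vm_compute. Qed.

Lemma euler_const_bound : N.leb (N.mul 178 unit40) (N.mul 1000 euler_const).
Proof. by vm_compute. Qed.

Lemma grid_strict_test : N.leb (N.succ (N.mul (N.mul 999 (N.mul 96 (N.mul 104 725))) grid_unit))
  (N.mul (N.mul 1000 100) (N.mul grid_level_bound (N.mul 10 715))).
Proof. by []. Qed.

Definition leaf_sl : seq (nat * nat) := slices leaf_slices.
Definition leaf_tmax : nat := N.to_nat 4096.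
Lemma leaf_tmaxE : leaf_tmax = N.to_nat 4096. Proof. by []. Qed.
Lemma grid_J1E : grid_J1 = N.to_nat 104. Proof. by []. Qed.
Lemma grid_J2E : grid_J2 = N.to_nat 829. Proof. by []. Qed.
Lemma grid_i1E : grid_i1 = N.to_nat 10. Proof. by []. Qed.
Lemma grid_unit_gt0 : N.ltb N0 grid_unit. Proof. by []. Qed.
Lemma grid_ranges : [&& grid_top <= grid_size, grid_J1 < grid_top, grid_J1.+2 <= grid_size,
  0 < grid_i1 < grid_J1 & grid_J1 + grid_i1 <= grid_J2]%N.
Proof. by []. Qed.

Opaque slice_total leaf_slices leaf_data leaf_tmax grid_size grid_J1 grid_J2 grid_i1 grid_top
  grid_unit grid_level_bound.

Lemma leaf_sl_sorted : sorted slice_lt leaf_sl.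
Proof.
rewrite sorted_map; apply: sub_sorted leaf_slices_sorted => a b /andP[/N.ltb_lt h1 /N.leb_le h2].
by rewrite /slice_lt /=; apply/andP; split; move: h1 h2; clear; lia.
Qed.

Lemma leaf_slP q : q \in leaf_sl -> (0 < q.1 <= leaf_tmax)%N /\ (0 < q.2)%N.
Proof.
move=> /mapP[p pl ->] /=; have /and3P[/N.ltb_lt h1 /N.leb_le h2 /N.ltb_lt h3] := allP
  leaf_slices_range p pl.
rewrite leaf_tmaxE; split; last by move: h3; clear; lia.
by apply/andP; split; [move: h1; clear; lia | move: h2; clear; lia].
Qed.

Lemma ler_cross (R : realType) (a b c d : R) : 0 < b -> 0 < d -> a * d <= b * c -> a / b <= c / d.
Proof. by move=> b0 d0; rewrite ler_pdivrMr // mulrAC ler_pdivlMr // [c * b]mulrC. Qed.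

(** The factors are eta, the slope b / 100, C3 = 1.586 q, the scale and the initial potential;
    rounded down, their product is 0.7704... *)
Lemma numeric_bound (R : realType) (q P e : R) :
  e <= 1 / 1000 -> 31 / 10 <= P -> 178 / 1000 <= q ->
  77 / 100 <= 999 / 1000 * (96 / 100) * (793 / 500 * q) * (92 / 100 - e) * P.
Proof.
move=> he hP hq.
have h1 : 282 / 1000 <= 793 / 500 * q by lra.
have h2 : 919 / 1000 <= 92 / 100 - e by lra.
move: (793 / 500 * q) (92 / 100 - e) h1 h2 => u v h1 h2.
have h3 : 282 / 1000 * (919 / 1000) <= u * v by apply: ler_pM; lra.
have h4 : 282 / 1000 * (919 / 1000) * (31 / 10) <= u * v * P by apply: ler_pM; lra.
rewrite -!mulrA !(mulrA u); move: (u * v * P) h4 => w h4; lra.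
Qed.

Section LastSteps.
Variable R : realType.
Local Notation lnn n := (ln (n%:R : R)).
Local Notation r := (@toR R).
Local Notation eta := (r 999 / r 1000).

Lemma toR_lt a b : N.leb (N.succ a) b -> r a < r b.
Proof. by move/(toR_le R); apply: lt_le_trans; rewrite toR_succ ltrDl. Qed.

Lemma grid_strict : eta * (r 96 / 100) * grid_J1%:R * (grid_J2%:R - grid_J1%:R) <
  r grid_level_bound / r grid_unit * grid_i1%:R * (grid_J2%:R - grid_i1%:R - grid_J1%:R).
Proof.
have D0 : 0 < r grid_unit by apply/toR_gt0/grid_unit_gt0.
rewrite grid_J1E grid_J2E grid_i1E -!(toRE R).
have -> : 100 = r 100 by rewrite toRE.
have -> : r 829 - r 104 = r 725 by rewrite -toR_sub.
have -> : r 829 - r 10 - r 104 = r 715 by rewrite -!toR_sub.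
have := toR_lt grid_strict_test; rewrite !toRM => h.
have h3 : 0 < r 1000 by apply: toR_gt0.
have h4 : 0 < r 100 by apply: toR_gt0.
have -> : r grid_level_bound / r grid_unit * r 10 * r 715 =
  r grid_level_bound * (r 10 * r 715) / r grid_unit by rewrite mulrAC -!mulrA [_ / _]mulrC; ring.
rewrite ltr_pdivlMr //.
have -> : r 999 / r 1000 * (r 96 / r 100) * r 104 * r 725 * r grid_unit =
  r 999 * (r 96 * (r 104 * r 725)) * r grid_unit / (r 1000 * r 100).
  by field; rewrite !gt_eqF.
by rewrite ltr_pdivrMr ?mulr_gt0 // [ltRHS]mulrC.
Qed.

Lemma path_max_possum x : (12 <= x)%N ->
  (possum (value leaf_sl x) (primes_in 17 x) [::] <= (divisor_path_max x).+1)%N.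
Proof.
move=> x12; have := @divisor_path_weight 17 x (leaf x) isT x12 (@leaf_valid x).
apply: leq_trans.
have lw Q q : (0 < Q)%N -> q \in leaf_sl -> (2 * q.1 * Q <= x)%N -> (q.2 <= (size (leaf x Q)).+1)%N.
  move=> Q0 /mapP[p /mapP[d dl ->] ->] /= h.
  have := leaf_max dl h; move: (size d.2) (size _); clear; lia.
have pr : all prime (rev (primes_in 17 x)) by rewrite all_rev filter_all.
have := subsum_weight lw (T := [::]) pr isT.
rewrite revK big_nil; apply: leq_trans.
by rewrite subsumE; apply: leq_addl.
Qed.

Lemma path_max_asymptotic : exists S : R, forall x, S <= lnn x ->
  77 / 100 * (x%:R / lnn x) <= (divisor_path_max x)%:R + 1.
Proof.
have q178 : r 178 / r 1000 <= r euler_const / r unit40.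
  have := toR_le R euler_const_bound; rewrite !toRM.
  have d0 := D_gt0 R; have d3 : 0 < r 1000 by apply: toR_gt0.
  by rewrite ler_pdivlMr // mulrAC ler_pdivrMr // [r 1000 * _]mulrC.
have [C1 C10] := Pi_bound17 R.
move: (r euler_const / r unit40) q178 => q q178.
have q0 : 0 < q by apply: lt_le_trans q178; rewrite divr_gt0 ?toR_gt0.
move=> Pi_le.
have c0 : 0 < 793 / 500 :> R by apply: divr_gt0; rewrite ltr0n.
have [c c0' [cE]] : exists2 c : R, 0 < c & c = 793 / 500 /\ forall m, Pi R 17 m * (c * q * lnn m
  - C1) <= 1.
  by exists (793 / 500).
set C3 := c * q => {}Pi_le.
have C30 : 0 < C3 by apply: mulr_gt0.
have eta01 : 0 <= eta < 1.
  rewrite divr_ge0 ?toR_ge0 //= ltr_pdivrMr ?mul1r; last exact: toR_gt0.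
  exact: toR_lt.
have b0 : 0 < r 96 / 100 by rewrite divr_gt0 // toR_gt0.
have E0 : 0 <= r mertens_shift / r unit40 by rewrite divr_ge0 ?toR_ge0.
have kl s : s \in leaf_sl -> kappa R s.1 <= lnn s.1 - r mertens_shift / r unit40.
  by move=> /leaf_slP[/andP[s0 _] _]; apply: kappa_le.
have km s : s \in leaf_sl -> kappa R s.1 <= lnn leaf_tmax.
  move=> sl; apply: le_trans (kl s sl) _; have [/andP[s0 st] _] := leaf_slP sl.
  by apply: (@le_trans _ _ (lnn s.1)); [rewrite lerBlDr lerDl | apply: ler_lnn].
have tm0 : (0 < leaf_tmax)%N by rewrite leaf_tmaxE; clear; lia.
have /and5P[g1 g2 g3 g4 g5] := grid_ranges.
have [S hS] := gain_asymptotic leaf_sl_sorted leaf_slP tm0 grid_unit_gt0 grid_ratio_test g1 g2 g3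
  g4 g5
  grid_testP eta01 b0 grid_strict Pi_le (@Lsum_ge17 R) C30 C10 E0 kl km (lnn_ge0 R _).
exists (S + `|S| + lnn 12 + 1) => x xS.
have ln12 := lnn_ge0 R 12.
have Sx : S <= lnn x by have := ler_norm S; have := normr_ge0 S; move: xS ln12;
  move: `|S| (lnn 12) (lnn x) => *; lra.
have L1 : 1 <= lnn x by have := ler_norm (- S); rewrite normrN; move: xS ln12;
  move: `|S| (lnn 12) (lnn x) => *; lra.
have L12 : lnn 12 <= lnn x by have := ler_norm (- S); rewrite normrN; move: xS;
  move: `|S| (lnn 12) (lnn x) => *; lra.
have x0 : (0 < x)%N by case: (x) L1 => //; rewrite ln0 // ler10.
have x12 : (12 <= x)%N by rewrite -(ler_nat R) -ler_ln // posrE ltr0n.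
have := hS x Sx; set P := potential _ _ _ _ _ => hP.
have P31 : r 31 / r 10 <= P.
  have srt : sorted (fun q q' : N * N => N.ltb q.1 q'.1) leaf_slices.
    by apply: sub_sorted leaf_slices_sorted => a b /andP[].
  apply: le_trans (slice_total_le R leaf_slices_test srt); apply: ler_cross => //.
  - exact: toR_gt0.
  - by rewrite mulr_gt0 ?D_gt0.
  by rewrite -!toRM; apply: toR_le leaf_slices_total.
rewrite natr1; apply: le_trans (_ : _ <= (possum (value leaf_sl x) (primes_in 17 x) [::])%:R) _;
  last first.
  by rewrite ler_nat path_max_possum.
apply: le_trans hP; rewrite /scale.
have X0 : 0 <= x%:R / lnn x by rewrite divr_ge0 // lnn_ge0.
have e4 : (10 ^+ 4 : R)^-1 <= 1 / 1000.
  rewrite div1r lef_pV2 ?posrE ?exprn_gt0 ?ltr0n //.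
  by rewrite -natrX ler_nat.
have num : 77 / 100 <= eta * (r 96 / 100) * C3 * (92 / 100 - (10 ^+ 4)^-1) * P.
  have P31' : 31 / 10 <= P by move: P31; rewrite !toRE.
  have q178' : 178 / 1000 <= q by move: q178; rewrite !toRE.
  have e999 : eta = 999 / 1000 by rewrite !toRE.
  have b96 : r 96 = 96 by rewrite toRE.
  by rewrite e999 b96 /C3 cE; apply: numeric_bound.
have -> : eta * (r 96 / 100) * C3 * ((92 / 100 - (10 ^+ 4)^-1) * (x%:R / lnn x)) * P =
  eta * (r 96 / 100) * C3 * (92 / 100 - (10 ^+ 4)^-1) * P * (x%:R / lnn x) by ring.
by rewrite ler_wpM2r.
Qed.

End LastSteps.

Local Open Scope classical_set_scope.

Theorem corollary1 (R : realType) :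
  \forall n \near \oo,
    76898%N%:R / 10 ^+ 5 * (n%:R / ln n%:R) < (divisor_path_max n)%:R :> R.
Proof.
have [S hS] := path_max_asymptotic R.
(* From ln n > 2000 and e^L >= 1 + L^2 / 2 follows n / ln n > 1000; then the margin between 0.77 and
   0.769 exceeds the 1 added to the path length. *)
exists (expn_floor (`|S| + 2 * 10 ^+ 3)).+1 => // n /= nS.
have T0 : 0 <= 2 * 10 ^+ 3 :> R by rewrite mulr_ge0 ?exprn_ge0.
have A0 := normr_ge0 S; have AS := ler_norm S.
have n0 : (0 < n)%N by apply: leq_trans nS.
have Ln : `|S| + 2 * 10 ^+ 3 < ln (n%:R : R).
  by rewrite ltNge -leq_expn_floor // -ltnNge.
have L0 : 0 < ln (n%:R : R) by apply: le_lt_trans Ln; rewrite addr_ge0.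
have h : 77 / 100 * (n%:R / ln n%:R) <= (divisor_path_max n)%:R + 1 :> R.
  by apply: hS; apply: le_trans (ltW Ln); rewrite (le_trans AS) // lerDl.
have X : 10 ^+ 3 < n%:R / ln n%:R :> R.
  rewrite ltr_pdivlMr //.
  have := @expR_ge1Dxn R _ 1 (ltW L0); rewrite lnK ?posrE ?ltr0n //.
  have -> : 2`!%:R = 2 :> R by [].
  apply: lt_le_trans; rewrite expr2.
  apply: (@le_lt_trans _ _ (ln n%:R * ln n%:R / 2)); last by rewrite ltrDr.
  rewrite ler_pdivlMr // mulrAC ler_wpM2r ?(ltW L0) //.
  by apply: le_trans (ltW Ln); rewrite mulrC lerDr.
have N1 : 76898%N%:R / 10 ^+ 5 <= 769 / 1000 :> R.
  have E3 : 10 ^+ 3 = 1000%:R :> R by rewrite -natrX.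
  have E2 : 10 ^+ 2 = 100%:R :> R by rewrite -natrX.
  rewrite ler_pdivrMr ?exprn_gt0 ?ltr0n // (exprD _ 3 2) E2 mulrA -E3 divfK ?expf_neq0 ?pnatr_eq0
    //.
  by rewrite -natrM ler_nat; vm_compute.
have X0 : 0 < n%:R / ln n%:R :> R by apply: lt_trans X; rewrite exprn_gt0 ?ltr0n.
apply: le_lt_trans (ler_wpM2r (ltW X0) N1) _.
have E3 : 10 ^+ 3 = 1000 :> R by rewrite -natrX.
rewrite E3 in X; move: (n%:R / ln n%:R) (divisor_path_max n)%:R h X => y p h X; lra.
Qed.
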